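(* Let $\beta>0$. For every Riemannian metric $g$ on the Klein bottle $K$ conformal to $g_\beta$: (1) If $0<\beta\le 2\ln(2+\sqrt{3})$, then $$L_\sigma(g)\,l_v(g)\le \frac{\arcsin\left(\frac{e^{\beta}-1}{e^{\beta}+1}\right)}{\frac{e^{\beta}-1}{e^{\beta}+1}}\,\mathrm{vol}(g).$$ (2) If $\beta>2\ln(2+\sqrt{3})$, then $$L_\sigma(g)\,l_v(g)\le \frac{2}{3}\cdot\frac{3\beta+4\pi-6\ln(2+\sqrt{3})}{4\sqrt{3}+\beta-2\ln(2+\sqrt{3})}\,\mathrm{vol}(g).$$ Moreover, equality is achieved by a spherical metric in case (1) and by a flat-spherical metric in case (2).
   Context: The Klein bottle $K$ is the quotient of $\mathbb{R}^2=\mathbb{C}$ by the group generated by $\sigma: z\mapsto \bar z+\pi$ and $t: z\mapsto z+2i\beta$, with $\beta>0$; $g_\beta$ is the flat metric induced on $K$ by the Euclidean metric. The group is identified with $\pi_1(K)$. A metric $g$ is conformal to $g_\beta$ if $g=\varphi^2 g_\beta$ for a positive function $\varphi$ on $K$; continuous metrics (continuous $\varphi$) are admitted. $\mathrm{vol}(g)$ is the total area. Lengths, measured with respect to $g$: - $l_\sigma(g)$: least length of a closed curve in the free homotopy class of the glide reflection $\sigma$; - $l_v(g)$: least length of a closed curve in the free homotopy class of the vertical translation $t$; - $l_h(g)$: least length of a closed curve in the free homotopy class of the horizontal translation $\sigma^2$; - $L_\sigma(g)$: least length of a curve freely homotopic to a geodesic loop closed by a (nontrivial) element of the subgroup $\langle\sigma\rangle$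 generated by $\sigma$; since the only candidates are $\sigma$ and $\sigma^2$, $L_\sigma(g)=\inf\{l_\sigma(g),l_h(g)\}$. A metric is called spherical if, outside a finite union of curves where it is only continuous, it is locally isometric, up to one global scaling constant, to the round unit sphere; it is called flat-spherical if, outside a finite union of curves where it is only continuous, it is locally isometric, up to one global scaling constant, either to the round unit sphere or to the Euclidean plane, both types occurring.
   Formalization: The vertical translation is taken as t: z ↦ z+iβ rather than z ↦ z+2iβ; with the printed period 2β both bounds fail (e.g. the metric with φ = 1/cosh y on |y| ≤ β for β = ln(2+√3)), while all formulas of the statement are kept. *)

(* Defs.v *)
From HB Require Import structures.
From mathcomp Require Import all_boot all_order all_algebra generic_quotient.
From mathcomp Require Import all_classical all_reals all_analysis.

Set Implicit Arguments.
Unset Strict Implicit.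
Unset Printing Implicit Defensive.

Import Order.TTheory GRing.Theory Num.Theory.
Import numFieldNormedType.Exports.

Local Open Scope classical_set_scope.
Local Open Scope ring_scope.
Local Open Scope quotient_scope.

(* The point (x, y) stands for x + i y. The norm of the library on this product
   is the sup norm, which gives the right topology but not the Euclidean
   lengths; those are written out below. *)
Notation plane R := (R * R)%type.

Definition glide (R : realType) (z : plane R) : plane R := (z.1 + pi, - z.2).
Definition glideV (R : realType) (z : plane R) : plane R := (z.1 - pi, - z.2).

(* The vertical period is b, with fundamental domain [0, pi] x [0, b]. It is
   sometimes taken to be 2 b instead, but the bounds asin s / s with
   s = (e^b - 1) / (e^b + 1) = tanh (b / 2), and the critical value
   b = 2 ln (2 + sqrt 3), i.e. cosh (b / 2) = 2, belong to the period b: they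
   come from the metric (dx^2 + dy^2) / cosh^2 y on the band |y| <= b / 2. With
   the period 2 b this metric lives on |y| <= b, where it gives the value
   asin (tanh b) / tanh b, which is larger than asin s / s. *)
Definition vtrans (R : realType) (b : R) (z : plane R) : plane R :=
  (z.1, z.2 + b).

Inductive deck (R : realType) (b : R) : (plane R -> plane R) -> Prop :=
| deck_id : deck b id
| deck_glide g : deck b g -> deck b (@glide R \o g)
| deck_glideV g : deck b g -> deck b (@glideV R \o g)
| deck_vtrans g : deck b g -> deck b (vtrans b \o g)
| deck_vtransV g : deck b g -> deck b (vtrans (- b) \o g).

Section Quotient.
Variables (R : realType) (b : R).

Definition same_orbit (z w : plane R) : bool :=
  `[< exists2 g, deck b g & w = g z >].

Lemma glideK : cancel (@glide R) (@glideV R).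
Proof. by case=> x y; rewrite /glide /glideV /= addrK opprK. Qed.

Lemma glideVK : cancel (@glideV R) (@glide R).
Proof. by case=> x y; rewrite /glide /glideV /= subrK opprK. Qed.

Lemma vtransK (a : R) : cancel (vtrans a) (vtrans (- a)).
Proof. by case=> x y; rewrite /vtrans /= addrK. Qed.

Lemma vtransVK (a : R) : cancel (vtrans (- a)) (vtrans a).
Proof. by case=> x y; rewrite /vtrans /= subrK. Qed.

Lemma deck_comp (g h : plane R -> plane R) :
  deck b g -> deck b h -> deck b (g \o h).
Proof.
move=> dg dh; elim: dg => [|k _ IH|k _ IH|k _ IH|k _ IH].
- exact: dh.
- exact: (deck_glide IH).
- exact: (deck_glideV IH).
- exact: (deck_vtrans IH).
- exact: (deck_vtransV IH).
Qed.

Lemma deck_inv (g : plane R -> plane R) :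
  deck b g -> exists2 h, deck b h & cancel g h.
Proof.
have d0 := deck_id b.
elim=> [|k _ [h dh kh]|k _ [h dh kh]|k _ [h dh kh]|k _ [h dh kh]].
- by exists id.
- exists (h \o (@glideV R \o id)); first exact: deck_comp dh (deck_glideV d0).
  by move=> z /=; rewrite glideK kh.
- exists (h \o (@glide R \o id)); first exact: deck_comp dh (deck_glide d0).
  by move=> z /=; rewrite glideVK kh.
- exists (h \o (vtrans (- b) \o id)).
    exact: deck_comp dh (deck_vtransV d0).
  by move=> z /=; rewrite vtransK kh.
- exists (h \o (vtrans b \o id)); first exact: deck_comp dh (deck_vtrans d0).
  by move=> z /=; rewrite vtransVK kh.
Qed.

Lemma same_orbit_refl : reflexive same_orbit.
Proof. by move=> z; apply/asboolP; exists id => //; exact: deck_id. Qed.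

Lemma same_orbit_sym : symmetric same_orbit.
Proof.
move=> z w; apply/asboolP/asboolP => -[g dg ->];
  by have [h dh gh] := deck_inv dg; exists h.
Qed.

Lemma same_orbit_trans : transitive same_orbit.
Proof.
move=> y x z /asboolP[g dg ->] /asboolP[h dh ->]; apply/asboolP.
by exists (h \o g) => //; exact: deck_comp.
Qed.

Canonical same_orbit_equiv :=
  EquivRel same_orbit same_orbit_refl same_orbit_sym same_orbit_trans.

Definition klein : Type := quotient_topology {eq_quot same_orbit}.
Definition klein_pi (z : plane R) : klein := \pi_klein z.

End Quotient.

(* phi is the factor of the metric phi ^ 2 times the flat one. *)
Definition conformal_factor (R : realType) (b : R) (phi : klein b -> R) : Prop :=
  continuous phi /\ forall p, 0 < phi p.

Definition vol (R : realType) (b : R) (phi : klein b -> R) : R :=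
  \int[(lebesgue_measure \x lebesgue_measure)%E]_(z in `[0, pi] `*` `[0, b])
    phi (klein_pi b z) ^+ 2.

Definition C1_on (R : realType) (c : R -> plane R) (s t : R) : Prop :=
  {within `[s, t], continuous c} /\
  exists d : R -> plane R, {within `[s, t], continuous d} /\
    forall u, u \in `]s, t[ -> is_derive u 1 c (d u).

Definition piecewise_C1 (R : realType) (c : R -> plane R) : Prop :=
  exists (n : nat) (s : nat -> R),
    [/\ s 0%N = 0, s n = 1,
        forall i, (i < n)%N -> s i < s i.+1 &
        forall i, (i < n)%N -> C1_on c (s i) (s i.+1)].

(* A curve in the Klein bottle is given by a lift c : [0, 1] -> plane, and is
   closed in the quotient. *)
Definition closed_curve (R : realType) (b : R) (c : R -> plane R) : Prop :=
  piecewise_C1 c /\ klein_pi b (c 0) = klein_pi b (c 1).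

Definition curve_length (R : realType) (b : R) (phi : klein b -> R)
    (c : R -> plane R) : R :=
  \int[lebesgue_measure]_(t in `[0, 1])
    (phi (klein_pi b (c t)) *
     Num.sqrt (derive1 (fun u => (c u).1) t ^+ 2 +
               derive1 (fun u => (c u).2) t ^+ 2)).

Definition freely_homotopic (R : realType) (T : topologicalType)
    (c0 c1 : R -> T) : Prop :=
  exists H : R * R -> T,
    [/\ {within `[0, 1] `*` `[0, 1], continuous H},
        forall t, t \in `[0, 1] -> H (0, t) = c0 t,
        forall t, t \in `[0, 1] -> H (1, t) = c1 t &
        forall s, s \in `[0, 1] -> H (s, 0) = H (s, 1)].

(* The loop of the Klein bottle that the identification of the deck group with
   the fundamental group attaches to g: the image of the segment from the origin
   to its image under g. *)
Definition deck_loop (R : realType) (b : R) (g : plane R -> plane R) (t : R) :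
  klein b := klein_pi b ((1 - t) *: (0 : plane R) + t *: g 0).

Definition min_length (R : realType) (b : R) (phi : klein b -> R)
    (g : plane R -> plane R) : R :=
  inf [set curve_length phi c | c in
    [set c | closed_curve b c /\
             freely_homotopic (klein_pi b \o c) (deck_loop b g)]].

Definition l_sigma (R : realType) (b : R) (phi : klein b -> R) : R :=
  min_length phi (@glide R).
Definition l_v (R : realType) (b : R) (phi : klein b -> R) : R :=
  min_length phi (vtrans b).
Definition l_h (R : realType) (b : R) (phi : klein b -> R) : R :=
  min_length phi (@glide R \o @glide R).
Definition L_sigma (R : realType) (b : R) (phi : klein b -> R) : R :=
  Num.min (l_sigma phi) (l_h phi).

Definition dotp (R : realType) (n : nat) (u v : 'rV[R]_n) : R :=
  \sum_(i < n) u 0 i * v 0 i.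

(* On U, f is C^1 and pulls the Euclidean inner product back to the metric
   (lam * phi) ^ 2 (dx ^ 2 + dy ^ 2). *)
Definition isometric_on (R : realType) (b : R) (phi : klein b -> R) (lam : R)
    (n : nat) (U : set (plane R)) (f : plane R -> 'rV[R]_n.+1) : Prop :=
  [/\ forall w, U w -> differentiable f w,
      forall w u, U w -> {for w, continuous ('D_u f)} &
      forall w u v, U w ->
        dotp ('D_u f w) ('D_v f w) =
        (lam * phi (klein_pi b w)) ^+ 2 * (u.1 * v.1 + u.2 * v.2)].

Definition round_at (R : realType) (b : R) (phi : klein b -> R) (lam : R)
    (z : plane R) : Prop :=
  exists (U : set (plane R)) (f : plane R -> 'rV[R]_3),
    [/\ open U, U z, isometric_on phi lam U f &
        forall w, U w -> dotp (f w) (f w) = 1].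

Definition flat_at (R : realType) (b : R) (phi : klein b -> R) (lam : R)
    (z : plane R) : Prop :=
  exists (U : set (plane R)) (f : plane R -> 'rV[R]_2),
    [/\ open U, U z & isometric_on phi lam U f].

Definition off_curves (R : realType) (b : R) (n : nat)
    (c : 'I_n -> R -> plane R) (z : plane R) : Prop :=
  forall i t, t \in `[0, 1] -> klein_pi b (c i t) <> klein_pi b z.

Definition spherical (R : realType) (b : R) (phi : klein b -> R) : Prop :=
  exists (lam : R) (n : nat) (c : 'I_n -> R -> plane R),
    [/\ 0 < lam, forall i, piecewise_C1 (c i) &
        forall z, off_curves b c z -> round_at phi lam z].

Definition flat_spherical (R : realType) (b : R) (phi : klein b -> R) : Prop :=
  exists (lam : R) (n : nat) (c : 'I_n -> R -> plane R),
    [/\ 0 < lam, forall i, piecewise_C1 (c i),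
        forall z, off_curves b c z -> round_at phi lam z \/ flat_at phi lam z,
        exists2 z, off_curves b c z & round_at phi lam z &
        exists2 z, off_curves b c z & flat_at phi lam z].

(* Main.v *)
(* Pull the conformal factor back to the plane and let f y be its mean over the
   horizontal circle of height y. Then l_h <= 2 pi f y, l_v is at most the
   integral of f over a period, and vol is at least 2 pi times the integral of
   f ^ 2 over half a period. In the spherical metric (dx^2 + dy^2) / cosh^2 y the
   great circles are the curves sinh y = h cos x, and a half of such a curve is a
   lift of a curve in the class of sigma. Averaging l_sigma over the horizontal
   translates of these curves bounds from below an Abel transform of f, whose
   inversion gives asin (tanh a) L_sigma <= pi times the integral of f over
   [0, a], for all a. With the profile f0 y = 1 / cosh (min (y, A)), where
   A = min (b / 2, ln (2 + sqrt 3)), these bounds on f and the Cauchy-Schwarz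
   inequality for f and f0 give the estimate.

   The metric of factor f0, extended to an even function of period b, attains it:
   the length of a curve is at least the increment along a lift of any function
   whose local Lipschitz constant is at most f0. Such functions are x / 2 for
   sigma ^ 2, a primitive of f0 for t and, for sigma, - asin (k <p0, p>) with
   k < 1 tending to 1, where p is the point of the unit sphere with coordinates
   (x, y): the end points of a lift of the curve are antipodal on the sphere. *)

(* The threshold [cosh A <= 2] has two sources that agree. In the extremal metric the circle at
   height y has length [2 pi f0 y], at least pi, the length found for sigma, exactly while
   [f0 y >= 1 / 2]. In the estimate, the bounds on the integrals of f over [0, a] are tested against
   the decreasing weight [f0 - k], where [k = E / (2 I)] and E, I are the integrals of [f0 ^ 2] and
   f0. The weight has to be nonnegative at A, and only [k <= 1 / 2] is known, from [E <= I]. Beyond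
   A the pointwise bound from l_h takes over.

   The Abel transform of f is only bounded below, so the inversion has to use a positive kernel: it
   is an integration against a positive weight, evaluated on even polynomials by Wallis integrals.

   For the lower bounds on lengths, the obstacle is that free homotopy lives in the quotient: one
   has to show that a lift ends at a known deck image of its starting point, so homotopies are
   lifted by hand on a fine grid. The functions compared with f0 are only locally Lipschitz and have
   no chain rule along a curve; a Dini derivative argument replaces it. *)
From HB Require Import structures.
Require Import Defs.
From mathcomp Require Import all_boot all_order all_algebra generic_quotient.
From mathcomp Require Import all_classical all_reals all_analysis measurable_realfun.
From mathcomp Require Import ring lra.

Set Implicit Arguments.
Unset Strict Implicit.
Unset Printing Implicit Defensive.

Import Order.TTheory GRing.Theory Num.Theory.
Import numFieldNormedType.Exports.

(** * Syntax-directed rules for derivatives *)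

Section Derivatives.
Local Open Scope ring_scope.
Context {R : realType}.
Implicit Types (f g : R -> R) (x a b c : R).

(* [is_derive] is a class: this alias keeps the instance search from
   instantiating the derivative when the lemmas below are applied. *)
Definition has_der f x a : Prop := is_derive x 1 f a.

Lemma der_eq f x a b : has_der f x a -> a = b -> is_derive x 1 f b.
Proof. by move=> df <-. Qed.

Lemma der_cst c x : has_der (fun=> c) x 0.
Proof. exact: is_derive_cst. Qed.

Lemma der_id x : has_der (fun y => y) x 1.
Proof. exact: is_derive_id. Qed.

Lemma derD f g x a b : has_der f x a -> has_der g x b ->
  has_der (fun y => f y + g y) x (a + b).
Proof. exact: is_deriveD. Qed.

Lemma derN f x a : has_der f x a -> has_der (fun y => - f y) x (- a).
Proof. exact: is_deriveN. Qed.

Lemma derM f g x a b : has_der f x a -> has_der g x b ->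
  has_der (fun y => f y * g y) x (f x * b + g x * a).
Proof. exact: is_deriveM. Qed.

Lemma der_comp (h : R -> R) f x a b : has_der h (f x) b -> has_der f x a ->
  has_der (fun y => h (f y)) x (b * a).
Proof. exact: is_derive1_comp. Qed.

Lemma derX f n x a : has_der f x a ->
  has_der (fun y => f y ^+ n) x (n%:R * f x ^+ n.-1 * a).
Proof.
move=> df; apply: (der_comp (h := fun y => y ^+ n)) => //.
elim: n => [|n IH].
  by rewrite mul0r; apply: der_eq (der_cst 1 (f x)) _.
have := derM (der_id (f x)) IH.
under [X in has_der X]eq_fun do rewrite -exprS.
move=> H; apply: der_eq H _ => /=.
by case: n {IH} => [|n]; rewrite ?expr0 /= -?natr1 ?exprS; ring.
Qed.

Lemma derV f x a : f x != 0 -> has_der f x a ->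
  has_der (fun y => (f y)^-1) x (- (f x ^+ 2)^-1 * a).
Proof. exact: is_deriveV. Qed.

Lemma der_sin f x a : has_der f x a ->
  has_der (fun y => sin (f y)) x (cos (f x) * a).
Proof. by apply: der_comp; exact: is_derive_sin. Qed.

Lemma der_cos f x a : has_der f x a ->
  has_der (fun y => cos (f y)) x (- sin (f x) * a).
Proof. by apply: der_comp; exact: is_derive_cos. Qed.

Lemma der_expR f x a : has_der f x a ->
  has_der (fun y => expR (f y)) x (expR (f x) * a).
Proof. by apply: der_comp; exact: is_derive_expR. Qed.

Lemma der_ln f x a : 0 < f x -> has_der f x a ->
  has_der (fun y => ln (f y)) x ((f x)^-1 * a).
Proof. by move=> ?; apply: der_comp; exact: is_derive1_ln. Qed.

Lemma der_sqrt f x a : 0 < f x -> has_der f x a ->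
  has_der (fun y => Num.sqrt (f y)) x ((2 * Num.sqrt (f x))^-1 * a).
Proof. by move=> ?; apply: der_comp; exact: is_derive1_sqrt. Qed.

Lemma der_asin f x a : -1 < f x < 1 -> has_der f x a ->
  has_der (fun y => asin (f y)) x ((Num.sqrt (1 - f x ^+ 2))^-1 * a).
Proof. by move=> ?; apply: der_comp; exact: is_derive1_asin. Qed.

End Derivatives.

(** Meant to follow [der_eq]: the derivative is then an existential variable that the descent
    through the term fills in, and the second goal of [der_eq] compares it with the expected
    formula. Side conditions (nonzero denominators, ranges of [ln], [sqrt] and [asin]) are left to
    the caller. *)
Ltac der := lazymatch goal with
  | |- has_der (fun _ => ?c) _ _ => exact: der_cst
  | |- has_der (fun x => x) _ _ => exact: der_id
  | |- has_der (fun x => (@?f x + @?g x)%R) _ _ => apply: derD; der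
  | |- has_der (fun x => (- @?f x)%R) _ _ => apply: derN; der
  | |- has_der (fun x => (@?f x * @?g x)%R) _ _ => apply: derM; der
  | |- has_der (fun x => (@?f x ^+ _)%R) _ _ => apply: derX; der
  | |- has_der (fun x => ((@?f x)^-1)%R) _ _ => apply: derV; der
  | |- has_der (fun x => sin (@?f x)) _ _ => apply: der_sin; der
  | |- has_der (fun x => cos (@?f x)) _ _ => apply: der_cos; der
  | |- has_der (fun x => expR (@?f x)) _ _ => apply: der_expR; der
  | |- has_der (fun x => ln (@?f x)) _ _ => apply: der_ln; der
  | |- has_der (fun x => Num.sqrt (@?f x)) _ _ => apply: der_sqrt; der
  | |- has_der (fun x => asin (@?f x)) _ _ => apply: der_asin; der
  | |- has_der sin _ _ => exact: is_derive_sin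
  | |- has_der cos _ _ => exact: is_derive_cos
  | |- has_der expR _ _ => exact: is_derive_expR
  | |- has_der (GRing.mul ?c) _ _ => exact: derM (der_cst c _) (der_id _)
  | |- has_der (GRing.add ?c) _ _ => exact: derD (der_cst c _) (der_id _)
  | |- has_der GRing.opp _ _ => exact: derN (der_id _)
  | |- has_der ?f ?x _ =>
      try first [ eassumption
                | match goal with H : context [f] |- _ => exact: H end ]
  | |- _ => idtac
  end.

(** * Syntax-directed rules for continuity *)

Section Continuity.
Local Open Scope classical_set_scope.
Local Open Scope ring_scope.
Context {R : realType} {T : topologicalType}.
Implicit Types f g : T -> R.

Lemma cont_cst (c : R) : continuous (fun _ : T => c).
Proof. by move=> x; exact: cvg_cst. Qed.

Lemma contD f g : continuous f -> continuous g -> continuous (fun x => f x + g x).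
Proof. by move=> cf cg x; apply: cvgD; [exact: cf|exact: cg]. Qed.

Lemma contN f : continuous f -> continuous (fun x => - f x).
Proof. by move=> cf x; apply: cvgN; exact: cf. Qed.

Lemma contM f g : continuous f -> continuous g -> continuous (fun x => f x * g x).
Proof. by move=> cf cg x; apply: cvgM; [exact: cf|exact: cg]. Qed.

Lemma cont_comp (h : R -> R) f : continuous h -> continuous f ->
  continuous (fun x => h (f x)).
Proof. by move=> ch cf x; apply: continuous_comp; [exact: cf|exact: ch]. Qed.

Lemma contX f n : continuous f -> continuous (fun x => f x ^+ n).
Proof. by move=> cf; apply: (cont_comp (h := fun y => y ^+ n)) => //; exact: exprn_continuous. Qed.

Lemma contV f : (forall x, f x != 0) -> continuous f -> continuous (fun x => (f x)^-1).
Proof. by move=> f0 cf x; apply: cvgV; [exact: f0|exact: cf]. Qed.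

Lemma cont_norm f : continuous f -> continuous (fun x => `|f x|).
Proof. by move=> cf x; apply: cvg_norm; exact: cf. Qed.

Lemma cont_sqrt f : continuous f -> continuous (fun x => Num.sqrt (f x)).
Proof. by move=> cf; apply: cont_comp => //; exact: sqrt_continuous. Qed.

Lemma cont_sin f : continuous f -> continuous (fun x => sin (f x)).
Proof. by move=> cf; apply: cont_comp => //; exact: continuous_sin. Qed.

Lemma cont_cos f : continuous f -> continuous (fun x => cos (f x)).
Proof. by move=> cf; apply: cont_comp => //; exact: continuous_cos. Qed.

Lemma cont_expR f : continuous f -> continuous (fun x => expR (f x)).
Proof. by move=> cf; apply: cont_comp => //; exact: continuous_expR. Qed.

Lemma cont_pair f g : continuous f -> continuous g ->
  continuous (fun x => (f x, g x)).
Proof.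
move=> cf cg x.
have h1 : f y @[y --> x] --> f x by exact: cf.
have h2 : g y @[y --> x] --> g x by exact: cg.
exact: cvg_pair h1 h2.
Qed.

End Continuity.

Lemma cont_comp2 {R : realType} {T : topologicalType} (G : R * R -> R) (f g : T -> R) :
  continuous G -> continuous f -> continuous g -> continuous (fun x => G (f x, g x)).
Proof.
move=> cG cf cg x; apply: (continuous_comp (f := fun x => (f x, g x))).
  exact: cont_pair.
exact: cG.
Qed.

Lemma cont_id {R : realType} : continuous (fun x : R => x).
Proof. by move=> x; exact: cvg_id. Qed.

Lemma cont_horner {R : realType} {T : topologicalType} (p : {poly R}) (f : T -> R) :
  continuous f -> continuous (fun x => (p.[f x])%R).
Proof. by move=> cf; apply: cont_comp => //; exact: continuous_horner. Qed.

Ltac cont := lazymatch goal with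
  | H : continuous ?f |- continuous ?f => exact: H
  | |- continuous (fun _ => ?c) => exact: cont_cst
  | |- continuous (fun x => x) => exact: cont_id
  | H : continuous ?q |- continuous (fun x => ?q (@?f x)) =>
      apply: (cont_comp H); cont
  | |- continuous (fun x => (@?f x + @?g x)%R) => apply: contD; cont
  | |- continuous (fun x => (- @?f x)%R) => apply: contN; cont
  | |- continuous (fun x => (@?f x * @?g x)%R) => apply: contM; cont
  | |- continuous (fun x => (@?f x ^+ _)%R) => apply: contX; cont
  | |- continuous (fun x => ((@?f x)^-1)%R) => apply: contV; cont
  | |- continuous (fun x => (`|@?f x|)%R) => apply: cont_norm; cont
  | |- continuous (fun x => sin (@?f x)) => apply: cont_sin; cont
  | |- continuous (fun x => cos (@?f x)) => apply: cont_cos; cont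
  | |- continuous (fun x => expR (@?f x)) => apply: cont_expR; cont
  | |- continuous (fun x => Num.sqrt (@?f x)) => apply: cont_sqrt; cont
  | |- continuous (fun x => (?p.[@?f x])%R) => apply: cont_horner; cont
  | |- continuous sin => exact: continuous_sin
  | |- continuous cos => exact: continuous_cos
  | |- continuous expR => exact: continuous_expR
  | |- continuous (GRing.mul ?c) => exact: contM (@cont_cst _ _ c) cont_id
  | |- continuous (GRing.add ?c) => exact: contD (@cont_cst _ _ c) cont_id
  | |- continuous GRing.opp => exact: contN cont_id
  | |- _ => idtac
  end.

(** * Integrals on the line and in the plane *)

Section Integral.
Local Open Scope classical_set_scope.
Local Open Scope ring_scope.
Context {R : realType}.
Notation mu := (@lebesgue_measure R).
Implicit Types (f g F G : R -> R) (a b c : R).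

Lemma continuous_integrable f a b :
  continuous f -> mu.-integrable `[a, b] (EFin \o f).
Proof.
move=> cf; apply: continuous_compact_integrable; first exact: segment_compact.
exact: continuous_subspaceT.
Qed.

Lemma is_derive_continuous f (df : R -> R) :
  (forall x : R, is_derive x 1 f (df x)) -> continuous f.
Proof.
by move=> Hd x; apply/differentiable_continuous/derivable1_diffP; case: (Hd x).
Qed.

Lemma Rintegral_itv_pt f a : \int[mu]_(x in `[a, a]) f x = 0.
Proof. by rewrite set_itv1 Rintegral_set1. Qed.

Lemma Rintegral_FTC f F a b : a <= b -> continuous f ->
  (forall x : R, is_derive x 1 F (f x)) -> \int[mu]_(x in `[a, b]) f x = F b - F a.
Proof.
rewrite le_eqVlt => /predU1P[->|ab] cf dF.
  by rewrite Rintegral_itv_pt subrr.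
have cF := is_derive_continuous dF.
rewrite /Rintegral (continuous_FTC2 (F := F) ab) //.
- exact: continuous_subspaceT.
- split.
  + by move=> x _; case: (dF x).
  + exact: cvg_at_right_filter (cF a).
  + exact: cvg_at_left_filter (cF b).
- by move=> x _; rewrite derive1E; case: (dF x).
Qed.

Lemma Rintegral_itv_cat f a b c : a <= b -> b <= c ->
  mu.-integrable `[a, c] (EFin \o f) ->
  \int[mu]_(x in `[a, c]) f x =
  \int[mu]_(x in `[a, b]) f x + \int[mu]_(x in `[b, c]) f x.
Proof.
move=> ab bc fi.
have := @Rintegral_itvB _ f (BLeft a) (BRight c) b fi.
rewrite !bnd_simp => /(_ ab bc) H.
rewrite -(@Rintegral_itv_obnd_cbnd _ b); last first.
  apply: integrableS fi => //; apply: subset_itv; rewrite ?bnd_simp //.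
by rewrite -H addrC subrK.
Qed.

(** An integral from a fixed point is a primitive only to the right of that point. Subtracting the
    integral up to 0 makes [G N x] independent of [N] once [N] is below 0 and [x], so the lower end
    may depend on [x]; near [x] the common lower end [- (|x| + 2)] gives the derivative. *)
Lemma ex_primitive f : continuous f ->
  exists F, forall x : R, is_derive x 1 F (f x).
Proof.
move=> cf.
have fi a b := @continuous_integrable f a b cf.
pose G N x := \int[mu]_(t in `[N, x]) f t - \int[mu]_(t in `[N, 0]) f t.
pose F x := G (- (`|x| + 1)) x.
have GE N M x : N <= M -> M <= x -> M <= 0 -> G N x = G M x.
  move=> NM Mx M0; rewrite /G.
  rewrite (Rintegral_itv_cat NM Mx) // (Rintegral_itv_cat NM M0) //.
  by rewrite opprD addrACA subrr add0r.
exists F => x.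
pose N := - (`|x| + 2).
have Nx : N < x by rewrite /N; have := ler_norm (- x); rewrite normrN; lra.
have [dG GE'] : derivable (fun y => \int[mu]_(t in `[N, y]) f t) x 1 /\
    derive1 (fun y => \int[mu]_(t in `[N, y]) f t) x = f x.
  apply: (@continuous_FTC1_closed _ f N x (x + 1)) => //; first lra.
  exact: cf.
have dG' : is_derive x 1 (fun y => \int[mu]_(t in `[N, y]) f t) (f x).
  by apply: (DeriveDef dG); rewrite -derive1E.
have : is_derive x 1 (G N) (f x).
  rewrite -[f x]subr0.
  exact: (is_deriveB dG' (is_derive_cst (\int[mu]_(t in `[N, 0]) f t) x 1)).
apply: near_eq_is_derive.
near=> y.
rewrite /F; apply: GE.
- have : `|y - x| < 1.
    near: y; have := @nbhsx_ballx _ _ x 1 ltr01; apply: filterS => y.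
    by rewrite /ball /= distrC.
  by rewrite /N => H; have := ler_normD x (y - x); rewrite [x + _]addrC subrK; lra.
- have := ler_norm (- y); rewrite normrN; lra.
- by have := normr_ge0 y; lra.
Unshelve. all: by end_near. Qed.

(** One primitive on the whole line, fixed once and for all, turns the substitutions below (shift,
    reflection, scaling) into applications of the chain rule. *)
Definition primitive_of f : R -> R :=
  get (fun F => forall x : R, is_derive x 1 F (f x)).

Lemma is_derive_primitive f (x : R) : continuous f -> is_derive x 1 (primitive_of f) (f x).
Proof. by move=> /ex_primitive H; apply: (getPex H). Qed.

Lemma Rintegral_primitive f a b : a <= b -> continuous f ->
  \int[mu]_(x in `[a, b]) f x = primitive_of f b - primitive_of f a.
Proof.
by move=> ab cf; apply: Rintegral_FTC => // x; exact: is_derive_primitive.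
Qed.

Lemma Rintegral_shift f a b c : a <= b -> continuous f ->
  \int[mu]_(x in `[a, b]) f (x + c) = \int[mu]_(x in `[a + c, b + c]) f x.
Proof.
move=> ab cf; rewrite (Rintegral_primitive _ cf) ?lerD2r //.
apply: (Rintegral_FTC (F := fun x => primitive_of f (x + c))) => //.
  move=> x; apply: continuous_comp; last exact: cf.
  by apply: cvgD; [exact: cvg_id|exact: cvg_cst].
move=> x; rewrite -[f _]mulr1.
apply: (@is_derive1_comp _ _ (fun x => x + c)) => //.
  exact: is_derive_primitive.
by apply: is_derive_eq; rewrite addr0.
Qed.

Lemma Rintegral_opp f a b : a <= b -> continuous f ->
  \int[mu]_(x in `[a, b]) f (- x) = \int[mu]_(x in `[- b, - a]) f x.
Proof.
move=> ab cf; rewrite (Rintegral_primitive _ cf) ?lerN2 //.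
have cf' : continuous (fun x => f (- x)).
  move=> x; apply: continuous_comp; last exact: cf.
  by apply: cvgN; exact: cvg_id.
have dF (x : R) : is_derive x 1 (fun x => - primitive_of f (- x)) (f (- x)).
  have -> : f (- x) = - (f (- x) * -1) by rewrite mulrN1 opprK.
  apply: is_deriveN.
  apply: (@is_derive1_comp _ _ (fun x => - x)) => //.
  exact: is_derive_primitive.
by rewrite (Rintegral_FTC ab cf' dF) opprK addrC.
Qed.

Lemma Rintegral_scale f a b c : a <= b -> 0 <= c -> continuous f ->
  \int[mu]_(x in `[a, b]) (c * f (c * x)) = \int[mu]_(x in `[c * a, c * b]) f x.
Proof.
move=> ab c0 cf; rewrite (Rintegral_primitive _ cf) ?ler_wpM2l //.
apply: (Rintegral_FTC (F := fun x => primitive_of f (c * x))) => //.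
  move=> x; apply: cvgM; first exact: cvg_cst.
  apply: continuous_comp; last exact: cf.
  by apply: cvgM; [exact: cvg_cst|exact: cvg_id].
move=> x; rewrite mulrC.
apply: (@is_derive1_comp _ _ (fun x => c * x)) => //.
  exact: is_derive_primitive.
by apply: is_derive_eq; rewrite /GRing.scale /= mulr1.
Qed.

(** The increment of a primitive over a period has derivative [f (x + T) - f x = 0], so it is
    constant. *)
Lemma Rintegral_period f T c : 0 <= T -> continuous f ->
  (forall x, f (x + T) = f x) ->
  \int[mu]_(x in `[c, c + T]) f x = \int[mu]_(x in `[0, T]) f x.
Proof.
move=> T0 cf fT.
have H (x : R) : is_derive x 1 (fun x => primitive_of f (x + T) - primitive_of f x) 0.
  have := @is_derive_primitive f.
  move=> /(_ _ cf) dP.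
  have d1 : is_derive x 1 (primitive_of f \o (fun x => x + T)) (f (x + T) * 1).
    apply: is_derive1_comp; apply: is_derive_eq; by rewrite addr0.
  have := is_deriveB d1 (dP x); rewrite mulr1 fT subrr; exact.
rewrite !Rintegral_primitive ?lerDl //.
by have := is_derive_0_is_cst c 0 H; rewrite add0r.
Qed.

Lemma Rintegral_even f a : 0 <= a -> continuous f -> (forall x, f (- x) = f x) ->
  \int[mu]_(x in `[- a, a]) f x = 2 * \int[mu]_(x in `[0, a]) f x.
Proof.
move=> a0 cf ev.
rewrite (@Rintegral_itv_cat f (- a) 0 a) ?oppr_le0 //; last exact: continuous_integrable.
rewrite mulr_natl mulr2n; congr (_ + _).
rewrite -[X in `[_, X]]oppr0 -Rintegral_opp //.
by apply: eq_Rintegral => x _; rewrite ev.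
Qed.

Lemma le_Rintegral_itv f g a b : continuous f -> continuous g ->
  (forall x, a <= x <= b -> f x <= g x) ->
  \int[mu]_(x in `[a, b]) f x <= \int[mu]_(x in `[a, b]) g x.
Proof.
move=> cf cg fg; apply: le_Rintegral => //; try exact: continuous_integrable.
Qed.

Lemma Rintegral_itv_cst a b c : a <= b -> \int[mu]_(x in `[a, b]) c = c * (b - a).
Proof.
move=> ab.
have dF (x : R) : is_derive x 1 (fun x => c * x) c.
  by apply: is_derive_eq; rewrite /GRing.scale /= mulr1.
by rewrite (@Rintegral_FTC (cst c) _ _ _ ab (@cst_continuous _ _ c) dF) mulrBr.
Qed.

Lemma RintegralD_itv f g a b : continuous f -> continuous g ->
  \int[mu]_(x in `[a, b]) (f x + g x) =
  \int[mu]_(x in `[a, b]) f x + \int[mu]_(x in `[a, b]) g x.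
Proof. by move=> cf cg; rewrite RintegralD //; exact: continuous_integrable. Qed.

Lemma RintegralB_itv f g a b : continuous f -> continuous g ->
  \int[mu]_(x in `[a, b]) (f x - g x) =
  \int[mu]_(x in `[a, b]) f x - \int[mu]_(x in `[a, b]) g x.
Proof. by move=> cf cg; rewrite RintegralB //; exact: continuous_integrable. Qed.

Lemma RintegralZl_itv f c a b : continuous f ->
  \int[mu]_(x in `[a, b]) (c * f x) = c * \int[mu]_(x in `[a, b]) f x.
Proof. by move=> cf; rewrite RintegralZl //; exact: continuous_integrable. Qed.

End Integral.

Section PlaneIntegral.
Local Open Scope classical_set_scope.
Local Open Scope ring_scope.
Context {R : realType}.
Notation mu := (@lebesgue_measure R).
Notation Rm := (measurableTypeR R).
Implicit Types (g : R * R -> R) (a b c d : R).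

(** The product sigma-algebra is generated by rectangles, so [U] is written as the countable union
    of the squares with rational centre and radius [1 / (n + 1)] that it contains. *)
Lemma open_measurable_plane (U : set (R * R)) : open U -> measurable (U : set (Rm * Rm)).
Proof.
move=> oU.
pose box (q : (rat * rat) * nat) : set (R * R) :=
  ball (ratr q.1.1 : R) q.2.+1%:R^-1 `*` ball (ratr q.1.2 : R) q.2.+1%:R^-1.
have -> : U = \bigcup_q (if `[< box q `<=` U >] then box q else set0).
  apply/seteqP; split => [[x y] Uxy|z [q _]]; last first.
    by case: asboolP => // H /H.
  have /nbhs_ballP[e /= e0 eU] : nbhs (x, y) U by exact: open_nbhs_nbhs.
  have [n ne] : exists n : nat, n.+1%:R^-1 < e / 2.
    have [n _ Hn] := near_infty_natSinv_lt (PosNum (divr_gt0 e0 (ltr0n _ 2))).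
    by exists n; exact: (Hn n (leqnn n)).
  have n0 : 0 < n.+1%:R^-1 :> R by rewrite invr_gt0.
  have [p /itvP pP] := @rat_in_itvoo R _ _ (ltr_pwDr n0 (lexx x)).
  have [q /itvP qP] := @rat_in_itvoo R _ _ (ltr_pwDr n0 (lexx y)).
  have bx (z r k : R) : z < r -> r < z + k -> ball r k z.
    by move=> h1 h2; rewrite /ball /= ltr_norml; apply/andP; split; lra.
  exists ((p, q), n) => //.
  case: asboolP => [_|]; first by split; apply: bx; rewrite ?pP ?qP.
  case=> -[s t] [/= ps qt]; apply: eU; split => /=.
    have bp : ball (ratr p : R) n.+1%:R^-1 x by apply: bx; rewrite pP.
    apply: le_ball (ball_triangle (ball_sym bp) ps).
    by move: ne; set k := _^-1; lra.
  have bq : ball (ratr q : R) n.+1%:R^-1 y by apply: bx; rewrite qP.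
  apply: le_ball (ball_triangle (ball_sym bq) qt).
  by move: ne; set k := _^-1; lra.
apply: countable_bigcupT_measurable => [|q]; first exact: countableP.
by case: asboolP => // _; apply: measurableX; apply: open_measurable; apply: ball_open; rewrite invr_gt0.
Qed.

Lemma continuous_measurable_plane g : continuous g -> measurable_fun setT (g : Rm * Rm -> R).
Proof.
move=> /continuousP cg; apply: (measurability _ (RGenOpens.measurableE R)).
move=> _ [_ [a [b ->] <-]]; rewrite setTI; apply: open_measurable_plane.
exact/cg/interval_open.
Qed.

Lemma continuous_slice1 g (y : R) : continuous g -> continuous (fun x => g (x, y)).
Proof.
move=> cg x; apply: (continuous_comp (f := fun x => (x, y))); last exact: cg.
exact: (cvg_pair (@cvg_id _ (nbhs x)) (@cvg_cst _ y _ (nbhs x) _)).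
Qed.

Lemma continuous_slice2 g (x : R) : continuous g -> continuous (fun y => g (x, y)).
Proof.
move=> cg y; apply: (continuous_comp (f := fun y => (x, y))); last exact: cg.
exact: (cvg_pair (@cvg_cst _ x _ (nbhs y) _) (@cvg_id _ (nbhs y))).
Qed.

Lemma continuous_bounded_rect g a b c d : continuous g ->
  exists M : R, forall x y, a <= x <= b -> c <= y <= d -> `|g (x, y)| <= M.
Proof.
move=> cg.
have cK : compact ((`[a, b] : set R) `*` (`[c, d] : set R)).
  by apply: compact_setX; exact: segment_compact.
have : bounded_set (g @` ((`[a, b] : set R) `*` (`[c, d] : set R))).
  apply: compact_bounded; apply: continuous_compact => //.
  exact: continuous_subspaceT.
move=> /pinfty_ex_gt0[M _ HM]; exists M => x y xab ycd.
by apply: HM; exists (x, y) => //; split; rewrite /= in_itv.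
Qed.

(** Dominated convergence: on the compact rectangle over [[y - 1, y + 1]] the integrand is bounded
    by a constant, which is integrable on [[a, b]]. *)
Lemma continuous_Rintegral_param g a b : continuous g ->
  continuous (fun y => \int[mu]_(x in `[a, b]) g (x, y)).
Proof.
move=> cg y.
have [M HM] := @continuous_bounded_rect g a b (y - 1) (y + 1) cg.
have yI : y \in (`](y - 1), (y + 1)[%classic : set R).
  by rewrite inE /= in_itv /=; lra.
apply: (@continuity_under_integral _ _ _ mu (fun y x => g (x, y)) `[a, b] _
  (y - 1) (y + 1) _ _ (cst M)) => //.
- move=> t _; apply: continuous_integrable; exact: continuous_slice1.
- by apply: aeW => x _ t _; exact: continuous_slice2.
- by apply: continuous_integrable; exact: cst_continuous.
- move=> t; rewrite /= in_itv /= => tI; apply: aeW => x /=; rewrite in_itv /= => xI.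
  by apply: HM => //; lra.
Qed.

Lemma continuous_integrable_rect g a b c d : continuous g ->
  (mu \x mu)%E.-integrable (`[a, b] `*` `[c, d]) (EFin \o g).
Proof.
move=> cg.
have mA : measurable ((`[a, b] : set Rm) `*` (`[c, d] : set Rm)).
  by apply: measurableX; exact: measurable_itv.
apply: measurable_bounded_integrable => //.
- suff : ((mu \x mu)%E ((`[a, b] : set R) `*` (`[c, d] : set R)) < +oo)%E by [].
  rewrite product_measure1E //=.
  by rewrite !lebesgue_measure_itv /=; do 2 case: ifP => _;
    rewrite ?mule0 ?mul0e ?ltry // -!EFinB -EFinM ltry.
- by apply: measurable_funS (continuous_measurable_plane cg).
- have [M HM] := @continuous_bounded_rect g a b c d cg.
  exists M; split; first exact: num_real.
  move=> N MN [x y] [/= xI yI]; rewrite in_itv /= in xI; rewrite in_itv /= in yI.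
  exact: le_trans (HM _ _ xI yI) (ltW MN).
Qed.

(** Fubini is applied on the whole plane to the function extended by 0 outside the rectangle; the
    slices of the extension are then identified one by one. *)
Lemma Rintegral_rect1 g a b c d : continuous g ->
  \int[(mu \x mu)%E]_(z in `[a, b] `*` `[c, d]) g z =
  \int[mu]_(x in `[a, b]) \int[mu]_(y in `[c, d]) g (x, y).
Proof.
move=> cg; have ig := @continuous_integrable_rect g a b c d cg.
have mA : measurable ((`[a, b] : set Rm) `*` (`[c, d] : set Rm)).
  by apply: measurableX; exact: measurable_itv.
have ig' := (integrable_mkcond _ mA).1 ig.
rewrite /Rintegral integral_mkcond -(integral12_prod_meas1 (m1 := mu) (m2 := mu)); last first.
  exact: ig'.
congr fine; rewrite [RHS]integral_mkcond; apply: eq_integral => x _.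
rewrite /fubini_F patchE; case: ifPn => xA.
  rewrite fineK; last first.
    by apply: integrable_fin_num => //; apply: continuous_integrable; exact: continuous_slice2.
  rewrite [RHS]integral_mkcond; apply: eq_integral => y _.
  by rewrite !patchE in_setX /= xA.
by apply: integral0_eq => y _; rewrite patchE in_setX /= (negbTE xA).
Qed.

Lemma Rintegral_rect2 g a b c d : continuous g ->
  \int[(mu \x mu)%E]_(z in `[a, b] `*` `[c, d]) g z =
  \int[mu]_(y in `[c, d]) \int[mu]_(x in `[a, b]) g (x, y).
Proof.
move=> cg; have ig := @continuous_integrable_rect g a b c d cg.
have mA : measurable ((`[a, b] : set Rm) `*` (`[c, d] : set Rm)).
  by apply: measurableX; exact: measurable_itv.
have ig' := (integrable_mkcond _ mA).1 ig.
rewrite /Rintegral integral_mkcond -(integral21_prod_meas1 (m1 := mu) (m2 := mu)); last first.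
  exact: ig'.
congr fine; rewrite [RHS]integral_mkcond; apply: eq_integral => y _.
rewrite /fubini_G patchE; case: ifPn => yA.
  rewrite fineK; last first.
    by apply: integrable_fin_num => //; apply: continuous_integrable; exact: continuous_slice1.
  rewrite [RHS]integral_mkcond; apply: eq_integral => x _.
  by rewrite !patchE in_setX /= yA andbT.
by apply: integral0_eq => x _; rewrite patchE in_setX /= (negbTE yA) andbF.
Qed.

Lemma Rintegral_swap g a b c d : continuous g ->
  \int[mu]_(x in `[a, b]) \int[mu]_(y in `[c, d]) g (x, y) =
  \int[mu]_(y in `[c, d]) \int[mu]_(x in `[a, b]) g (x, y).
Proof. by move=> cg; rewrite -Rintegral_rect1 // Rintegral_rect2. Qed.

End PlaneIntegral.

(** * Inversion of the Abel transform *)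

Section Weierstrass.
Local Open Scope classical_set_scope.
Local Open Scope ring_scope.
Context {R : realType}.
Implicit Types (u w : nat -> R) (v : R).

(* The Bernstein operator, [u k] being the value at [k / n]: the mean of [u]
   after [n] steps of a walk that moves up with probability [v]. *)
Fixpoint bernstein (n : nat) u : {poly R} :=
  if n is m.+1 then 'X * bernstein m (fun k => u k.+1) + (1 - 'X) * bernstein m u
  else (u 0%N)%:P.

Lemma horner_bernsteinS n u v : (bernstein n.+1 u).[v] =
  v * (bernstein n (fun k => u k.+1)).[v] + (1 - v) * (bernstein n u).[v].
Proof. by rewrite /= !hornerE. Qed.

Lemma bernstein_le n u w v : 0 <= v <= 1 ->
  (forall k, (k <= n)%N -> u k <= w k) -> (bernstein n u).[v] <= (bernstein n w).[v].
Proof.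
move=> /andP[v0 v1]; elim: n u w => [|n IH] u w uw.
  by rewrite /= !hornerC uw.
rewrite !horner_bernsteinS lerD // ler_wpM2l ?subr_ge0 //.
- by apply: IH => k kn; exact: uw.
- by apply: IH => k kn; apply: uw; exact: leqW.
Qed.

Lemma bernstein_affine n u w (a b : R) v :
  (bernstein n (fun k => a * u k + b * w k)).[v] =
  a * (bernstein n u).[v] + b * (bernstein n w).[v].
Proof.
elim: n u w => [|n IH] u w; first by rewrite /= !hornerC.
by rewrite !horner_bernsteinS (IH (fun k => u k.+1) (fun k => w k.+1)) IH; ring.
Qed.

Lemma bernstein_cst n c v : (bernstein n (fun=> c)).[v] = c.
Proof.
by elim: n => [|n IH]; rewrite ?horner_bernsteinS ?IH /= ?hornerC //; ring.
Qed.

(** The variance of a binomial law plus the squared bias. The centre [c] is arbitrary because the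
    induction needs it: an upward first step replaces [c] by [c - 1]. *)
Lemma bernstein_var n (c : R) v :
  (bernstein n (fun k => (k%:R - c) ^+ 2)).[v] =
  n%:R * v * (1 - v) + (n%:R * v - c) ^+ 2.
Proof.
elim: n c => [|n IH] c; first by rewrite /= !hornerC; ring.
rewrite horner_bernsteinS IH.
have -> : (fun k : nat => (k.+1%:R - c) ^+ 2) = (fun k => (k%:R - (c - 1)) ^+ 2).
  by apply/funext => k; rewrite -natr1; ring.
by rewrite IH -natr1; ring.
Qed.

Lemma segment_unif_continuous (f : R -> R) (a b e : R) : continuous f -> 0 < e ->
  exists2 d, 0 < d & forall x y, a <= x <= b -> a <= y <= b ->
    `|x - y| < d -> `|f x - f y| < e.
Proof.
move=> cf e0.
have cK : compact (`[a, b] : set R) := @segment_compact R a b.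
have /compact_near_coveringP := cK.
move=> /(_ _ (0^'+) (fun d x => forall y, `|x - y| < d -> `|f x - f y| < e)).
move=> H; have {}H : \forall d \near 0^'+,
    (`[a, b] : set R) `<=` (fun x => forall y, `|x - y| < d -> `|f x - f y| < e).
  apply: H => x _.
  have e2 : 0 < e / 2 by rewrite divr_gt0.
  have /cvgrPdist_lt /(_ _ e2) /nbhs_ballP[r /= r0 fr] := cf x.
  have r2 : 0 < r / 2 by rewrite divr_gt0.
  near=> z d => /= y zy.
  have xz : `|x - z| < r / 2 by near: z; exact: (nbhsx_ballx x _ r2).
  have dr : d < r / 2 by near: d; exact: nbhs_right_lt.
  have h1 : `|f x - f z| < e / 2 by apply: fr; rewrite /ball /=; lra.
  have h2 : `|f x - f y| < e / 2.
    apply: fr; rewrite /ball /=.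
    rewrite (_ : x - y = (x - z) + (z - y)); last by ring.
    by apply: le_lt_trans (ler_normD _ _) _; lra.
  rewrite (_ : f z - f y = (f x - f y) - (f x - f z)); last by ring.
  by apply: le_lt_trans (ler_normB _ _) _; lra.
have /filterI/(_ H) H0 : \forall d \near (0 : R)^'+, 0 < d by exact: nbhs_right_gt.
have [d [d0 Hd]] := filter_ex H0.
by exists d => // x y xab _; apply: Hd; rewrite /= in_itv.
Unshelve. all: by end_near. Qed.

(** Chebyshev's argument: [|r v - r t|] is at most [e / 2] for [t] within [d] of [v], and at most
    [2 M <= A (v - t)^2] otherwise. Averaging the sum of both bounds over the walk gives
    [e / 2 + A v (1 - v) / N], by the variance formula. *)
Theorem weierstrass (r : R -> R) (e : R) : continuous r -> 0 < e ->
  exists p : {poly R}, forall v, 0 <= v <= 1 -> `|r v - p.[v]| <= e.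
Proof.
move=> cr e0.
have [d d0 rd] := @segment_unif_continuous r 0 1 _ cr (divr_gt0 e0 (ltr0n _ 2)).
have [M HM] : exists M : R, forall x, 0 <= x <= 1 -> `|r x| <= M.
  have [c _ Hc] := @EVT_max R (fun x => `|r x|) 0 1 ler01
    (continuous_subspaceT (cont_norm cr)).
  by exists `|r c| => x xI; apply: Hc; rewrite in_itv.
have M0 : 0 <= M.
  by apply: le_trans (HM 0 _); rewrite ?normr_ge0 // lexx ler01.
pose A := 2 * M / d ^+ 2.
have A0 : 0 <= A by apply: divr_ge0; [lra|exact: sqr_ge0].
have [n nE] : exists n : nat, A * n.+1%:R^-1 <= e / 2.
  have d'0 : 0 < e / 2 / (A + 1) by rewrite !divr_gt0 // ltr_wpDl.
  have [n _ Hn] := near_infty_natSinv_lt (PosNum d'0).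
  exists n; have /= := Hn n (leqnn n); rewrite ltr_pdivlMr ?ltr_wpDl // => H.
  have n0 : 0 < n.+1%:R^-1 :> R by rewrite invr_gt0.
  by move: H n0; set k := _^-1 => *; nra.
set N := n.+1 in nE *.
have N0 : 0 < N%:R :> R by [].
exists (bernstein N (fun k => r (k%:R / N%:R))) => v v01.
(* The operator is indexed by the integers [k] and not by [t = k / N]; the division by [N ^ 2]
   accounts for this rescaling of the squared distance. *)
pose K := A / N%:R ^+ 2.
have K0 : 0 <= K by rewrite /K divr_ge0 ?sqr_ge0.
have Ku k : (k <= N)%N ->
    `|r v - r (k%:R / N%:R)| <= e / 2 + K * (k%:R - N%:R * v) ^+ 2.
  move=> kN; set t := k%:R / N%:R.
  have t01 : 0 <= t <= 1.
    by rewrite /t divr_ge0 //= ler_pdivrMr // mul1r ler_nat.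
  have -> : K * (k%:R - N%:R * v) ^+ 2 = A * (v - t) ^+ 2.
    by rewrite /K /t; field; rewrite gt_eqF.
  have Avt : 0 <= A * (v - t) ^+ 2 by rewrite mulr_ge0 ?sqr_ge0.
  have [vt|vt] := ltP `|v - t| d.
    by have := rd _ _ v01 t01 vt; lra.
  have : 2 * M <= A * (v - t) ^+ 2.
    rewrite /A -mulrA -[leLHS]mulr1 ler_wpM2l ?mulr_ge0 //.
    rewrite mulrC ler_pdivlMr ?exprn_gt0 // mul1r -[leRHS]real_normK ?num_real //.
    by rewrite ler_sqr // nnegrE // ltW.
  have := ler_normB (r v) (r t); have := HM _ v01; have := HM _ t01; lra.
have mean (c s : R) : (bernstein N (fun k => 1 * c + s * (k%:R - N%:R * v) ^+ 2)).[v]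
    = c + s * (N%:R * v * (1 - v)).
  rewrite (bernstein_affine N (fun=> c) (fun k => (k%:R - N%:R * v) ^+ 2)).
  by rewrite bernstein_cst bernstein_var subrr; ring.
have KN : K * (N%:R * v * (1 - v)) <= e / 2.
  apply: le_trans nE; rewrite /K.
  have -> : A / N%:R ^+ 2 * (N%:R * v * (1 - v)) = A * N%:R^-1 * (v * (1 - v)).
    by field; rewrite gt_eqF.
  by rewrite ler_piMr ?mulr_ge0 ?invr_ge0 //; nra.
rewrite ler_norml; apply/andP; split.
- have : (bernstein N (fun k => r (k%:R / N%:R))).[v] <=
    (bernstein N (fun k => 1 * (r v + e / 2) + K * (k%:R - N%:R * v) ^+ 2)).[v].
    by apply: bernstein_le => // k /Ku; rewrite ler_norml; lra.
  by rewrite mean; lra.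
- have : (bernstein N (fun k => 1 * (r v - e / 2) + (- K) * (k%:R - N%:R * v) ^+ 2)).[v] <=
    (bernstein N (fun k => r (k%:R / N%:R))).[v].
    by apply: bernstein_le => // k /Ku; rewrite ler_norml; lra.
  by rewrite mean; lra.
Qed.

End Weierstrass.

Section Abel.
Local Open Scope classical_set_scope.
Local Open Scope ring_scope.
Context {R : realType}.
Notation mu := (@lebesgue_measure R).

Let C n : R := \int[mu]_(x in `[0, pi]) cos x ^+ (2 * n).
Let S n : R := \int[mu]_(x in `[0, pi / 2]) sin x ^+ (2 * n).+1.

Let CS n : (2 * n).+2%:R * C n.+1 = (2 * n).+1%:R * C n.
Proof.
pose f (x : R) := (2 * n).+2%:R * cos x ^+ (2 * n.+1) - (2 * n).+1%:R * cos x ^+ (2 * n).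
have dF (x : R) : is_derive x 1 (fun x => sin x * cos x ^+ (2 * n).+1) (f x).
  apply: der_eq; first by der.
  rewrite /f mulnS !addSn add0n /= !exprS.
  transitivity (- (2 * n).+1%:R * (sin x ^+ 2) * cos x ^+ (2 * n) + cos x ^+ 2 * cos x ^+ (2 * n)).
    by rewrite -natr1; ring.
  by rewrite sin2cos2 -[X in X * (_ * _)]natr1; ring.
have cf : continuous f by rewrite /f; cont.
have := Rintegral_FTC (pi_ge0 R) cf dF.
rewrite sinpi sin0 !mul0r subrr /f RintegralB_itv; [|by cont|by cont].
rewrite RintegralZl_itv; last by cont.
rewrite RintegralZl_itv; last by cont.
by move/eqP; rewrite subr_eq0 => /eqP.
Qed.

Let SS n : (2 * n).+3%:R * S n.+1 = (2 * n).+2%:R * S n.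
Proof.
pose f (x : R) := (2 * n).+3%:R * sin x ^+ (2 * n.+1).+1 - (2 * n).+2%:R * sin x ^+ (2 * n).+1.
have dF (x : R) : is_derive x 1 (fun x => - cos x * sin x ^+ (2 * n).+2) (f x).
  apply: der_eq; first by der.
  rewrite /f mulnS !addSn add0n /= !exprS.
  transitivity (sin x ^+ 3 * sin x ^+ (2 * n) - (2 * n).+2%:R * (cos x ^+ 2) * (sin x * sin x ^+ (2 * n))).
    by rewrite -natr1; ring.
  by rewrite cos2sin2 -[X in X * (_ * (_ * _)) - _]natr1; ring.
have cf : continuous f by rewrite /f; cont.
have p2 : 0 <= pi / 2 :> R by rewrite divr_ge0 ?pi_ge0.
have := Rintegral_FTC p2 cf dF.
rewrite cos_pihalf sin0 oppr0 mul0r exprS mul0r mulr0 subrr.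
rewrite /f RintegralB_itv; [|by cont|by cont].
rewrite RintegralZl_itv; last by cont.
rewrite RintegralZl_itv; last by cont.
by move/eqP; rewrite subr_eq0 => /eqP.
Qed.

Let C0 : C 0 = pi.
Proof.
rewrite /C muln0; under eq_Rintegral do rewrite expr0.
by rewrite Rintegral_itv_cst ?pi_ge0 // subr0 mul1r.
Qed.

Let S0 : S 0 = 1.
Proof.
rewrite /S muln0.
have dF (x : R) : is_derive x 1 (fun x => - cos x) (sin x ^+ 1).
  by apply: der_eq; [by der|rewrite expr1; ring].
have p2 : 0 <= pi / 2 :> R by rewrite divr_ge0 ?pi_ge0.
rewrite (Rintegral_FTC p2 _ dF); last by cont.
by rewrite cos_pihalf cos0 oppr0 add0r opprK.
Qed.

(** In the product of the two recurrences the factor [2 n + 2] cancels, which leaves the ratio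
    [(2 n + 1) / (2 n + 3)]. *)
Let wallis n : C n * S n = pi / (2 * n).+1%:R.
Proof.
elim: n => [|n IH]; first by rewrite C0 S0 mulr1 divr1.
have n2 : (2 * n).+2%:R != 0 :> R by [].
have n1 : (2 * n).+1%:R != 0 :> R by [].
have n3 : (2 * n).+3%:R != 0 :> R by [].
have -> : (2 * n.+1).+1 = (2 * n).+3 by rewrite mulnS.
apply: (mulfI n3); apply: (mulfI n2).
transitivity (((2 * n).+2%:R * C n.+1) * ((2 * n).+3%:R * S n.+1)); first by ring.
rewrite CS SS.
transitivity ((2 * n).+1%:R * (2 * n).+2%:R * (C n * S n)); first by ring.
rewrite IH.
have E (a b c : R) : a != 0 -> c != 0 -> a * b * (pi / a) = b * (c * (pi / c)).
  by move=> a0 c0; field; rewrite a0 c0.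
exact: E.
Qed.

Lemma Rintegral_sum (F : nat -> R -> R) (n : nat) (a b : R) :
  (forall i, continuous (F i)) ->
  \int[mu]_(x in `[a, b]) (\sum_(i < n) F i x) =
  \sum_(i < n) \int[mu]_(x in `[a, b]) F i x.
Proof.
move=> cF; have cS m : continuous (fun x => \sum_(i < m) F i x).
  elim: m => [|m IH]; first by under eq_fun do rewrite big_ord0; exact: cont_cst.
  by under eq_fun do rewrite big_ord_recr /=; apply: contD.
elim: n => [|n IH].
  rewrite big_ord0; under eq_Rintegral do rewrite big_ord0.
  by rewrite /Rintegral integral0.
rewrite big_ord_recr /= -IH -RintegralD_itv //.
by apply: eq_Rintegral => x _; rewrite big_ord_recr.
Qed.

(* Averaging [q (t cos x)] over [x], then over [t = sin y] with weight [sin y],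
   multiplies [z ^+ (2 * n)] by [C n * S n = pi / (2 * n + 1)]; by Weierstrass
   it is the mean value over [0, 1] (this is Archimedes' projection theorem, or
   the inversion of Abel's equation). *)
Lemma abel_mean (q m : R -> R) : continuous q -> (forall x, q (- x) = q x) ->
  continuous m ->
  (forall t, 0 <= t <= 1 -> m t <= \int[mu]_(x in `[0, pi]) q (t * cos x)) ->
  \int[mu]_(y in `[0, pi / 2]) (sin y * m (sin y)) <=
  pi * \int[mu]_(z in `[0, 1]) q z.
Proof.
move=> cq evq cm mq.
have pi0 : 0 <= pi :> R := pi_ge0 R.
have p2 : 0 <= pi / 2 :> R by rewrite divr_ge0.
apply/ler_addgt0Pr => e e0.
(* The approximation error is paid twice, once on each side of the inequality, and costs [pi] times
   itself each time. *)
have e'0 : 0 < e / (2 * pi) by rewrite divr_gt0 // mulr_gt0 // pi_gt0.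
(* Evenness makes [q] a function of [z ^ 2]. Approximating that function yields even powers only,
   the ones whose moments are [C i] and [S i]. *)
pose r v := q (Num.sqrt v).
have cr : continuous r by apply: (cont_comp cq); exact: sqrt_continuous.
have [p Hp] := weierstrass cr e'0.
set d := e / (2 * pi) in e'0 Hp.
have qr z : q z = r (z ^+ 2).
  rewrite /r sqrtr_sqr; have [z0|z0] := leP 0 z; first by rewrite ger0_norm.
  by rewrite ltr0_norm // evq.
have qp z : -1 <= z <= 1 -> `|q z - p.[z ^+ 2]| <= d.
  move=> z1; rewrite qr; apply: Hp; rewrite sqr_ge0 /=.
  by nra.
pose n := size p.
have mT t : 0 <= t <= 1 -> m t <= \sum_(i < n) p`_i * C i * t ^+ (2 * i) + d * pi.
  move=> t01; apply: le_trans (mq _ t01) _.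
  apply: (@le_trans _ _ (\int[mu]_(x in `[0, pi]) (p.[(t * cos x) ^+ 2] + d))).
    apply: le_Rintegral_itv; [by apply: (cont_comp cq); cont|by cont|] => x _.
    have := qp (t * cos x); rewrite ler_norml.
    have := cos_geN1 x; have := cos_le1 x => h1 h2 /(_ _)/andP[|_]; last by lra.
    by apply/andP; split; nra.
  rewrite RintegralD_itv; try by cont.
  rewrite Rintegral_itv_cst // subr0 lerD2r.
  under eq_Rintegral do rewrite horner_coef.
  rewrite (Rintegral_sum (F := fun i x => p`_i * ((t * cos x) ^+ 2) ^+ i)); last by move=> i; cont.
  apply: ler_sum => i _.
  have -> : \int[mu]_(x in `[0, pi]) (p`_i * ((t * cos x) ^+ 2) ^+ i) =
      \int[mu]_(x in `[0, pi]) (p`_i * t ^+ (2 * i) * cos x ^+ (2 * i)).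
    by apply: eq_Rintegral => x _; rewrite -exprM exprMn mulrA.
  by rewrite RintegralZl_itv; [rewrite mulrAC|cont].
apply: (@le_trans _ _ (\int[mu]_(y in `[0, pi / 2])
    (\sum_(i < n) p`_i * C i * sin y ^+ (2 * i).+1 + d * pi * sin y ^+ 1))).
  apply: le_Rintegral_itv.
  - by apply: contM; [cont|apply: (cont_comp cm); cont].
  - apply: contD; last by cont.
    elim: n {mT} => [|k IH]; first by under eq_fun do rewrite big_ord0; exact: cont_cst.
    by under eq_fun do rewrite big_ord_recr /=; apply: contD; [exact: IH|cont].
  move=> y /andP[y0 y1].
  have sy : 0 <= sin y by apply: sin_ge0_pi; rewrite y0 /=; lra.
  have := mT (sin y); rewrite sy sin_le1 => /(_ isT) H.
  apply: le_trans (ler_wpM2l sy H) _.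
  rewrite mulrDr mulr_sumr expr1 mulrC lerD // ?[sin y * _]mulrC //.
  by apply: ler_sum => i _; rewrite exprS; lra.
have cs : continuous (fun y : R => \sum_(i < n) p`_i * C i * sin y ^+ (2 * i).+1).
  elim: n {mT} => [|k IH]; first by under eq_fun do rewrite big_ord0; exact: cont_cst.
  by under eq_fun do rewrite big_ord_recr /=; apply: contD; [exact: IH|cont].
rewrite RintegralD_itv; [|exact: cs|by cont].
rewrite [X in _ + X]RintegralZl_itv; last by cont.
rewrite (Rintegral_sum (F := fun i y => p`_i * C i * sin y ^+ (2 * i).+1)); last by move=> i; cont.
have -> : \int[mu]_(y in `[0, pi / 2]) sin y ^+ 1 = 1 by move: S0; rewrite /S muln0.
have -> : \sum_(i < n) \int[mu]_(y in `[0, pi / 2]) (p`_i * C i * sin y ^+ (2 * i).+1) =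
    pi * \int[mu]_(z in `[0, 1]) p.[z ^+ 2].
  under [in RHS]eq_Rintegral do rewrite horner_coef.
  rewrite (Rintegral_sum (F := fun i z => p`_i * (z ^+ 2) ^+ i)); last by move=> i; cont.
  rewrite mulr_sumr; apply: eq_bigr => i _.
  rewrite RintegralZl_itv; last by cont.
  rewrite -/(S i) -mulrA wallis.
  under eq_Rintegral do rewrite -exprM.
  rewrite RintegralZl_itv; last by cont.
  have dF (x : R) : is_derive x 1 (fun x => ((2 * i).+1%:R)^-1 * x ^+ (2 * i).+1) (x ^+ (2 * i)).
    apply: der_eq; first by der.
    by rewrite /=; field.
  rewrite (Rintegral_FTC ler01 _ dF); last by cont.
  by rewrite expr1n exprS mul0r mulr0 subr0; ring.
have : \int[mu]_(z in `[0, 1]) p.[z ^+ 2] <= \int[mu]_(z in `[0, 1]) (q z + d).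
  apply: le_Rintegral_itv; [by cont|by cont|] => z z01.
  by have := qp z; rewrite ler_norml => /(_ _)/andP[|? _]; lra.
rewrite RintegralD_itv; [|by cont|by cont].
rewrite Rintegral_itv_cst ?ler01 // subr0 mulr1 => H.
have pin0 : pi != 0 :> R by rewrite gt_eqF ?pi_gt0.
have : d * pi = e / 2.
  by rewrite /d; move: (pi : R) pin0 => w w0; field.
have := ler_wpM2l pi0 H; lra.
Qed.

End Abel.

(** * Hyperbolic functions and great circles in Mercator coordinates *)

Section Hyperbolic.
Local Open Scope classical_set_scope.
Local Open Scope ring_scope.
Context {R : realType}.
Notation mu := (@lebesgue_measure R).
Implicit Types x y v a b : R.

Definition cosh y : R := (expR y + expR (- y)) / 2.
Definition sinh y : R := (expR y - expR (- y)) / 2.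
Definition tanh y : R := sinh y / cosh y.
Definition asinh v : R := ln (v + Num.sqrt (1 + v ^+ 2)).

Lemma asin0 : asin 0 = 0 :> R.
Proof.
by rewrite -[X in asin X]sin0 sinK // in_itv /=; have := pi_ge0 R; lra.
Qed.

Lemma cosh_gt0 y : 0 < cosh y.
Proof. by rewrite /cosh divr_gt0 ?addr_gt0 ?expR_gt0. Qed.

Lemma cosh_neq0 y : cosh y != 0.
Proof. by rewrite gt_eqF ?cosh_gt0. Qed.

Lemma cosh2_sinh2 y : cosh y ^+ 2 = 1 + sinh y ^+ 2.
Proof.
have : expR y * expR (- y) = 1 by rewrite -expRD subrr expR0.
by rewrite /cosh /sinh => H; field: H.
Qed.

Lemma cosh_ge1 y : 1 <= cosh y.
Proof.
have c0 := ltW (cosh_gt0 y).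
rewrite -[leLHS]sqrtr1 -[leRHS](ger0_norm c0) -sqrtr_sqr.
by rewrite ler_sqrt ?sqr_ge0 // cosh2_sinh2 lerDl sqr_ge0.
Qed.

Lemma coshN y : cosh (- y) = cosh y.
Proof. by rewrite /cosh opprK addrC. Qed.

Lemma sinhN y : sinh (- y) = - sinh y.
Proof. by rewrite /sinh opprK; field. Qed.

Lemma sinh0 : sinh 0 = 0.
Proof. by rewrite /sinh oppr0 subrr mul0r. Qed.

Lemma tanh0 : tanh 0 = 0.
Proof. by rewrite /tanh sinh0 mul0r. Qed.

Lemma is_derive_cosh x : is_derive x 1 cosh (sinh x).
Proof. by apply: der_eq; [rewrite /cosh; der|rewrite /sinh; cbv beta; field]. Qed.

Lemma is_derive_sinh x : is_derive x 1 sinh (cosh x).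
Proof. by apply: der_eq; [rewrite /sinh; der|rewrite /cosh; cbv beta; field]. Qed.

Lemma continuous_cosh : continuous cosh.
Proof. exact: is_derive_continuous is_derive_cosh. Qed.

Lemma continuous_sinh : continuous sinh.
Proof. exact: is_derive_continuous is_derive_sinh. Qed.

Lemma is_derive_tanh x : is_derive x 1 tanh ((cosh x ^+ 2)^-1).
Proof.
have ds := is_derive_sinh x; have dc := is_derive_cosh x.
have c0 := cosh_neq0 x.
apply: der_eq; first by rewrite /tanh; der.
have -> : sinh x * (- (cosh x ^+ 2)^-1 * sinh x) + (cosh x)^-1 * cosh x =
    1 - sinh x ^+ 2 / cosh x ^+ 2 by field.
have -> : sinh x ^+ 2 = cosh x ^+ 2 - 1 by rewrite cosh2_sinh2 addrAC subrr add0r.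
by field.
Qed.

Lemma is_derive_sech x : is_derive x 1 (fun y => (cosh y)^-1) (- (sinh x / cosh x ^+ 2)).
Proof.
have dc := is_derive_cosh x; have c0 := cosh_neq0 x.
by apply: der_eq; [der|rewrite mulNr mulrC].
Qed.

Lemma continuous_sech : continuous (fun y : R => (cosh y)^-1).
Proof. exact: is_derive_continuous is_derive_sech. Qed.

Lemma tanh2 y : 1 - tanh y ^+ 2 = (cosh y)^-1 ^+ 2.
Proof.
have c0 := cosh_neq0 y; rewrite /tanh expr_div_n.
have -> : sinh y ^+ 2 = cosh y ^+ 2 - 1 by rewrite cosh2_sinh2 addrAC subrr add0r.
by field.
Qed.

Lemma tanh_bound y : -1 < tanh y < 1.
Proof.
rewrite -ltr_norml -(@expr_lt1 _ 2) // real_normK ?num_real //.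
by rewrite -subr_gt0 tanh2 exprn_gt0 // invr_gt0 cosh_gt0.
Qed.

(** This is the Gudermannian function: [asin (tanh y)] is the latitude of the point of the sphere at
    Mercator height [y], and [1 / cosh y] is the cosine of that latitude. *)
Lemma is_derive_gd x : is_derive x 1 (fun y => asin (tanh y)) ((cosh x)^-1).
Proof.
have dt := is_derive_tanh x; have c0 := cosh_neq0 x.
apply: der_eq; first by der; exact: tanh_bound.
rewrite tanh2 sqrtr_sqr ger0_norm ?invr_ge0 ?(ltW (cosh_gt0 x)) //.
by field.
Qed.

Lemma sinh_ge0 y : 0 <= y -> 0 <= sinh y.
Proof.
move=> y0; rewrite /sinh divr_ge0 // subr_ge0 ler_expR; lra.
Qed.

Lemma sinh_gt0 y : 0 < y -> 0 < sinh y.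
Proof.
move=> y0; rewrite /sinh divr_gt0 // subr_gt0 ltr_expR; lra.
Qed.

Lemma le_cosh a b : 0 <= a -> a <= b -> cosh a <= cosh b.
Proof.
move=> a0 ab.
(* Both factors of the increment are visibly nonnegative when [0 <= a <= b]. *)
have -> : cosh b = cosh a + (expR b - expR a) * (1 - expR (- a) * expR (- b)) / 2.
  have Ha : expR a * expR (- a) = 1 by rewrite -expRD subrr expR0.
  have Hb : expR b * expR (- b) = 1 by rewrite -expRD subrr expR0.
  by rewrite /cosh; field: Ha Hb.
rewrite lerDl divr_ge0 // mulr_ge0 // subr_ge0 ?ler_expR //.
by rewrite -expRD -expR0 ler_expR; lra.
Qed.

Let sq_gt0 v : 0 < 1 + v ^+ 2.
Proof. by rewrite ltr_pwDl // sqr_ge0. Qed.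

Lemma asinh_arg_gt0 v : 0 < v + Num.sqrt (1 + v ^+ 2).
Proof.
have H : `|v| < Num.sqrt (1 + v ^+ 2).
  by rewrite -sqrtr_sqr ltr_sqrt // ltrDr.
by have := ler_norm (- v); rewrite normrN; lra.
Qed.

Lemma expR_asinh v : expR (asinh v) = v + Num.sqrt (1 + v ^+ 2).
Proof. by rewrite /asinh lnK // posrE asinh_arg_gt0. Qed.

Lemma expRN_asinh v : expR (- asinh v) = - v + Num.sqrt (1 + v ^+ 2).
Proof.
rewrite expRN expR_asinh; apply: (mulfI (lt0r_neq0 (asinh_arg_gt0 v))).
rewrite mulfV ?gt_eqF ?asinh_arg_gt0 //.
transitivity (Num.sqrt (1 + v ^+ 2) ^+ 2 - v ^+ 2); last by ring.
by rewrite sqr_sqrtr ?ltW // addrK.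
Qed.

Lemma asinhK v : sinh (asinh v) = v.
Proof. by rewrite /sinh expR_asinh expRN_asinh; field. Qed.

Lemma sqrt_cosh y : Num.sqrt (1 + sinh y ^+ 2) = cosh y.
Proof. by rewrite -cosh2_sinh2 sqrtr_sqr ger0_norm ?ltW ?cosh_gt0. Qed.

Lemma sinhK y : asinh (sinh y) = y.
Proof.
rewrite /asinh sqrt_cosh (_ : _ + _ = expR y) ?expRK //.
by rewrite /sinh /cosh; field.
Qed.

Lemma asinh0 : asinh 0 = 0.
Proof. by rewrite -[X in asinh X]sinh0 sinhK. Qed.

Lemma asinhN v : asinh (- v) = - asinh v.
Proof. by rewrite -[v in LHS]asinhK -sinhN sinhK. Qed.

Lemma is_derive_asinh v : is_derive v 1 asinh ((Num.sqrt (1 + v ^+ 2))^-1).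
Proof.
have A0 := asinh_arg_gt0 v; have B0 := sq_gt0 v.
apply: der_eq; first by rewrite /asinh; der.
set s := Num.sqrt _ in A0 *.
have s0 : s != 0 by rewrite gt_eqF // sqrtr_gt0.
by rewrite /=; field; rewrite s0 gt_eqF.
Qed.

Lemma continuous_asinh : continuous asinh.
Proof. exact: is_derive_continuous is_derive_asinh. Qed.

(* [h * cos x = sinh y] is a great circle of the sphere [(dx^2 + dy^2) / cosh y ^ 2],
   of maximal height [asinh h]; [L] bounds the length of its half. *)
Lemma band_integral (f : R -> R) (L a : R) : continuous f ->
  (forall y, f (- y) = f y) ->
  (forall h, 0 <= h -> L <= \int[mu]_(x in `[0, pi])
     (f (asinh (h * cos x)) * (Num.sqrt (1 + h ^+ 2) / Num.sqrt (1 + (h * cos x) ^+ 2)))) ->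
  0 <= a -> L * asin (tanh a) <= pi * \int[mu]_(y in `[0, a]) f y.
Proof.
move=> cf evf HL; rewrite le_eqVlt => /predU1P[<-|a0].
  by rewrite tanh0 asin0 Rintegral_itv_pt !mulr0.
have e0 : 0 < sinh a := sinh_gt0 a0.
set e := sinh a in e0.
have ca : continuous asinh := continuous_asinh.
have sq0 v : Num.sqrt (1 + v ^+ 2) != 0 by rewrite gt_eqF // sqrtr_gt0.
(* The height is bounded by [a] through [h = e t] with [t] in [0, 1]. Dividing the hypothesis by
   [sqrt (1 + h ^ 2)] puts it in the form required by [abel_mean], with [m] on the left and
   [q (t cos x)] under the integral. *)
pose q z := f (asinh (e * z)) * (Num.sqrt (1 + (e * z) ^+ 2))^-1.
pose m t := L * (Num.sqrt (1 + (e * t) ^+ 2))^-1.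
have cq : continuous q by rewrite /q; cont => x; exact: sq0.
have cm : continuous m by rewrite /m; cont => x; exact: sq0.
have evq x : q (- x) = q x by rewrite /q mulrN asinhN evf sqrrN.
have H t : 0 <= t <= 1 -> m t <= \int[mu]_(x in `[0, pi]) q (t * cos x).
  move=> /andP[t0 _].
  have := HL (e * t) (mulr_ge0 (ltW e0) t0).
  rewrite /m ler_pdivrMr ?sqrtr_gt0 // => /le_trans; apply.
  rewrite [leRHS]mulrC -RintegralZl_itv; last by cont.
  apply: le_Rintegral_itv.
  - by cont => x; exact: sq0.
  - by cont.
  - by move=> x _; rewrite /q (mulrA e t) mulrCA.
have := abel_mean cq evq cm H.
have p2 : 0 <= pi / 2 :> R by rewrite divr_ge0 ?pi_ge0.
have t1 y : -1 < e * cos y / cosh a < 1.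
  have := tanh_bound a; rewrite /tanh -/e -mulrA [cos y * _]mulrC mulrA => /andP[h1 h2].
  have := cos_le1 y; have := cos_geN1 y => h3 h4.
  have h0 : 0 < e / cosh a by rewrite divr_gt0 ?cosh_gt0.
  by apply/andP; split; nra.
(* Since [cosh a ^ 2 = 1 + e ^ 2], one has [1 + (e sin y)^2 = cosh a ^ 2 - (e cos y)^2], and the
   integral becomes an arc sine in [e cos y / cosh a], which equals [tanh a] at [y = 0]. *)
have dG (y : R) : is_derive y 1 (fun y => - (L / e) * asin (e * cos y / cosh a)) (sin y * m (sin y)).
  apply: der_eq; first by der; exact: t1.
  have -> : 1 - (e * cos y / cosh a) ^+ 2 = (1 + (e * sin y) ^+ 2) / cosh a ^+ 2.
    rewrite [(e * sin y) ^+ 2]exprMn sin2cos2 expr_div_n [(e * cos y) ^+ 2]exprMn.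
    have -> : cosh a ^+ 2 = 1 + e ^+ 2 by rewrite cosh2_sinh2.
    by field; rewrite gt_eqF.
  rewrite sqrtrM ?ltW // sqrtrV ?sqr_ge0 // sqrtr_sqr ger0_norm ?ltW ?cosh_gt0 //.
  rewrite /m; have := sq0 (e * sin y); have := cosh_neq0 a; set c := cosh a; set s := Num.sqrt _.
  by move=> c0 s0; field; rewrite s0 c0 gt_eqF.
rewrite (Rintegral_FTC p2 _ dG); last by cont.
rewrite cos_pihalf cos0 mulr0 mul0r mulr1 -/(tanh a) asin0.
(* The substitution [y = asinh (e z)] absorbs the square root in [q] and maps [0, 1] onto [0, a]. *)
have dQ (z : R) : is_derive z 1 (fun z => e^-1 * primitive_of f (asinh (e * z))) (q z).
  have dp x := is_derive_primitive x cf.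
  have da x := is_derive_asinh x.
  apply: der_eq.
    apply: derM; first exact: der_cst.
    apply: (der_comp (h := primitive_of f)); first exact: dp.
    apply: (der_comp (h := asinh)); first exact: da.
    by der.
  by rewrite /q; field; rewrite sq0 gt_eqF.
rewrite (Rintegral_FTC ler01 cq dQ) [e * 1]mulr1 [e * 0]mulr0 asinh0 sinhK.
rewrite (Rintegral_primitive (ltW a0) cf) => /(ler_wpM2l (ltW e0)).
set P := primitive_of f a; set Q := primitive_of f 0.
have -> : e * (- (L / e) * 0 - - (L / e) * asin (tanh a)) = L * asin (tanh a).
  by field; rewrite gt_eqF.
by have -> : e * (pi * (e^-1 * P - e^-1 * Q)) = pi * (P - Q) by field; rewrite gt_eqF.
Qed.

End Hyperbolic.

(** * The one-dimensional inequality for the mean conformal factor *)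

Section Profile.
Local Open Scope classical_set_scope.
Local Open Scope ring_scope.
Context {R : realType}.
Notation mu := (@lebesgue_measure R).

Lemma Rintegral_sech (a : R) : 0 <= a ->
  \int[mu]_(y in `[0, a]) (cosh y)^-1 = asin (tanh a).
Proof.
move=> a0; rewrite (Rintegral_FTC a0 continuous_sech is_derive_gd).
by rewrite tanh0 asin0 subr0.
Qed.

Lemma Rintegral_sech2 (a : R) : 0 <= a ->
  \int[mu]_(y in `[0, a]) (cosh y)^-1 ^+ 2 = tanh a.
Proof.
move=> a0; have cs := @continuous_sech R.
have dT (x : R) : is_derive x 1 tanh ((cosh x)^-1 ^+ 2).
  by rewrite exprVn; exact: is_derive_tanh.
rewrite (Rintegral_FTC a0 _ dT); last by cont.
by rewrite tanh0 subr0.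
Qed.

(* The second mean value theorem, for a decreasing weight. *)
Lemma Rintegral_weight_ge0 (d w dw : R -> R) (A : R) : 0 <= A -> continuous d ->
  (forall x : R, is_derive x 1 w (dw x)) ->
  (forall x, 0 <= x <= A -> dw x <= 0) -> 0 <= w A ->
  (forall a, 0 <= a <= A -> 0 <= \int[mu]_(y in `[0, a]) d y) ->
  0 <= \int[mu]_(y in `[0, A]) (d y * w y).
Proof.
move=> A0 cd dW dw0 wA HD.
have cw : continuous w := is_derive_continuous dW.
have cdw : continuous (fun y => d y * w y) by cont.
pose P := primitive_of d; pose Q := primitive_of (fun y => d y * w y).
have dP (x : R) : is_derive x 1 P (d x) := is_derive_primitive x cd.
have dQ (x : R) : is_derive x 1 Q (d x * w x) := is_derive_primitive x cdw.
(* Integration by parts: [G] is the part of the integral that carries [- dw], which is nonnegative,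
   so [G] increases; the boundary term at [A] is nonnegative by [wA]. *)
pose G x := Q x - w x * (P x - P 0).
have dG (x : R) : is_derive x 1 G (- (dw x) * (P x - P 0)).
  have dPx := dP x; have dQx := dQ x; have dWx := dW x.
  apply: der_eq; first by rewrite /G; der.
  by cbv beta; ring.
have GE a : 0 <= a <= A -> 0 <= P a - P 0.
  by move=> aA; have := HD a aA; rewrite Rintegral_primitive //; case/andP: aA.
have : G 0 <= G A.
  have cG : continuous G := is_derive_continuous dG.
  apply: (@ger0_derive1_le_cc R G 0 A); rewrite ?in_itv /= ?lexx ?A0 //.
  - move=> x; rewrite in_itv /= => /andP[x0 xA].
    rewrite derive1E; have [_ ->] := dG x.
    by rewrite mulr_ge0 ?oppr_ge0 ?dw0 ?GE // ?(ltW x0) ?(ltW xA).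
  - exact: continuous_subspaceT.
rewrite (Rintegral_primitive A0 cdw) -/Q /G subrr mulr0 subr0.
have := mulr_ge0 wA (GE A _); rewrite A0 lexx => /(_ isT); lra.
Qed.

(* Here [f] is the mean of the conformal factor over the horizontal circles, and
   the extremal profile is [1 / cosh y] up to height [A], then [1 / 2] up to [B]. *)
Lemma sharp_profile (f : R -> R) (L V W A B : R) :
  continuous f -> 0 <= L -> 0 <= V ->
  0 < B -> 0 <= A -> A <= B -> cosh A <= 2 ->
  (forall y, L <= 2 * pi * f y) ->
  (forall a, 0 <= a -> L * asin (tanh a) <= pi * \int[mu]_(y in `[0, a]) f y) ->
  V <= 2 * \int[mu]_(y in `[0, B]) f y ->
  2 * pi * \int[mu]_(y in `[0, B]) f y ^+ 2 <= W ->
  (tanh A + (B - A) / 4) * (L * V) <= (asin (tanh A) + (B - A) / 2) * W.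
Proof.
move=> cf L0 V0 B0 A0 AB cA Hh Hs Hv HW.
have p0 : 0 < pi :> R := pi_gt0 R.
have cs := @continuous_sech R.
(* With f0 equal to [1 / cosh y] on [0, A] and to [1 / 2] on [A, B], these are the integrals of
   [f0 ^ 2] and of f0 over [0, B]. *)
pose E := tanh A + (B - A) / 4; pose I := asin (tanh A) + (B - A) / 2.
pose S1 := \int[mu]_(y in `[0, A]) (f y * (cosh y)^-1).
pose F1 := \int[mu]_(y in `[0, A]) f y; pose F2 := \int[mu]_(y in `[A, B]) f y.
pose Q1 := \int[mu]_(y in `[0, A]) f y ^+ 2; pose Q2 := \int[mu]_(y in `[A, B]) f y ^+ 2.
have FE : \int[mu]_(y in `[0, B]) f y = F1 + F2.
  by rewrite (Rintegral_itv_cat A0 AB) //; exact: continuous_integrable.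
have QE : \int[mu]_(y in `[0, B]) f y ^+ 2 = Q1 + Q2.
  by rewrite (Rintegral_itv_cat A0 AB) //; apply: continuous_integrable; cont.
have AB0 : 0 <= B - A by rewrite subr_ge0.
have sech01 (y : R) : 0 < (cosh y)^-1 <= 1.
  by rewrite invr_gt0 cosh_gt0 invf_le1 ?cosh_ge1 ?cosh_gt0.
have tA : tanh A <= asin (tanh A).
  rewrite -Rintegral_sech // -[leLHS]Rintegral_sech2 //.
  apply: le_Rintegral_itv; [by cont|by []|] => y _.
  by have := sech01 y; nra.
have E0 : 0 < E.
  move: AB; rewrite le_eqVlt => /predU1P[AB|AB].
    by rewrite /E -AB subrr mul0r addr0 /tanh divr_gt0 ?cosh_gt0 ?sinh_gt0 // AB.
  have t0 : 0 <= tanh A by rewrite /tanh divr_ge0 ?sinh_ge0 // ltW ?cosh_gt0.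
  by rewrite /E; lra.
have EI : E <= I by rewrite /E /I; lra.
have I0 : 0 < I by lra.
(* This is the integral of [(f - s f0)^2], expanded; the choice [s = J / E] below, where [J] is the
   integral of [f f0], gives the Cauchy-Schwarz inequality. *)
have sqH s : 0 <= Q1 - 2 * s * S1 + s ^+ 2 * tanh A + (Q2 - s * F2 + s ^+ 2 / 4 * (B - A)).
  apply: addr_ge0.
    have -> : Q1 - 2 * s * S1 + s ^+ 2 * tanh A =
        \int[mu]_(y in `[0, A]) (f y ^+ 2 - 2 * s * (f y * (cosh y)^-1)
          + s ^+ 2 * (cosh y)^-1 ^+ 2).
      rewrite RintegralD_itv; [|by cont|by cont].
      rewrite RintegralB_itv; [|by cont|by cont].
      rewrite RintegralZl_itv; last by cont.
      rewrite RintegralZl_itv; last by cont.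
      by rewrite Rintegral_sech2.
    apply: Rintegral_ge0 => y _.
    by have := sqr_ge0 (f y - s * (cosh y)^-1); lra.
  have -> : Q2 - s * F2 + s ^+ 2 / 4 * (B - A) =
      \int[mu]_(y in `[A, B]) (f y ^+ 2 - s * f y + s ^+ 2 / 4).
    rewrite RintegralD_itv; [|by cont|by cont].
    rewrite RintegralB_itv; [|by cont|by cont].
    rewrite RintegralZl_itv; last by cont.
    by rewrite Rintegral_itv_cst.
  apply: Rintegral_ge0 => y _.
  by have := sqr_ge0 (f y - s / 2); lra.
(* [k I = E / 2] is what makes the final step sharp: when [f = l f0] and [V = 2 l I], the two terms
   [k V / 2] and [l E / 2] of the lower bound for [J] coincide, so passing from their sum to the
   product [L V] by the inequality of means loses nothing. *)
pose k := E / (2 * I); pose l := L / pi.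
have k0 : 0 < k by rewrite /k divr_gt0 ?mulr_gt0.
have k12 : k <= 1 / 2.
  rewrite /k ler_pdivrMr ?mulr_gt0 //; lra.
have l0 : 0 <= l by rewrite /l divr_ge0 // ltW.
(* The weighted inequality for [d = f - l / cosh] and the weight [1 / cosh - k]: the integrals of
   [d] over [0, a] are nonnegative by the band bound [Hs], and the weight at [A] is at least
   [1 / 2 - k]. *)
have H1 : 0 <= S1 - k * F1 - l * tanh A + l * k * asin (tanh A).
  have dw (x : R) : is_derive x 1 (fun y => (cosh y)^-1 - k) (- (sinh x / cosh x ^+ 2)).
    have ds := is_derive_sech x.
    apply: der_eq; first by apply: derD; [exact: ds|exact: derN (der_cst _ _)].
    by rewrite oppr0 addr0.
  have := @Rintegral_weight_ge0 (fun y => f y - l * (cosh y)^-1) _ _ A A0 _ dw.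
  have -> : \int[mu]_(y in `[0, A]) ((f y - l * (cosh y)^-1) * ((cosh y)^-1 - k)) =
      \int[mu]_(y in `[0, A]) (f y * (cosh y)^-1 - k * f y - l * (cosh y)^-1 ^+ 2
        + l * k * (cosh y)^-1).
    by apply: eq_Rintegral => y _; ring.
  rewrite RintegralD_itv; [|by cont|by cont].
  rewrite RintegralB_itv; [|by cont|by cont].
  rewrite RintegralB_itv; [|by cont|by cont].
  rewrite RintegralZl_itv; last by cont.
  rewrite RintegralZl_itv; last by cont.
  rewrite RintegralZl_itv; last by cont.
  rewrite Rintegral_sech2 // Rintegral_sech //; apply.
  - by cont.
  - move=> x /andP[x0 _]; rewrite oppr_le0 divr_ge0 ?sinh_ge0 ?sqr_ge0 //.
  - have : 2^-1 <= (cosh A)^-1 by rewrite lef_pV2 ?posrE ?cosh_gt0.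
    by lra.
  - move=> a /andP[a0 aA].
    rewrite RintegralB_itv; [|by cont|by cont].
    rewrite RintegralZl_itv; last by cont.
    rewrite Rintegral_sech // subr_ge0 /l mulrAC ler_pdivrMr // [leRHS]mulrC.
    exact: Hs.
have H2 : l / 2 * (B - A) <= F2.
  rewrite -Rintegral_itv_cst //; apply: le_Rintegral_itv; [by cont|by []|] => y _.
  rewrite /l mulrAC ler_pdivrMr // ler_pdivrMr //.
  by apply: le_trans (Hh y) _; rewrite -mulrA [pi * _]mulrC [2 * _]mulrC.
pose J := S1 + F2 / 2.
(* On [A, B] the weight is the constant [1 / 2 - k >= 0], so [H1] and [H2] together say that
   [J - k F >= l (E - k I) = l E / 2], where [F] is the whole integral of [f], at least [V / 2]. *)
have JY : k * V / 2 + l * E / 2 <= J.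
  have kI : k * I = E / 2 by rewrite /k; field; rewrite gt_eqF.
  have kV : k * V <= k * (2 * (F1 + F2)) by rewrite ler_pM2l // -FE.
  have H3 : 0 <= (1 / 2 - k) * (F2 - l / 2 * (B - A)).
    by rewrite mulr_ge0 // subr_ge0.
  have lkI : l * (k * I) = l * (E / 2) by rewrite kI.
  have lE : l * E = l * tanh A + l * ((B - A) / 4) by rewrite /E mulrDr.
  have lI : l * (k * I) = l * k * asin (tanh A) + l * k * ((B - A) / 2).
    by rewrite /I; ring.
  by rewrite /J; lra.
have JQ : J ^+ 2 <= E * (Q1 + Q2).
  have H := sqH (J / E).
  have : 0 <= E * (Q1 + Q2) - J ^+ 2.
    have -> : E * (Q1 + Q2) - J ^+ 2 = E * (Q1 - 2 * (J / E) * S1 + (J / E) ^+ 2 * tanh A +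
        (Q2 - J / E * F2 + (J / E) ^+ 2 / 4 * (B - A))).
      transitivity (E * (Q1 + Q2) - 2 * J * (S1 + F2 / 2) + (J ^+ 2 / E) * (tanh A + (B - A) / 4)).
        by rewrite -/E -/J; field; rewrite gt_eqF.
      by field; rewrite gt_eqF.
    by rewrite mulr_ge0 // ltW.
  by rewrite subr_ge0.
have JY2 : (k * V) * (l * E) <= J ^+ 2.
  have Y0 : 0 <= k * V / 2 + l * E / 2.
    by rewrite addr_ge0 // divr_ge0 // mulr_ge0 // ltW.
  have := ler_pM Y0 Y0 JY JY; rewrite -!expr2.
  have := sqr_ge0 (k * V / 2 - l * E / 2); lra.
have H4 : (k * V) * (l * E) * (2 * pi) <= E * W.
  apply: le_trans (ler_wpM2l (ltW E0) HW); rewrite QE.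
  rewrite [leRHS]mulrCA [leRHS]mulrC ler_pM2r ?mulr_gt0 //.
  exact: le_trans JY2 JQ.
have H5 : (k * V) * (l * E) * (2 * pi) = E * (E * (L * V) / I).
  by rewrite /k /l; move: (pi : R) p0 => w w0; field; rewrite !gt_eqF.
by move: H4; rewrite H5 ler_pM2l // ler_pdivrMr // [W * _]mulrC.
Qed.

End Profile.

(** * Lifting of homotopies *)

Section Deck.
Local Open Scope classical_set_scope.
Local Open Scope ring_scope.
Context {R : realType} (b : R).
Implicit Types (g h : plane R -> plane R) (z w : plane R) (m k : int).

(** The normal form [t ^ k sigma ^ m] of a deck transformation: conjugation by sigma inverts [t], so
    powers of [t] can always be collected on the left. *)
Definition deckf m k z : plane R :=
  (z.1 + m%:~R * pi, (-1) ^ m * z.2 + k%:~R * b).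

Lemma deckf0 : deckf 0 0 = id.
Proof.
by apply/funext => -[x y]; rewrite /deckf /= !mul0r !addr0 expr0z mul1r.
Qed.

Lemma signz_unit : (-1 : R) \is a GRing.unit.
Proof. by rewrite unitrN1. Qed.

Lemma signzD1 m : (-1 : R) ^ (m + 1) = - ((-1) ^ m).
Proof. by rewrite exprzDr ?signz_unit // expr1z mulrN1. Qed.

Lemma signzB1 m : (-1 : R) ^ (m - 1) = - ((-1) ^ m).
Proof. by rewrite exprzDr ?signz_unit // -invr_expz expr1z invrN1 mulrN1. Qed.

Lemma deck_normal g : deck b g -> exists m k, g = deckf m k.
Proof.
elim=> [|{}g _ [m [k ->]]|{}g _ [m [k ->]]|{}g _ [m [k ->]]|{}g _ [m [k ->]]].
- by exists 0, 0; rewrite deckf0.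
- exists (m + 1), (- k); apply/funext => z.
  by rewrite /deckf /glide /= signzD1 intrD mulrDl mul1r intrN; congr pair; ring.
- exists (m - 1), (- k); apply/funext => z.
  by rewrite /deckf /glideV /= signzB1 intrD !intrN; congr pair; ring.
- exists m, (k + 1); apply/funext => z.
  by rewrite /deckf /vtrans /= intrD mulrDl mul1r; congr pair; ring.
- exists m, (k - 1); apply/funext => z.
  by rewrite /deckf /vtrans /= intrD mulrDl intrN mulN1r; congr pair; ring.
Qed.

Lemma signz m : (-1 : R) ^ m = 1 \/ (-1 : R) ^ m = -1.
Proof.
have S (n : nat) : (-1 : R) ^+ n = 1 \/ (-1 : R) ^+ n = -1.
  by rewrite -signr_odd; case: odd; [right|left]; rewrite ?expr1 ?expr0.
case: m => n; first exact: S.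
by case: (S n.+1) => H; [left|right]; rewrite NegzE -exprnN H ?invr1 ?invrN1.
Qed.

(** The linear part is diagonal with entries 1 and -1 or 1, hence isometric for the sup norm too. *)
Lemma deck_ball g z w e : deck b g -> ball z e w -> ball (g z) e (g w).
Proof.
case/deck_normal => m [k ->] [/= h1 h2]; split; rewrite /ball /= in h1 h2 *.
  by rewrite opprD addrACA subrr addr0.
rewrite opprD addrACA subrr addr0 -mulrBr normrM.
by case: (signz m) => ->; rewrite ?normrN1 ?normr1 mul1r.
Qed.

Lemma deck_continuous g : deck b g -> continuous g.
Proof.
move=> dg z; apply/cvg_ballP => e e0.
by apply: filterS (nbhsx_ballx z e e0) => w; exact: deck_ball.
Qed.

(** If [m] is not 0, the abscissa moves by at least [pi]; if [m = 0], there is no reflection and the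
    ordinate moves by [|k| b]. *)
Lemma deck_id_of_near g z e : 0 < b -> e <= pi -> e <= b ->
  deck b g -> ball z e (g z) -> g = id.
Proof.
move=> b0 ep eb /deck_normal[m [k ->]] [] /=.
have int1 (n : int) : n != 0 -> 1 <= `|n%:~R : R|.
  move=> n0; rewrite -intr_norm (_ : 1 = 1%:~R) // ler_int.
  by rewrite -gtz0_ge1 normr_gt0.
rewrite /ball /= opprD addrA subrr sub0r normrN normrM (ger0_norm (pi_ge0 R)) => h1.
have [m0|/int1 m0] := eqVneq m 0; last by exfalso; have := pi_gt0 R; nra.
rewrite m0 expr0z mul1r opprD addrA subrr sub0r normrN normrM (gtr0_norm b0) => h2.
have [k0|/int1 k0] := eqVneq k 0; last by exfalso; nra.
by rewrite k0 deckf0.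
Qed.

Lemma deck_eq g h z : 0 < b -> deck b g -> deck b h -> g z = h z -> g = h.
Proof.
move=> b0 dg dh gh; have [h' dh' hK] := deck_inv dh.
have [h'' _ hK'] := deck_inv dh'.
have h'h : cancel h' h by move=> w; apply: (can_inj hK'); rewrite hK.
have m0 : 0 < Num.min pi b by rewrite lt_min pi_gt0.
have : h' \o g = id.
  apply: (@deck_id_of_near _ z (Num.min pi b)) => //.
  - by rewrite ge_min lexx.
  - by rewrite ge_min lexx orbT.
  - exact: deck_comp.
  - by rewrite /= gh hK; exact: ballxx.
by move=> E; apply/funext => w; rewrite -[RHS](congr1 h (congr1 (@^~ w) E)) /= h'h.
Qed.

Lemma klein_piP z w : klein_pi b z = klein_pi b w <-> exists2 g, deck b g & w = g z.
Proof.
split => [/eqmodP/asboolP //|H].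
by apply/eqmodP; apply/asboolP.
Qed.

Lemma klein_pi_deck g z : deck b g -> klein_pi b (g z) = klein_pi b z.
Proof. by move=> dg; apply/esym/klein_piP; exists g. Qed.

Lemma klein_pi_continuous : continuous (klein_pi b : plane R -> klein b).
Proof. exact: pi_continuous. Qed.

Lemma klein_pi_surj p : exists z, klein_pi b z = p.
Proof. by exists (repr p); rewrite /klein_pi reprK. Qed.

(** The quotient carries a topology but no distance here; this relation serves as the entourage of
    size [e]. *)
Definition close (e : R) (p q : klein b) : Prop :=
  exists z w, [/\ klein_pi b z = p, klein_pi b w = q & ball z e w].

(** Deck transformations preserve balls, so the witness of closeness can be moved to any prescribed
    point over [p]. *)
Lemma close_lift e p q z : close e p q -> klein_pi b z = p ->
  exists2 w, klein_pi b w = q & ball z e w.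
Proof.
move=> [z' [w' [zp wq zw]]] zp'.
have [g dg E] : exists2 g, deck b g & z = g z' by apply/klein_piP; rewrite zp.
exists (g w'); first by rewrite klein_pi_deck.
by rewrite E; exact: deck_ball.
Qed.

Lemma close_near e p : 0 < e -> \forall q \near p, close e p q.
Proof.
move=> e0; have [z zp] := klein_pi_surj p.
(* The image of the interior of the ball. It is open because its preimage is the union of the deck
   translates of that interior. *)
pose U : set (klein b) := [set q | exists w, klein_pi b w = q /\ nbhs w (fun w' => ball z e w')].
have Up : U p by exists z; split => //; exact: nbhsx_ballx.
have oU : open U.
  rewrite /open /= /quotient_open openE => w [w' [ww' nw']].
  have [g dg E] : exists2 g, deck b g & w' = g w by apply/klein_piP; rewrite ww'.
  rewrite E in nw'.
  suff : nbhs w (fun v => nbhs (g v) (ball z e)).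
    by apply: filterS => v nv; exists (g v); split => //; exact: klein_pi_deck.
  exact: (@deck_continuous g dg w _ (nbhs_interior nw')).
apply: filterS (open_nbhs_nbhs (conj oU Up)) => q [w [wq nw]].
by exists z, w; split => //; exact: nbhs_singleton.
Qed.

End Deck.

Section Lebesgue.
Local Open Scope classical_set_scope.
Local Open Scope ring_scope.
Context {R : realType} {T : pseudoMetricType R}.

(** Two relations replace a distance on the target: [half] stands for closeness at half the scale
    and [ent] for closeness at full scale. This covers both curves in the plane and homotopies in
    the quotient, where only [close] is at hand. *)
Lemma lebesgue_number (A : set T) (half ent : T -> T -> Prop) : compact A ->
  (forall x, A x -> \forall y \near x, A y -> half x y) ->
  (forall x y z, half x y -> half x z -> ent y z) ->
  \forall d \near (0 : R)^'+, forall x y, A x -> A y -> ball x d y -> ent x y.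
Proof.
move=> cA nA hE.
have /compact_near_coveringP cov := cA.
have H : \forall d \near (0 : R)^'+,
    A `<=` (fun x => A x -> forall y, A y -> ball x d y -> ent x y).
  apply: cov => x Ax.
  have /nbhs_ballP[r /= r0 xr] := nA x Ax.
  have r2 : 0 < r / 2 by rewrite divr_gt0.
  near=> z d => /= Az y Ay zy.
  have xz : ball x (r / 2) z by near: z; exact: nbhsx_ballx.
  have dr : d <= r / 2 by near: d; exact: nbhs_right_le.
  apply: (hE x); apply: xr => //.
    by apply: le_ball xz; lra.
  have := ball_triangle xz (le_ball dr zy).
  by rewrite -splitr.
by apply: filterS H => d Hd x y Ax Ay; exact: (Hd x Ax).
Unshelve. all: by end_near. Qed.

End Lebesgue.

Section Lifting.
Local Open Scope classical_set_scope.
Local Open Scope ring_scope.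
Context {R : realType} (b : R) (b0 : 0 < b).
Implicit Types (u v : nat -> plane R) (z w : plane R).

Let r : R := Num.min pi b.

Let r0 : 0 < r.
Proof. by rewrite /r lt_min pi_gt0. Qed.

Lemma near_fibre z w : klein_pi b z = klein_pi b w -> ball z r w -> z = w.
Proof.
move=> /klein_piP[g dg ->] zg; rewrite (@deck_id_of_near R b g z r) //.
- by rewrite /r ge_min lexx.
- by rewrite /r ge_min lexx orbT.
Qed.

Lemma close_triangle e e' (p q q' : klein b) :
  close e p q -> close e' p q' -> close (e + e') q q'.
Proof.
move=> pq pq'; have [z zp] := klein_pi_surj p.
have [w wq zw] := close_lift pq zp; have [w' wq' zw'] := close_lift pq' zp.
by exists w, w'; split => //; exact: ball_triangle (ball_sym zw) zw'.
Qed.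

(** Two chains that start close and have close projections stay in the same sheet. The lift [w] near
    [u (j + 1)] and the point [v (j + 1)] lie in one fibre and are joined through [u (j + 1)],
    [u j], [v j] by four steps of size [e], so they coincide. *)
Lemma row_compare u v N e : 4 * e <= r ->
  (forall j, (j < N)%N -> ball (u j) e (u j.+1)) ->
  (forall j, (j < N)%N -> ball (v j) e (v j.+1)) ->
  (forall j, (j <= N)%N -> close e (klein_pi b (u j)) (klein_pi b (v j))) ->
  ball (u 0%N) e (v 0%N) -> forall j, (j <= N)%N -> ball (u j) e (v j).
Proof.
move=> er su sv uv uv0; elim=> [//|j IH] jN.
have [w wv uw] := close_lift (uv _ jN) erefl.
suff -> : v j.+1 = w by [].
symmetry; apply: near_fibre => //.
apply: (le_ball er).
have -> : 4 * e = e + e + e + e by ring.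
apply: ball_triangle (sv _ jN).
apply: ball_triangle (IH (ltnW jN)).
apply: ball_triangle (ball_sym (su _ jN)).
exact: ball_sym.
Qed.

(** Path lifting for a discrete path: each next point is chosen over [p (j + 1)] near the previous
    one. *)
Lemma row_lift (p : nat -> klein b) N e z : klein_pi b z = p 0%N ->
  (forall j, (j < N)%N -> close e (p j) (p j.+1)) ->
  exists u, [/\ u 0%N = z, forall j, (j <= N)%N -> klein_pi b (u j) = p j &
                 forall j, (j < N)%N -> ball (u j) e (u j.+1)].
Proof.
move=> zp cp.
pose nx j w := get (fun w' => klein_pi b w' = p j.+1 /\ ball w e w').
pose u := fix u j := if j is j'.+1 then nx j' (u j') else z.
have nxP j : (j < N)%N -> klein_pi b (u j) = p j ->
    klein_pi b (u j.+1) = p j.+1 /\ ball (u j) e (u j.+1).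
  move=> jN uj; have [w wq uw] := close_lift (cp j jN) uj.
  by apply: (@getPex _ (fun w' => klein_pi b w' = p j.+1 /\ ball (u j) e w')); exists w.
have up j : (j <= N)%N -> klein_pi b (u j) = p j.
  by elim: j => [//|j IH] jN; case: (nxP _ jN (IH (ltnW jN))).
exists u; split=> // j jN; by case: (nxP _ jN (up _ (ltnW jN))).
Qed.

Lemma segment01_compact : compact (`[0, 1] : set R).
Proof. exact: segment_compact. Qed.

Lemma within_unif (c : R -> plane R) (e : R) : 0 < e -> {within `[0, 1], continuous c} ->
  \forall d \near (0 : R)^'+, forall x y : R, `[0, 1]%classic x -> `[0, 1]%classic y ->
    ball x d y -> ball (c x) e (c y).
Proof.
move=> e0 /subspace_continuousP cc.
apply: (@lebesgue_number R R `[0, 1] (fun x y => ball (c x) (e / 2) (c y))).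
- exact: segment01_compact.
- move=> x x01; have e2 : 0 < e / 2 by rewrite divr_gt0.
  have := cc x x01 _ (nbhsx_ballx (c x) _ e2).
  by rewrite /= /within /= near_simpl.
- by move=> x y z xy xz; rewrite [e]splitr; exact: ball_triangle (ball_sym xy) xz.
Qed.

(** The homotopy is sampled on a grid and lifted row by row. The deck transformation [f] that takes
    the first point of a row to its last is the same for all rows, by the separation of fibres; on
    the last row, which lies over the loop of [g], it turns out to be the conjugate of [g] by
    [h]. *)
Theorem freely_homotopic_deck (c : R -> plane R) (g : plane R -> plane R) :
  deck b g -> {within `[0, 1], continuous c} ->
  klein_pi b (c 0) = klein_pi b (c 1) ->
  freely_homotopic (klein_pi b \o c) (deck_loop b g) ->
  exists h w, [/\ deck b h, c 0 = h w & c 1 = h (g w)].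
Proof.
move=> dg cc ccl [H [/subspace_continuousP cH H0 H1 Hs]].
pose e := r / 4.
have e0 : 0 < e by rewrite /e divr_gt0.
have e2 : 0 < e / 2 by rewrite divr_gt0.
have er : 4 * e <= r by rewrite /e; lra.
pose seg (t : R) : plane R := (1 - t) *: (0 : plane R) + t *: g 0.
have cseg : {within `[0, 1], continuous seg}.
  apply: continuous_subspaceT => t; apply: cvgD.
    by apply: cvgZ; [apply: cvgB; [exact: cvg_cst|exact: cvg_id]|exact: cvg_cst].
  by apply: cvgZ; [exact: cvg_id|exact: cvg_cst].
have NH : \forall d \near (0 : R)^'+, forall x y : (R * R)%type,
    (`[0, 1] `*` `[0, 1])%classic x -> (`[0, 1] `*` `[0, 1])%classic y ->
    ball x d y -> close e (H x) (H y).
  apply: (@lebesgue_number R (R * R)%type (`[0, 1] `*` `[0, 1])%classic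
    (fun x y => close (e / 2) (H x) (H y))).
  - by apply: compact_setX; exact: segment01_compact.
  - move=> x x01; have := cH x x01 _ (close_near (H x) e2).
    by rewrite /= /within /= near_simpl.
  - by move=> x y z xy xz; rewrite [e]splitr; exact: close_triangle xy xz.
have d0 : \forall d \near (0 : R)^'+, 0 < d by exact: nbhs_right_gt.
have [d [[[{}NH Nc] Ns] {}d0]] := filter_ex (filterI (filterI (filterI NH
  (within_unif e0 cc)) (within_unif e0 cseg)) d0).
have [n nd] : exists n : nat, n.+1%:R^-1 < d.
  have [n _ Hn] := near_infty_natSinv_lt (PosNum d0).
  by exists n; exact: (Hn n (leqnn n)).
set N := n.+1 in nd.
pose t j : R := j%:R / N%:R.
have N0 : 0 < N%:R :> R by [].
have t01 j : (j <= N)%N -> `[0, 1]%classic (t j).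
  move=> jN; rewrite /= in_itv /= /t divr_ge0 //=.
  by rewrite ler_pdivrMr // mul1r ler_nat.
have tS j : ball (t j) d (t j.+1).
  rewrite /ball /= /t -mulrBl -natr1 opprD addrA subrr sub0r mulN1r normrN.
  by rewrite gtr0_norm // invr_gt0.
have t0 : t 0%N = 0 by rewrite /t mul0r.
have tN : t N = 1 by rewrite /t divff // gt_eqF.
have [f df cf] : exists2 f, deck b f & c 1 = f (c 0) by apply/klein_piP.
have in01 (x : R) : `[0, 1]%classic x -> x \in `[0, 1] by [].
(* The invariant: the lift of row [i] is closed up by the same [f] as the lift [c] itself, which is
   row 0. *)
have row i : (i <= N)%N -> exists u, [/\ u N = f (u 0%N),
    forall j, (j <= N)%N -> klein_pi b (u j) = H (t i, t j) &
    forall j, (j < N)%N -> ball (u j) e (u j.+1)].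
  elim: i => [|i IH] iN.
    exists (c \o t); split => [|j jN|j jN] /=.
    - by rewrite t0 tN.
    - by rewrite t0 H0 //; exact: in01 (t01 _ jN).
    - by apply: Nc => //; [exact: t01 (ltnW jN)|exact: t01].
  have [u [uN uH us]] := IH (ltnW iN).
  have cl j : (j <= N)%N -> close e (H (t i, t j)) (H (t i.+1, t j)).
    move=> jN; apply: NH; split => /=; try exact: t01; try exact: t01 (ltnW iN).
    - exact: tS.
    - exact: ballxx.
  have [z zH uz] := close_lift (cl 0%N isT) (uH 0%N isT).
  have [v [v0 vH vs]] : exists v, [/\ v 0%N = z,
      forall j, (j <= N)%N -> klein_pi b (v j) = H (t i.+1, t j) &
      forall j, (j < N)%N -> ball (v j) e (v j.+1)].
    apply: (row_lift (p := fun j => H (t i.+1, t j))) => // j jN.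
    apply: NH; split => /=; try exact: t01; try exact: t01 (ltnW jN).
    - exact: ballxx.
    - exact: tS.
  exists v; split => //.
  have uv : ball (u N) e (v N).
    apply: (row_compare er us vs) => //; last by rewrite v0.
    by move=> j jN; rewrite uH // vH //; exact: cl.
  symmetry; apply: near_fibre.
    rewrite klein_pi_deck // !vH // t0 tN.
    by apply: Hs; exact: in01 (t01 _ iN).
  have : ball (f (v 0%N)) (e + e) (v N).
    apply: ball_triangle uv; rewrite uN; apply: (deck_ball df).
    by apply: ball_sym; rewrite v0.
  by apply: le_ball; lra.
have [u [uN uH us]] := row N (leqnn N).
have [h dh hu] : exists2 h, deck b h & u 0%N = h (seg 0).
  apply/klein_piP; rewrite uH // t0 tN H1 //.
  by rewrite in_itv /= lexx ler01.
(* The last row and the translate by [h] of the segment from 0 to [g 0] lie over the same loop and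
   start at the same point, hence also end at the same point. *)
have uh : ball (u N) e (h (seg (t N))).
  apply: (row_compare (v := fun j => h (seg (t j))) er us) => // [j jN|j jN|].
  - apply: (deck_ball dh).
    by apply: Ns => //; [exact: t01 (ltnW jN)|exact: t01].
  - rewrite uH // klein_pi_deck // tN H1; last exact: in01 (t01 _ jN).
    exists (seg (t j)), (seg (t j)); split => //; exact: ballxx.
  - by rewrite hu t0; exact: ballxx.
have {}uh : u N = h (seg (t N)).
  apply: near_fibre; last by apply: le_ball uh; lra.
  rewrite uH // klein_pi_deck // tN H1 //.
  by rewrite in_itv /= lexx ler01.
have s0 : seg 0 = 0 by rewrite /seg scaler0 scale0r addr0.
have s1 : seg 1 = g 0 by rewrite /seg scaler0 scale1r add0r.
(* Both sides agree at 0, and deck transformations that agree at one point are equal. *)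
have fh : f \o h = h \o g.
  apply: (@deck_eq _ _ _ _ 0 b0); [exact: deck_comp|exact: deck_comp|].
  by rewrite /= -s1 -tN -uh uN hu s0.
have [h' dh' hK] := deck_inv dh.
have h'h : cancel h' h.
  by have [h'' _ h'K] := deck_inv dh' => w; apply: (can_inj h'K); rewrite hK.
exists h, (h' (c 0)); split; [exact: dh|by rewrite h'h|].
by rewrite cf -[in LHS](h'h (c 0)); exact: (congr1 (@^~ (h' (c 0))) fh).
Qed.

End Lifting.

(** * Lengths of curves *)

Section Pieces.
Local Open Scope classical_set_scope.
Local Open Scope ring_scope.
Context {R : realType}.
Notation mu := (@lebesgue_measure R).
Implicit Types (f : R -> R) (a b s t : R).

Lemma integrable_itv_oo_cc f a b :
  mu.-integrable `]a, b[ (EFin \o f) -> mu.-integrable `[a, b] (EFin \o f).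
Proof.
move=> /integrableP[mf fi]; have mf' := emeasurable_fun_itv_cc mf.
apply/integrableP; split => //.
by rewrite integral_itv_bndoo //; exact: measurableT_comp.
Qed.

Lemma integrable_itv_cat f a b s : a <= b -> b <= s ->
  mu.-integrable `[a, b] (EFin \o f) -> mu.-integrable `[b, s] (EFin \o f) ->
  mu.-integrable `[a, s] (EFin \o f).
Proof.
move=> ab bs /integrableP[m1 i1] ibs.
have /integrableP[m2 i2] : mu.-integrable `]b, s] (EFin \o f).
  by apply: integrableS ibs => //; apply: subset_itvr; rewrite bnd_simp.
have E : `[a, s]%classic = `[a, b]%classic `|` `]b, s]%classic.
  by rewrite -(@itv_bndbnd_setU _ _ _ (BRight b)) // bnd_simp.
have m12 : measurable_fun (`[a, b]%classic `|` `]b, s]%classic) (EFin \o f).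
  by apply/measurable_funU.
apply/integrableP; rewrite E; split => //.
rewrite ge0_integral_setU //=.
- exact: lte_add_pinfty.
- apply/measurable_EFinP; apply: measurableT_comp => //; exact/measurable_EFinP.
- apply/disj_setPLR => x /=; rewrite !in_itv /= => /andP[_ xb].
  by apply/negP; rewrite negb_and -leNgt xb.
Qed.

Lemma Rintegral_itv_bndoo f a b : mu.-integrable `]a, b[ (EFin \o f) ->
  \int[mu]_(x in `[a, b]) f x = \int[mu]_(x in `]a, b[) f x.
Proof.
by case/integrableP => mf _; rewrite /Rintegral; congr fine; exact: integral_itv_bndoo.
Qed.

(** The retraction of the line onto [[s, t]]: composing with it extends a function continuous within
    a segment to one continuous everywhere. *)
Definition clamp s t (x : R) : R := Num.max s (Num.min t x).

Lemma clamp_in s t x : s <= t -> s <= clamp s t x <= t.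
Proof.
by move=> st; rewrite /clamp le_max lexx /= ge_max st ge_min lexx.
Qed.

Lemma clamp_id s t x : s <= x <= t -> clamp s t x = x.
Proof. by move=> /andP[sx xt]; rewrite /clamp (min_r xt) (max_r sx). Qed.

Lemma clamp_lip s t x y : `|clamp s t x - clamp s t y| <= `|x - y|.
Proof.
by rewrite /clamp /Num.max /Num.min; do 4 case: ifP; rewrite !ler_norml => *;
  have := ler_norm (x - y); have := ler_norm (y - x); rewrite [`|y - x|]distrC; lra.
Qed.

Lemma clamp_continuous {T : topologicalType} (f : R -> T) s t : s <= t ->
  {within `[s, t], continuous f} -> continuous (fun x => f (clamp s t x)).
Proof.
move=> st /subspace_continuousP cf x U /= HU.
have cx : `[s, t]%classic (clamp s t x) by rewrite /= in_itv /= clamp_in.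
have := cf _ cx U HU; rewrite /= /within /= => /nbhs_ballP[e /= e0 eU].
apply/nbhs_ballP; exists e => //= y xy; apply: eU; last first.
  by rewrite /= in_itv /= clamp_in.
exact: le_lt_trans (clamp_lip _ _ _ _) xy.
Qed.

Lemma is_derive_pair (c1 c2 : R -> R) (x a b : R) : is_derive x 1 c1 a ->
  is_derive x 1 c2 b -> is_derive x 1 (fun u => (c1 u, c2 u)) ((a, b) : R * R).
Proof.
move=> [d1 <-] [d2 <-].
have H : h^-1 *: (((fun u => (c1 u, c2 u)) \o shift x) (h *: 1) - (c1 x, c2 x) : R * R)
    @[h --> 0^'] --> ('D_1 c1 x, 'D_1 c2 x) by exact: cvg_pair d1 d2.
by apply: DeriveDef; [exact: cvgP H|exact: cvg_lim H].
Qed.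

Lemma is_derive_fst (c : R -> R * R) (x : R) (d : R * R) :
  is_derive x 1 c d -> is_derive x 1 (fun u => (c u).1) d.1.
Proof.
move=> [dc <-].
have H : h^-1 *: (((fun u => (c u).1) \o shift x) (h *: 1) - (c x).1)
    @[h --> 0^'] --> ('D_1 c x).1 by exact: (cvg_comp _ _ dc (@cvg_fst _ _ _ _ _)).
by apply: DeriveDef; [exact: cvgP H|exact: cvg_lim H].
Qed.

Lemma is_derive_snd (c : R -> R * R) (x : R) (d : R * R) :
  is_derive x 1 c d -> is_derive x 1 (fun u => (c u).2) d.2.
Proof.
move=> [dc <-].
have H : h^-1 *: (((fun u => (c u).2) \o shift x) (h *: 1) - (c x).2)
    @[h --> 0^'] --> ('D_1 c x).2 by exact: (cvg_comp _ _ dc (@cvg_snd _ _ _ _ _)).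
by apply: DeriveDef; [exact: cvgP H|exact: cvg_lim H].
Qed.

Lemma near_at_right (P : set R) (x : R) :
  (\forall y \near x, P y) -> \forall y \near x^'+, P y.
Proof. by rewrite /at_right /within /=; apply: filterS => y Py _. Qed.

Lemma is_derive_near (f : R -> R) (x a e : R) : is_derive x 1 f a -> 0 < e ->
  \forall y \near x, `|f y - f x - a * (y - x)| <= e * `|y - x|.
Proof.
move=> /is_derive1_caratheodory[g [fg cg ga]] e0.
have : \forall y \near x, `|g x - g y| <= e by move/cvgrPdist_le: cg; apply.
apply: filterS => y gy; rewrite fg -ga -mulrBl normrM ler_wpM2r //.
by rewrite distrC.
Qed.

(** A mean value inequality for upper right derivatives, as [w] need not be differentiable. If it
    failed, [m = w - K - e v] would still increase from [s] to [t] for a small slope [e]; but just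
    after the last point where [m] is at most its starting value, [m] stays below that value. *)
Lemma dini_le (w K k : R -> R) s t : s <= t -> continuous w ->
  (forall x : R, is_derive x 1 K (k x)) ->
  (forall u e, s < u < t -> 0 < e ->
     \forall v \near u, u <= v -> w v - w u <= (k u + e) * (v - u)) ->
  w t - w s <= K t - K s.
Proof.
rewrite le_eqVlt => /predU1P[<-|st] cw dK dw; first by rewrite !subrr.
rewrite leNgt; apply/negP => wK.
pose D := w t - w s - (K t - K s).
have D0 : 0 < D by rewrite subr_gt0.
pose e := D / (2 * (t - s)).
have ts0 : 0 < t - s by rewrite subr_gt0.
have e0 : 0 < e by rewrite divr_gt0 // mulr_gt0.
have e2 : 0 < e / 2 by rewrite divr_gt0.
pose m v := w v - K v - e * v.
have cK : continuous K := is_derive_continuous dK.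
have cm : continuous m by rewrite /m; cont.
have mst : m s < m t.
  have : e * (t - s) = D / 2 by rewrite /e; field; rewrite gt_eqF.
  by rewrite /m /D; move: D0; rewrite /D; lra.
(* The local hypothesis is available only inside []s, t[], so the argument starts slightly after
   [s]. *)
have [s' [ss' s't ms']] : exists s', [/\ s < s', s' < t & m s' < m t].
  have Hn : \forall v \near s^'+, s < v /\ v < t /\ m v < m t.
    near=> v; split; first by near: v; exact: nbhs_right_gt.
    split; first by near: v; exact: nbhs_right_lt.
    by near: v; apply: near_at_right; exact: (cvgr_lt (m s) (cm s)).
  by have [v [v1 [v2 v3]]] := filter_ex Hn; exists v.
pose S := `[s', t]%classic `&` [set v | m v <= m s'].
have cS : compact S.
  apply: compact_closedI; first exact: segment_compact.
  exact: ((continuous_closedP _).1 cm _ (@closed_le _ (m s'))).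
have S0 : S !=set0 by exists s'; split; rewrite /= ?in_itv /= ?lexx // ltW.
have [u Su umax] := compact_EVT_max S0 cS (continuous_subspaceT (@cont_id R)).
move: Su; rewrite inE => -[]; rewrite /= in_itv /= => /andP[s'u ut] mu_.
have {}ut : u < t.
  rewrite lt_neqAle ut andbT; apply/eqP => E; move: ms' mu_; rewrite -E; lra.
have su : s < u < t by rewrite ut (lt_le_trans ss').
have Hn : \forall v \near u^'+, u < v /\ v < t /\
    w v - w u <= (k u + e / 2) * (v - u) /\
    `|K v - K u - k u * (v - u)| <= e / 2 * `|v - u|.
  near=> v.
  have uv : u < v by near: v; exact: nbhs_right_gt.
  split=> //; split; first by near: v; exact: nbhs_right_lt.
  split; last by near: v; apply: near_at_right; exact: is_derive_near.
  have : u <= v -> w v - w u <= (k u + e / 2) * (v - u).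
    by near: v; apply: near_at_right; exact: dw.
  by apply; exact: ltW.
have [v [uv [vt [wv Kv]]]] := filter_ex Hn.
have Sv : S v.
  split; first by rewrite /= in_itv /= (ltW vt) (ltW (le_lt_trans s'u uv)).
  move: Kv; rewrite (gtr0_norm (_ : 0 < v - u)) ?subr_gt0 // ler_norml => /andP[Kv _].
  by rewrite /= /m; move: mu_; rewrite /m; lra.
have := umax v; rewrite inE => /(_ Sv); lra.
Unshelve. all: by end_near. Qed.

End Pieces.

Section Lengths.
Local Open Scope classical_set_scope.
Local Open Scope ring_scope.
Context {R : realType}.
Notation mu := (@lebesgue_measure R).
Implicit Types (c : R -> plane R) (psi Phi : plane R -> R).

Definition enorm (x y : R) : R := Num.sqrt (x ^+ 2 + y ^+ 2).

Lemma enorm_ge0 x y : 0 <= enorm x y.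
Proof. exact: sqrtr_ge0. Qed.

Lemma sqr_enorm x y : enorm x y ^+ 2 = x ^+ 2 + y ^+ 2.
Proof. by rewrite sqr_sqrtr // addr_ge0 // sqr_ge0. Qed.

Lemma enorm_le x y z : 0 <= z -> x ^+ 2 + y ^+ 2 <= z ^+ 2 -> enorm x y <= z.
Proof.
by move=> z0 H; rewrite -(ler_sqr (enorm_ge0 x y)) ?nnegrE // sqr_enorm.
Qed.

Lemma ler_norm_enorm1 x y : `|x| <= enorm x y.
Proof. by rewrite -sqrtr_sqr ler_sqrt ?addr_ge0 ?sqr_ge0 // lerDl sqr_ge0. Qed.

Lemma ler_norm_enorm2 x y : `|y| <= enorm x y.
Proof. by rewrite -sqrtr_sqr ler_sqrt ?addr_ge0 ?sqr_ge0 // lerDr sqr_ge0. Qed.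

Lemma enorm_scale x y k : 0 <= k -> enorm (x * k) (y * k) = enorm x y * k.
Proof.
move=> k0; rewrite /enorm !exprMn -mulrDl sqrtrM ?addr_ge0 ?sqr_ge0 //.
by rewrite sqrtr_sqr ger0_norm.
Qed.

(** The shape [x - a + a] is what rewriting backwards with [subrK] produces where this is
    applied. *)
Lemma enorm_perturb x y a b' r : `|x - a| <= r -> `|y - b'| <= r ->
  enorm (x - a + a) (y - b' + b') <= enorm a b' + r + r.
Proof.
move=> X Y; have r0 : 0 <= r := le_trans (normr_ge0 _) X.
have N0 := enorm_ge0 a b'; have Na := ler_norm_enorm1 a b'; have Nb := ler_norm_enorm2 a b'.
apply: enorm_le; first by lra.
have := sqr_enorm a b'; set N := enorm a b' in N0 Na Nb * => NE.
move: X Y Na Nb; rewrite !ler_norml; set p := x - a; set q := y - b'.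
move=> /andP[p1 p2] /andP[q1 q2] /andP[a1 a2] /andP[b1 b2].
have h1 : p * a <= r * N by nra.
have h2 : q * b' <= r * N by nra.
have h3 : p ^+ 2 <= r ^+ 2 by nra.
have h4 : q ^+ 2 <= r ^+ 2 by nra.
nra.
Qed.

(* The metric [Phi] dominates the Lipschitz constant of [psi] at each point. *)
Definition loc_lip Phi psi := forall z (e : R), 0 < e ->
  \forall w \near z, psi w - psi z <= (Phi z + e) * enorm (w.1 - z.1) (w.2 - z.2).

Definition speed c (u : R) : R :=
  Num.sqrt (derive1 (fun u => (c u).1) u ^+ 2 + derive1 (fun u => (c u).2) u ^+ 2).

(** The upper right derivative of [psi] along the curve is at most [Phi] times the speed, so
    [dini_le] compares the increment of [psi] with a primitive of that product. *)
Lemma piece_length Phi psi c (s t : R) : continuous Phi -> (forall z, 0 <= Phi z) ->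
  continuous psi -> loc_lip Phi psi -> s < t -> C1_on c s t ->
  mu.-integrable `[s, t] (EFin \o (fun u => Phi (c u) * speed c u)) /\
  psi (c t) - psi (c s) <= \int[mu]_(u in `[s, t]) (Phi (c u) * speed c u).
Proof.
move=> cP P0 cpsi lip st [cc [d [cd dc]]].
have {}cc := clamp_continuous (ltW st) cc.
have {}cd := clamp_continuous (ltW st) cd.
set c' := fun x => _ in cc; set d' := fun x => _ in cd.
have cP' : continuous (fun u => Phi (c' u)) by move=> u; apply: continuous_comp; [exact: cc|exact: cP].
have cpsi' : continuous (fun u => psi (c' u)) by move=> u; apply: continuous_comp; [exact: cc|exact: cpsi].
have cd1 : continuous (fun u => (d' u).1) by move=> u; apply: continuous_comp; [exact: cd|exact: cvg_fst].
have cd2 : continuous (fun u => (d' u).2) by move=> u; apply: continuous_comp; [exact: cd|exact: cvg_snd].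
pose k u := Phi (c' u) * enorm (d' u).1 (d' u).2.
have ck : continuous k by rewrite /k /enorm; cont.
(* [speed] uses two-sided derivatives and is uncontrolled at the ends of a piece. The continuous [k]
   agrees with the integrand inside, which is enough for integrals. *)
have Ik u : s < u < t -> Phi (c u) * speed c u = k u.
  move=> /andP[su ut]; have uI : u \in `]s, t[ by rewrite in_itv /= su.
  have du := dc u uI.
  have id : clamp s t u = u by rewrite clamp_id // (ltW su) ltW.
  rewrite /k /c' /d' id /speed !derive1E.
  by have [_ ->] := is_derive_fst du; have [_ ->] := is_derive_snd du.
have ik : mu.-integrable `]s, t[ (EFin \o k).
  by apply: integrableS (continuous_integrable s t ck) => //; exact: subset_itv_oo_cc.
have iI : mu.-integrable `]s, t[ (EFin \o (fun u => Phi (c u) * speed c u)).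
  apply: eq_integrable ik => // u; rewrite inE /= in_itv /= => uI.
  by rewrite Ik.
split; first exact: integrable_itv_oo_cc.
have -> : \int[mu]_(u in `[s, t]) (Phi (c u) * speed c u) = \int[mu]_(u in `[s, t]) k u.
  rewrite (Rintegral_itv_bndoo iI) (Rintegral_itv_bndoo ik).
  by apply: eq_Rintegral => u; rewrite inE /= in_itv /= => uI; rewrite Ik.
rewrite (Rintegral_primitive (ltW st) ck).
have ct : c t = c' t by rewrite /c' clamp_id // lexx ltW.
have cs : c s = c' s by rewrite /c' clamp_id // lexx ltW.
rewrite ct cs.
apply: (@dini_le R (fun u => psi (c' u)) _ k s t (ltW st) cpsi').
  by move=> x; exact: is_derive_primitive.
move=> u e /andP[su ut] e0.
have uI : u \in `]s, t[ by rewrite in_itv /= su.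
have id : clamp s t u = u by rewrite clamp_id // (ltW su) ltW.
have du := dc u uI.
set N := enorm (d' u).1 (d' u).2.
have N0 : 0 <= N := enorm_ge0 _ _.
have PN : 0 < N + Phi (c' u) + 1 by have := P0 (c' u); lra.
(* Chosen so that [(Phi + h) (N + h) <= Phi N + e], the excess being [h (Phi + N + h)] with
   [h <= 1]. *)
pose h := Num.min 1 (e / (N + Phi (c' u) + 1)).
have h0 : 0 < h by rewrite lt_min ltr01 divr_gt0.
have h1 : h <= 1 by rewrite ge_min lexx.
have he : h * (N + Phi (c' u) + 1) <= e.
  by rewrite -ler_pdivlMr // ge_min lexx orbT.
have h2 : 0 < h / 2 by rewrite divr_gt0.
have c'u : c' u = c u by rewrite /c' id.
have d'u : d' u = d u by rewrite /d' id.
near=> v => uv.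
have vI : v \in `]s, t[ by near: v; exact: near_in_itvoo.
have c'v : c' v = c v.
  by move: vI; rewrite in_itv /= => /andP[sv vt]; rewrite /c' clamp_id // (ltW sv) ltW.
have X1 : `|(c v).1 - (c u).1 - (d u).1 * (v - u)| <= h / 2 * `|v - u|.
  by near: v; exact: (is_derive_near (is_derive_fst du) h2).
have X2 : `|(c v).2 - (c u).2 - (d u).2 * (v - u)| <= h / 2 * `|v - u|.
  by near: v; exact: (is_derive_near (is_derive_snd du) h2).
have X3 : psi (c' v) - psi (c' u) <=
    (Phi (c' u) + h) * enorm ((c' v).1 - (c' u).1) ((c' v).2 - (c' u).2).
  by near: v; exact: (cc u _ (lip (c' u) h h0)).
have vu0 : 0 <= v - u by rewrite subr_ge0.
have X4 : enorm ((c' v).1 - (c' u).1) ((c' v).2 - (c' u).2) <= (N + h) * (v - u).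
  rewrite c'v c'u; move: X1 X2; rewrite (ger0_norm vu0).
  set x := (c v).1 - _; set y := (c v).2 - _ => X1 X2.
  rewrite -[x](subrK ((d u).1 * (v - u))) -[y](subrK ((d u).2 * (v - u))).
  apply: le_trans (enorm_perturb X1 X2) _.
  by rewrite enorm_scale // /N d'u; lra.
apply: le_trans X3 _.
have P0u := P0 (c' u).
apply: (@le_trans _ _ ((Phi (c' u) + h) * ((N + h) * (v - u)))).
  by apply: ler_wpM2l X4; lra.
rewrite mulrA; apply: ler_wpM2r => //.
rewrite /k -/N; nra.
Unshelve. all: by end_near. Qed.

Lemma piecewise_length Phi psi c : continuous Phi -> (forall z, 0 <= Phi z) ->
  continuous psi -> loc_lip Phi psi -> piecewise_C1 c ->
  psi (c 1) - psi (c 0) <= \int[mu]_(u in `[0, 1]) (Phi (c u) * speed c u).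
Proof.
move=> cP P0 cpsi lip [n [s [s0 sn sS cS]]].
have sge j : (j <= n)%N -> 0 <= s j.
  elim: j => [|j IH] jn; first by rewrite s0.
  exact: le_trans (IH (ltnW jn)) (ltW (sS _ jn)).
suff H j : (j <= n)%N ->
    mu.-integrable `[0, s j] (EFin \o (fun u => Phi (c u) * speed c u)) /\
    psi (c (s j)) - psi (c 0) <= \int[mu]_(u in `[0, s j]) (Phi (c u) * speed c u).
  by have := (H n (leqnn n)).2; rewrite sn.
elim: j => [_|j IH jn].
  rewrite s0 subrr Rintegral_itv_pt lexx; split => //.
  rewrite set_itv1; apply/integrableP; split; first exact: measurable_fun_set1.
  by rewrite integral_set1 ltry.
have [i1 l1] := IH (ltnW jn).
have [i2 l2] := piece_length cP P0 cpsi lip (sS _ jn) (cS _ jn).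
have i3 := integrable_itv_cat (sge _ (ltnW jn)) (ltW (sS _ jn)) i1 i2.
split => //; rewrite (Rintegral_itv_cat (sge _ (ltnW jn)) (ltW (sS _ jn)) i3).
by lra.
Qed.

End Lengths.

(** * Upper and lower bounds for the least length in a class *)

Section MinLength.
Local Open Scope classical_set_scope.
Local Open Scope ring_scope.
Context {R : realType} (b : R) (b0 : 0 < b).
Notation mu := (@lebesgue_measure R).
Variable phi : klein b -> R.
Hypothesis phi0 : forall p, 0 <= phi p.

Lemma curve_length_ge0 c : 0 <= curve_length phi c.
Proof. by apply: Rintegral_ge0 => t _; rewrite mulr_ge0 // sqrtr_ge0. Qed.

Lemma deck_affine g (z w : plane R) (s : R) : deck b g ->
  g ((1 - s) *: z + s *: w) = (1 - s) *: g z + s *: g w.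
Proof.
case/deck_normal => m [k ->]; rewrite /deckf.
have E1 : ((1 - s) *: z + s *: w).1 = (1 - s) * z.1 + s * w.1 by [].
have E2 : ((1 - s) *: z + s *: w).2 = (1 - s) * z.2 + s * w.2 by [].
have E (a1 a2 b1 b2 : R) : (1 - s) *: ((a1, a2) : plane R) + s *: ((b1, b2) : plane R) =
  ((1 - s) * a1 + s * b1, (1 - s) * a2 + s * b2) by [].
rewrite [RHS]E E1 E2; move: ((-1) ^ m : R) (m%:~R * pi) (k%:~R * b) => e p q.
by congr pair; ring.
Qed.

Section Smooth.
Variables (g : plane R -> plane R) (c1 c2 d1 d2 : R -> R).
Hypotheses (dg : deck b g) (dc1 : forall t : R, is_derive t 1 c1 (d1 t))
  (dc2 : forall t : R, is_derive t 1 c2 (d2 t))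
  (cd1 : continuous d1) (cd2 : continuous d2)
  (c01 : (c1 1, c2 1) = g (c1 0, c2 0)).
Let c t : plane R := (c1 t, c2 t).

Let cc : continuous c.
Proof.
by apply: cont_pair; [exact: is_derive_continuous dc1|exact: is_derive_continuous dc2].
Qed.

(** The straight homotopy in the plane from [c] to the segment from 0 to [g 0] descends to a
    homotopy of loops: [g] is affine, so at every stage it sends the starting point to the end
    point. *)
Lemma smooth_in_class :
  closed_curve b c /\ freely_homotopic (klein_pi b \o c) (deck_loop b g).
Proof.
split; first split.
- exists 1%N, (fun i => i%:R); split => //.
    by move=> i _; rewrite ltr_nat.
  move=> i _; split; first exact: (continuous_subspaceT cc).
  exists (fun t => (d1 t, d2 t)); split.
    by apply: continuous_subspaceT; exact: cont_pair.
  by move=> t _; exact: is_derive_pair.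
- by rewrite /c c01 klein_pi_deck.
pose seg (t : R) : plane R := (1 - t) *: (0 : plane R) + t *: g 0.
exists (fun q => klein_pi b ((1 - q.1) *: c q.2 + q.1 *: seg q.2)); split.
- apply: continuous_subspaceT => q.
  apply: continuous_comp; last exact: klein_pi_continuous.
  have h1 : (fun q : R * R => q.1) x @[x --> q] --> q.1 by exact: cvg_fst.
  have h2 : (fun q : R * R => q.2) x @[x --> q] --> q.2 by exact: cvg_snd.
  apply: cvgD; apply: cvgZ => //.
  + by apply: cvgB => //; exact: cvg_cst.
  + by apply: continuous_comp; [exact: h2|exact: cc].
  + apply: cvgD; apply: cvgZ; try exact: cvg_cst; try exact: h2.
    by apply: cvgB; [exact: cvg_cst|exact: h2].
- by move=> t _ /=; rewrite subr0 scale1r scale0r addr0.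
- by move=> t _ /=; rewrite subrr scale0r add0r scale1r.
- move=> s _ /=; rewrite /c c01 /seg subr0 subrr !scale0r !scale1r addr0 add0r.
  by rewrite -(deck_affine _ _ _ dg) (klein_pi_deck _ dg).
Qed.

Lemma min_length_le : min_length phi g <=
  \int[mu]_(t in `[0, 1]) (phi (klein_pi b (c t)) * enorm (d1 t) (d2 t)).
Proof.
have -> : \int[mu]_(t in `[0, 1]) (phi (klein_pi b (c t)) * enorm (d1 t) (d2 t)) =
    curve_length phi c.
  apply: eq_Rintegral => t _; rewrite /enorm !derive1E.
  by have [_ ->] := dc1 t; have [_ ->] := dc2 t.
apply: ge_inf.
  by exists 0 => _ [c' _ <-]; exact: curve_length_ge0.
by exists c => //; exact: smooth_in_class.
Qed.

End Smooth.

(** A lower bound passes to the infimum only over a nonempty set; the segment from 0 to [g 0] shows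
    that the class contains an admissible curve. *)
Lemma min_length_ge g x : deck b g ->
  (forall c, closed_curve b c -> freely_homotopic (klein_pi b \o c) (deck_loop b g) ->
     x <= curve_length phi c) -> x <= min_length phi g.
Proof.
move=> dg H; apply: lb_le_inf; last by move=> _ [c [c1 c2] <-]; exact: H.
pose c1 (t : R) := t * (g 0).1; pose c2 (t : R) := t * (g 0).2.
have dl (a t : R) : is_derive t 1 (fun t => t * a) a.
  by apply: der_eq; [der|cbv beta; ring].
have c01 : (c1 1, c2 1) = g (c1 0, c2 0).
  by rewrite /c1 /c2 !mul1r !mul0r -surjective_pairing.
have [h1 h2] := @smooth_in_class g c1 c2 (fun=> (g 0).1) (fun=> (g 0).2) dg
  (dl _) (dl _) (@cont_cst _ _ _) (@cont_cst _ _ _) c01.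
by eexists; exists (fun t => (c1 t, c2 t)).
Qed.

Lemma min_length_ge0 g : deck b g -> 0 <= min_length phi g.
Proof. by move=> dg; apply: min_length_ge => // c _ _; exact: curve_length_ge0. Qed.

End MinLength.

(** * The upper bound *)

Section UpperBound.
Local Open Scope classical_set_scope.
Local Open Scope ring_scope.
Context {R : realType} (b : R) (b0 : 0 < b).
Notation mu := (@lebesgue_measure R).
Variable phi : klein b -> R.
Hypothesis cphi : conformal_factor phi.

Let G (z : R * R) : R := phi (klein_pi b z).

Lemma deck_glideE : deck b (@glide R).
Proof. exact: (deck_glide (deck_id b)). Qed.

Lemma deck_glide2E : deck b (@glide R \o @glide R).
Proof. exact: (deck_glide deck_glideE). Qed.

Lemma deck_vtransE : deck b (vtrans b).
Proof. exact: (deck_vtrans (deck_id b)). Qed.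

Let phi0 p : 0 <= phi p.
Proof. by apply: ltW; case: cphi. Qed.

Let G0 z : 0 <= G z. Proof. exact: phi0. Qed.

Let cG : continuous G.
Proof.
move=> z; apply: continuous_comp; first exact: klein_pi_continuous.
by case: cphi => c _; exact: c.
Qed.

Let Gglide x y : G (x + pi, - y) = G (x, y).
Proof. by rewrite /G (klein_pi_deck (x, y) deck_glideE). Qed.

Let Gvtrans x y : G (x, y + b) = G (x, y).
Proof. by rewrite /G (klein_pi_deck (x, y) deck_vtransE). Qed.

Let Gpi x y : G (x + pi, y) = G (x, - y).
Proof. by rewrite -[y in LHS]opprK Gglide. Qed.

Let G2pi x y : G (x + 2 * pi, y) = G (x, y).
Proof. by rewrite mulr_natl mulr2n addrA !Gpi opprK. Qed.

Let p0 : 0 < pi :> R := pi_gt0 R.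
Let p2 : 0 < 2 * pi :> R. Proof. by rewrite mulr_gt0. Qed.

Let p0le : 0 <= pi :> R. Proof. exact: ltW. Qed.
Let p2le : 0 <= 2 * pi :> R. Proof. exact: ltW. Qed.
Let ble : 0 <= b. Proof. exact: ltW. Qed.
Let b2le : 0 <= b / 2. Proof. by rewrite divr_ge0. Qed.
Let B0 : - (b / 2) <= b / 2.
Proof. by apply: (@le_trans _ _ 0); rewrite ?oppr_le0. Qed.

Let eqW (x y : R) : x = y -> x <= y.
Proof. by move=> ->. Qed.

Definition mean_factor (y : R) : R :=
  (2 * pi)^-1 * \int[mu]_(x in `[0, 2 * pi]) phi (klein_pi b (x, y)).
Local Notation f := mean_factor.

Let fE y : \int[mu]_(x in `[0, 2 * pi]) G (x, y) = 2 * pi * f y.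
Proof. by rewrite /f mulrA mulfV ?mul1r // gt_eqF. Qed.

Lemma mean_factor_continuous : continuous f.
Proof.
have := @continuous_Rintegral_param R G 0 (2 * pi) cG => cI.
by rewrite /f; cont.
Qed.
Let cf := mean_factor_continuous.

Let mean_shift y a : \int[mu]_(x in `[0, 2 * pi]) G (x + a, y) = 2 * pi * f y.
Proof.
have c1 := @continuous_slice1 R G y cG.
rewrite (@Rintegral_shift R (fun x => G (x, y))) //.
rewrite add0r addrC (@Rintegral_period R (fun x => G (x, y))) //.
Qed.

(** A horizontal shift by [pi] amounts to the reflection of the ordinate, and a shift does not
    change a mean over a period. *)
Lemma mean_factor_even y : f (- y) = f y.
Proof.
apply: (mulfI (lt0r_neq0 p2)); rewrite -fE -(mean_shift y pi).
by apply: eq_Rintegral => x _; rewrite Gpi.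
Qed.

Lemma mean_factor_periodic y : f (y + b) = f y.
Proof.
by rewrite /f; congr (_ * _); apply: eq_Rintegral => x _; exact: Gvtrans.
Qed.

Let half_period (k : R -> R) : continuous k -> (forall y, k (y + b) = k y) ->
  \int[mu]_(y in `[0, b]) k y = \int[mu]_(y in `[- (b / 2), b / 2]) k y.
Proof.
move=> ck pk; rewrite -(@Rintegral_period R k b (- (b / 2))) //.
by have -> : - (b / 2) + b = b / 2 by field.
Qed.

Lemma L_sigma_ge0 : 0 <= L_sigma phi.
Proof.
by rewrite le_min; apply/andP; split; apply: min_length_ge0 => //;
  [exact: deck_glideE|exact: deck_glide2E].
Qed.

Lemma l_v_ge0 : 0 <= l_v phi.
Proof. by apply: min_length_ge0 => //; exact: deck_vtransE. Qed.

Lemma L_sigma_le_mean y : L_sigma phi <= 2 * pi * f y.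
Proof.
apply: (@le_trans _ _ (l_h phi)); first by rewrite ge_min lexx orbT.
have d1 (t : R) : is_derive t 1 (fun t => 2 * pi * t) (2 * pi).
  by apply: der_eq; [der|cbv beta; rewrite mulr0 addr0 mulr1].
have c01 : (2 * pi * 1, y) = (@glide R \o @glide R) (2 * pi * 0, y).
  by rewrite /glide /= opprK mulr0 add0r mulr1 mulr_natl mulr2n.
have := @min_length_le R b phi phi0 _ _ _ _ _ deck_glide2E d1
  (fun t => der_cst y t) (@cont_cst _ _ _) (@cont_cst _ _ _) c01.
move/le_trans; apply.
have c1 := @continuous_slice1 R G y cG.
have -> : 2 * pi * f y = \int[mu]_(x in `[2 * pi * 0, 2 * pi * 1]) G (x, y).
  by rewrite mulr0 mulr1 fE.
rewrite -(@Rintegral_scale R (fun x => G (x, y)) 0 1 (2 * pi)) //.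
apply/eqW/eq_Rintegral => x _.
  rewrite /enorm expr0n /= addr0 sqrtr_sqr ger0_norm //.
  by rewrite mulrC.
Qed.

(** Every vertical segment of height [b] projects to a curve in the class of [t]; the bound is the
    average over their abscissas, with the two integrals exchanged. *)
Lemma l_v_le_mean : l_v phi <= 2 * \int[mu]_(y in `[0, b / 2]) f y.
Proof.
have Hx x : l_v phi <= \int[mu]_(y in `[0, b]) G (x, y).
  have d2 (t : R) : is_derive t 1 (fun t => b * t) b.
    by apply: der_eq; [der|cbv beta; rewrite mulr0 addr0 mulr1].
  have c01 : (x, b * 1) = vtrans b (x, b * 0) by rewrite /vtrans /= mulr0 add0r mulr1.
  have := @min_length_le R b phi phi0 _ _ _ _ _ deck_vtransE (fun t => der_cst x t) d2
    (@cont_cst _ _ _) (@cont_cst _ _ _) c01.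
  move/le_trans; apply.
  have c2 := @continuous_slice2 R G x cG.
  have -> : \int[mu]_(y in `[0, b]) G (x, y) =
      \int[mu]_(y in `[b * 0, b * 1]) G (x, y) by rewrite mulr0 mulr1.
  rewrite -(@Rintegral_scale R (fun y => G (x, y)) 0 1 b) //.
  apply/eqW/eq_Rintegral => y _.
  by rewrite /enorm expr0n /= add0r sqrtr_sqr ger0_norm // mulrC.
have cs : continuous (fun z : R * R => G (z.2, z.1)).
  move=> z; apply: (continuous_comp (f := fun z : R * R => (z.2, z.1))); last exact: cG.
  by apply: cont_pair => w; [exact: cvg_snd|exact: cvg_fst].
have cI := @continuous_Rintegral_param R (fun z => G (z.2, z.1)) 0 b cs.
have : \int[mu]_(x in `[0, 2 * pi]) l_v phi <=
    \int[mu]_(x in `[0, 2 * pi]) \int[mu]_(y in `[0, b]) G (x, y).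
  by apply: le_Rintegral_itv => [|//|x _]; [exact: cont_cst|exact: Hx].
rewrite Rintegral_itv_cst // subr0 Rintegral_swap //.
have -> : \int[mu]_(y in `[0, b]) \int[mu]_(x in `[0, 2 * pi]) G (x, y) =
    2 * pi * \int[mu]_(y in `[0, b]) f y.
  by rewrite -RintegralZl_itv //; apply: eq_Rintegral => y _; exact: fE.
rewrite mulrC ler_pM2l // (half_period cf mean_factor_periodic).
by rewrite Rintegral_even // ?divr_ge0 //; exact: mean_factor_even.
Qed.

(** The fundamental domain meets each height in half a circle only, but the shift by [pi] exchanges
    [y] and [- y], so these two heights together fill a full circle. There the integral of
    [(G - f y)^2 >= 0] bounds the mean of the square below by the square of the mean. *)
Lemma vol_ge_mean : 2 * pi * \int[mu]_(y in `[0, b / 2]) f y ^+ 2 <= vol phi.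
Proof.
pose G' z := G z ^+ 2.
have cG' : continuous G' by rewrite /G'; cont.
pose v y := \int[mu]_(x in `[0, pi]) G' (x, y).
have cv : continuous v := @continuous_Rintegral_param R G' 0 pi cG'.
have cv' : continuous (fun y => v (- y)) by cont.
have volE : vol phi = \int[mu]_(y in `[- (b / 2), b / 2]) v y.
  rewrite /vol (@Rintegral_rect2 R G') // half_period // => y.
  by apply: eq_Rintegral => x _; rewrite /G' Gvtrans.
have volE' : vol phi = \int[mu]_(y in `[- (b / 2), b / 2]) v (- y).
  by rewrite Rintegral_opp // opprK.
have H y : 2 * pi * f y ^+ 2 <= v y + v (- y).
  have c1 := @continuous_slice1 R G y cG.
  have -> : v y + v (- y) = \int[mu]_(x in `[0, 2 * pi]) G' (x, y).
    have c1' : continuous (fun x => G' (x, y)) by rewrite /G'; cont.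
    have -> : v (- y) = \int[mu]_(x in `[0, pi]) G' (x + pi, y).
      by apply: eq_Rintegral => x _; rewrite /G' Gpi.
    rewrite (@Rintegral_shift R (fun x => G' (x, y))) // add0r.
    rewrite (_ : pi + pi = 2 * pi); last by rewrite mulr_natl mulr2n.
    rewrite -Rintegral_itv_cat //; first by have := p0; lra.
    exact: continuous_integrable.
  have : 0 <= \int[mu]_(x in `[0, 2 * pi]) (G' (x, y) - 2 * f y * G (x, y) + f y ^+ 2).
    by apply: Rintegral_ge0 => x _; have := sqr_ge0 (G (x, y) - f y); rewrite /G'; lra.
  rewrite RintegralD_itv; [|by rewrite /G'; cont|by cont].
  rewrite RintegralB_itv; [|by rewrite /G'; cont|by cont].
  rewrite RintegralZl_itv // fE Rintegral_itv_cst // subr0.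
  by move: (2 * pi : R) => P; lra.
have : \int[mu]_(y in `[- (b / 2), b / 2]) (2 * pi * f y ^+ 2) <=
    \int[mu]_(y in `[- (b / 2), b / 2]) (v y + v (- y)).
  by apply: le_Rintegral_itv; [cont|cont|move=> y _; exact: H].
rewrite RintegralD_itv // -volE -volE' RintegralZl_itv; last by cont.
rewrite (@Rintegral_even R (fun y => f y ^+ 2)) //; [|by cont|].
  by lra.
by move=> y; rewrite mean_factor_even.
Qed.

(** An arc of [sinh y = h cos x] over [0, pi] ends at the glide image of its start, as [cos] changes
    sign and [asinh] is odd. The ratio of square roots is its Euclidean speed, and averaging over
    the horizontal translate [x0] replaces the conformal factor by its mean at each height. *)
Lemma L_sigma_le_band h : 0 <= h -> L_sigma phi <= \int[mu]_(x in `[0, pi])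
  (f (asinh (h * cos x)) * (Num.sqrt (1 + h ^+ 2) / Num.sqrt (1 + (h * cos x) ^+ 2))).
Proof.
move=> h0.
pose Y x := asinh (h * cos x).
pose s x := Num.sqrt (1 + (h * cos x) ^+ 2).
have s0 x : 0 < s x by rewrite sqrtr_gt0 ltr_pwDl // sqr_ge0.
pose dY x := - (h * sin x / s x).
have cs : continuous s by rewrite /s; cont.
have sN x : s x != 0 by rewrite gt_eqF.
have cdY : continuous dY by rewrite /dY; cont.
have dYE (x : R) : is_derive x 1 Y (dY x).
  apply: der_eq.
    apply: (der_comp (h := asinh)); first exact: is_derive_asinh.
    by der.
  by cbv beta; rewrite -/(s x) /dY; field.
have cY : continuous Y := is_derive_continuous dYE.
pose r x := Num.sqrt (1 + h ^+ 2) / s x.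
have cr : continuous r by rewrite /r; cont.
have rE x : enorm 1 (dY x) = r x.
  rewrite /enorm /dY sqrrN expr_div_n exprMn sin2cos2 sqr_sqrtr; last first.
    by rewrite addr_ge0 // sqr_ge0.
  rewrite /r /s -sqrtrV ?addr_ge0 ?sqr_ge0 // -sqrtrM ?addr_ge0 ?sqr_ge0 //.
  congr Num.sqrt; rewrite exprMn; field.
  by rewrite gt_eqF // ltr_pwDl // sqr_ge0.
have Hx x0 : L_sigma phi <= \int[mu]_(x in `[0, pi]) (G (x0 + x, Y x) * r x).
  apply: (@le_trans _ _ (l_sigma phi)); first by rewrite ge_min lexx.
  have d1 (t : R) : is_derive t 1 (fun t => x0 + pi * t) pi.
    by apply: der_eq; [der|cbv beta; rewrite mulr0 addr0 mulr1 add0r].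
  have d2 (t : R) : is_derive t 1 (fun t => Y (pi * t)) (pi * dY (pi * t)).
    apply: der_eq.
      apply: (der_comp (h := Y)); first exact: dYE.
      by der.
    by cbv beta; rewrite mulr0 addr0 mulr1 mulrC.
  have c01 : (x0 + pi * 1, Y (pi * 1)) = glide (x0 + pi * 0, Y (pi * 0)).
    by rewrite /glide /= !mulr0 addr0 !mulr1 /Y cospi cos0 mulrN1 mulr1 asinhN.
  have := @min_length_le R b phi phi0 _ _ _ _ _ deck_glideE d1 d2 (@cont_cst _ _ _) _ c01.
  have cd2 : continuous (fun t => pi * dY (pi * t)) by cont.
  move/(_ cd2)/le_trans; apply.
  have cGr : continuous (fun x => G (x0 + x, Y x) * r x).
    apply: contM => //; apply: (cont_comp2 cG) => //; by cont.
  have -> : \int[mu]_(x in `[0, pi]) (G (x0 + x, Y x) * r x) =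
      \int[mu]_(x in `[pi * 0, pi * 1]) (G (x0 + x, Y x) * r x) by rewrite mulr0 mulr1.
  rewrite -(@Rintegral_scale R (fun x => G (x0 + x, Y x) * r x) 0 1 pi) //.
  apply/eqW/eq_Rintegral => t _.
  rewrite -rE -[X in enorm X _]mul1r [pi * dY _]mulrC enorm_scale //.
  by rewrite mulrA mulrC.
pose Q (z : R * R) := G (z.1 + z.2, Y z.2) * r z.2.
have cfst : continuous (fun z : R * R => z.1) by move=> z; exact: cvg_fst.
have csnd : continuous (fun z : R * R => z.2) by move=> z; exact: cvg_snd.
have cQ : continuous Q.
  by apply: contM; [apply: (cont_comp2 cG); cont|cont].
have cQ' : continuous (fun z : R * R => Q (z.2, z.1)).
  move=> z; apply: (continuous_comp (f := fun z : R * R => (z.2, z.1))); last exact: cQ.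
  by apply: cont_pair.
have cI := @continuous_Rintegral_param R (fun z => Q (z.2, z.1)) 0 pi cQ'.
have : \int[mu]_(x0 in `[0, 2 * pi]) L_sigma phi <=
    \int[mu]_(x0 in `[0, 2 * pi]) \int[mu]_(x in `[0, pi]) Q (x0, x).
  by apply: le_Rintegral_itv => [|//|x _]; [exact: cont_cst|exact: Hx].
rewrite Rintegral_itv_cst // subr0 Rintegral_swap //.
have -> : \int[mu]_(x in `[0, pi]) \int[mu]_(x0 in `[0, 2 * pi]) Q (x0, x) =
    2 * pi * \int[mu]_(x in `[0, pi]) (f (Y x) * r x).
  rewrite -RintegralZl_itv; last by cont.
  apply: eq_Rintegral => x _; rewrite /Q /=.
  have cx : continuous (fun x0 => G (x0 + x, Y x)) by apply: (cont_comp2 cG); cont.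
  under eq_Rintegral do rewrite mulrC.
  by rewrite RintegralZl_itv // mean_shift mulrC mulrA.
by rewrite mulrC ler_pM2l.
Qed.

Lemma sharp_bound A : 0 <= A -> A <= b / 2 -> cosh A <= 2 ->
  (tanh A + (b / 2 - A) / 4) * (L_sigma phi * l_v phi) <=
  (asin (tanh A) + (b / 2 - A) / 2) * vol phi.
Proof.
move=> A0 AB cA; apply: (@sharp_profile R f) => //.
- exact: L_sigma_ge0.
- exact: l_v_ge0.
- by rewrite divr_gt0.
- exact: L_sigma_le_mean.
- move=> a a0; apply: band_integral => //.
  + exact: mean_factor_even.
  + exact: L_sigma_le_band.
- exact: l_v_le_mean.
- exact: vol_ge_mean.
Qed.

End UpperBound.

(** * The extremal metric *)

Section Fold.
Local Open Scope classical_set_scope.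
Local Open Scope ring_scope.
Context {R : realType} (b : R) (b0 : 0 < b).
Implicit Types (x y : R).

Let p0 : 0 < pi :> R := pi_gt0 R.
Let pN0 : pi != 0 :> R. Proof. by rewrite gt_eqF. Qed.
Let bN0 : b != 0. Proof. by rewrite gt_eqF. Qed.

Lemma cos_asin_sin (u : R) : cos (asin (sin u)) = `|cos u|.
Proof. by rewrite cos_asin ?sin_geN1 ?sin_le1 // -cos2sin2 sqrtr_sqr. Qed.

Lemma sin_bound (u : R) : -1 <= sin u <= 1.
Proof. by rewrite sin_geN1 sin_le1. Qed.

(** Replacing [u] by [asin (sin u)] keeps the sine and makes the cosine nonnegative, so by the
    addition formula the cosine of the difference can only grow; [cos] is decreasing on [0, pi]. *)
Lemma asin_sin_lip (u v : R) : `|asin (sin u) - asin (sin v)| <= `|u - v|.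
Proof.
have [uv|uv] := lerP pi `|u - v|.
  apply: le_trans uv; have := asin_geNpi2 (sin_bound u); have := asin_lepi2 (sin_bound u).
  have := asin_geNpi2 (sin_bound v); have := asin_lepi2 (sin_bound v).
  by rewrite ler_norml; move: (pi : R) => P *; lra.
set s := asin (sin u); set t := asin (sin v).
have st : `|s - t| <= pi.
  have := asin_geNpi2 (sin_bound u); have := asin_lepi2 (sin_bound u).
  have := asin_geNpi2 (sin_bound v); have := asin_lepi2 (sin_bound v).
  by rewrite -/s -/t ler_norml; move: (pi : R) => P *; lra.
have c : cos `|u - v| <= cos `|s - t|.
  rewrite !cos_norm !cosB !cos_asin_sin !asinK ?in_itv /= ?sin_bound //.
  by rewrite lerD2r -normrM ler_norm.
rewrite leNgt; apply/negP => lt.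
have : cos `|s - t| < cos `|u - v|.
  rewrite ltr_cos // in_itv /= ?normr_ge0 //; exact: ltW.
by rewrite ltNge c.
Qed.

Lemma asinN x : -1 <= x <= 1 -> asin (- x) = - asin x.
Proof.
move=> x1; have [a1 a2] := asin_def x1.
rewrite -[X in asin (- X)]a2 -sinN sinK // in_itv /=.
by rewrite lerN2 lerNl; case/andP: a1 => -> ->.
Qed.

(* The triangle wave of period [2 * b] that is the identity on [- b / 2, b / 2]. *)
Definition fold y := b / pi * asin (sin (pi / b * y)).

Lemma fold_lip x y : `|fold x - fold y| <= `|x - y|.
Proof.
rewrite /fold -mulrBr normrM gtr0_norm ?divr_gt0 //.
apply: le_trans (ler_wpM2l _ (asin_sin_lip _ _)) _; first by rewrite divr_ge0 // ltW.
rewrite -mulrBr normrM (gtr0_norm (_ : 0 < pi / b)) ?divr_gt0 // mulrA.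
have -> : b / pi * (pi / b) = 1 by move: (pi : R) pN0 => P PN; field; rewrite ?PN ?bN0.
by rewrite mul1r.
Qed.

Lemma fold_continuous : continuous fold.
Proof.
move=> x; apply/cvgrPdist_le => e e0; near=> y.
apply: le_trans (fold_lip _ _) _.
by near: y; exact: cvgr_dist_le.
Unshelve. all: by end_near. Qed.

Lemma foldN y : fold (- y) = - fold y.
Proof. by rewrite /fold mulrN sinN asinN ?sin_bound // mulrN. Qed.

Lemma foldD y : fold (y + b) = - fold y.
Proof.
rewrite /fold mulrDr.
have -> : pi / b * b = pi by rewrite divfK.
by rewrite sinDpi asinN ?sin_bound // mulrN.
Qed.

Lemma foldDz y (k : int) : `|fold (y + k%:~R * b)| = `|fold y|.
Proof.
have S (n : nat) y' : `|fold (y' + n%:R * b)| = `|fold y'|.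
  elim: n => [|n IH]; first by rewrite mul0r addr0.
  by rewrite -natr1 mulrDl mul1r addrA foldD normrN IH.
case: k => n; first exact: S.
rewrite NegzE intrN mulNr -[in RHS](subrK (n.+1%:R * b) y) S; congr `|fold _|.
Qed.

Lemma fold2Dz y (k : int) : fold (y + 2 * (k%:~R * b)) = fold y.
Proof.
have S (n : nat) y' : fold (y' + 2 * (n%:R * b)) = fold y'.
  elim: n => [|n IH]; first by rewrite mul0r mulr0 addr0.
  have -> : y' + 2 * (n.+1%:R * b) = y' + 2 * (n%:R * b) + b + b.
    by rewrite -[n.+1%:R]natr1; ring.
  by rewrite !foldD opprK IH.
case: k => n; first exact: S.
by rewrite NegzE intrN mulNr mulrN -[in RHS](subrK (2 * (n.+1%:R * b)) y) S.
Qed.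

Lemma fold_id y : `|y| <= b / 2 -> fold y = y.
Proof.
rewrite ler_norml => /andP[y1 y2].
have E : b / pi * (pi / b * y) = y.
  by move: (pi : R) pN0 => P PN; field; rewrite ?PN ?bN0.
rewrite /fold sinK ?E // in_itv /=.
have pb : 0 < pi / b by rewrite divr_gt0.
have E2 : pi / 2 = pi / b * (b / 2).
  by move: (pi : R) => P; field.
by rewrite E2 -mulrN !ler_pM2l // y1.
Qed.

Lemma fold_le y : `|fold y| <= b / 2.
Proof.
rewrite /fold normrM gtr0_norm ?divr_gt0 //.
have E2 : b / 2 = b / pi * (pi / 2).
  by move: (pi : R) pN0 => P PN; field; rewrite ?PN ?bN0.
rewrite E2 ler_pM2l ?divr_gt0 // ler_norml asin_geNpi2 ?sin_bound //.
by rewrite asin_lepi2 ?sin_bound.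
Qed.

Lemma ex_rep y : exists k : int, `|y - k%:~R * b| <= b / 2.
Proof.
pose k := Num.floor (y / b + 1 / 2); exists k.
have := Num.Theory.floor_itv (y / b + 1 / 2); rewrite -/k intrD => /andP[k1 k2].
have E : y = y / b * b by rewrite divfK.
rewrite E -mulrBl normrM (gtr0_norm b0) [b / 2]mulrC ler_pM2r //.
rewrite ler_norml; move: k1 k2; set q := y / b; set m := k%:~R.
by rewrite /=; lra.
Qed.

Lemma norm_fold y (k : int) : `|y - k%:~R * b| <= b / 2 -> `|fold y| = `|y - k%:~R * b|.
Proof.
by move=> H; rewrite -[in LHS](subrK (k%:~R * b) y) foldDz fold_id.
Qed.

End Fold.

(** * Distance on the sphere in Mercator coordinates *)

Section SphereDistance.
Local Open Scope classical_set_scope.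
Local Open Scope ring_scope.
Context {R : realType} (x0 y0 : R).

(* The inner product, in space, of the points of the unit sphere with
   coordinates (x0, y0) and (x, y): its arc cosine is their distance. *)
Definition sphere_dot (x y : R) : R :=
  (cos (x - x0) + sinh y * sinh y0) / (cosh y * cosh y0).
Local Notation n := sphere_dot.

Let nx x y := - sin (x - x0) / (cosh y * cosh y0).
Let ny x y := (sinh y0 - cos (x - x0) * sinh y) / (cosh y ^+ 2 * cosh y0).

(** [nx] and [ny] are the partial derivatives of [sphere_dot]. On the sphere the gradient of the
    cosine of the distance has norm its sine; [1 / cosh y] is the conformal factor. *)
Lemma sphere_dot_grad x y : nx x y ^+ 2 + ny x y ^+ 2 = (cosh y)^-1 ^+ 2 * (1 - n x y ^+ 2).
Proof.
rewrite /nx /ny /n; have := cosh_neq0 y; have := cosh_neq0 y0.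
have := cosh2_sinh2 y; have := cosh2_sinh2 y0; have := sin2cos2 (x - x0).
move: (cosh y) (sinh y) (cosh y0) (sinh y0) (sin _) (cos _) => c s c0 s0 S C.
move=> HS H0 H n0 n1.
have E : S ^+ 2 * c ^+ 2 + (s0 - C * s) ^+ 2 = c ^+ 2 * c0 ^+ 2 - (C + s * s0) ^+ 2.
  by rewrite HS H H0; ring.
transitivity ((S ^+ 2 * c ^+ 2 + (s0 - C * s) ^+ 2) / (c ^+ 4 * c0 ^+ 2)).
  by field; rewrite n0 n1.
by rewrite E; field; rewrite n0 n1.
Qed.

Lemma sphere_dot_le1 x y : n x y ^+ 2 <= 1.
Proof.
have c0 : 0 < (cosh y)^-1 ^+ 2 by rewrite exprn_gt0 // invr_gt0 cosh_gt0.
have := addr_ge0 (sqr_ge0 (nx x y)) (sqr_ge0 (ny x y)).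
by rewrite sphere_dot_grad pmulr_rge0 // subr_ge0.
Qed.

(** The mean value theorem along the segment. The factor [k < 1] keeps the argument where [asin] is
    differentiable, and the gradient of [asin (k n)] has squared norm
    [k^2 (1 - n^2) / (1 - k^2 n^2) <= 1] times the squared conformal factor. *)
Lemma asin_sphere_dot_lip (k M x1 y1 x2 y2 : R) : 0 < k < 1 ->
  (forall t, 0 <= t <= 1 -> (cosh (y1 + t * (y2 - y1)))^-1 <= M) ->
  asin (k * n x1 y1) - asin (k * n x2 y2) <= M * enorm (x2 - x1) (y2 - y1).
Proof.
move=> /andP[k0 k1] HM.
pose X t := x1 + t * (x2 - x1); pose Y t := y1 + t * (y2 - y1).
set dx := x2 - x1; set dy := y2 - y1; set N := enorm dx dy.
have M0 : 0 <= M.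
  apply: le_trans (HM 0 _); first by rewrite invr_ge0 ltW // cosh_gt0.
  by rewrite lexx ler01.
have N0 : 0 <= N := enorm_ge0 _ _.
have kn x y : (k * n x y) ^+ 2 < 1.
  rewrite exprMn; apply: (@le_lt_trans _ _ (k ^+ 2)); last by nra.
  by rewrite ler_piMr ?sqr_ge0 // sphere_dot_le1.
have knb x y : -1 < k * n x y < 1.
  by move: (kn x y) => H; apply/andP; split; nra.
pose dn t := nx (X t) (Y t) * dx + ny (X t) (Y t) * dy.
have dnE (t : R) : is_derive t 1 (fun t => n (X t) (Y t)) (dn t).
  have dX (u : R) : is_derive u 1 X dx.
    by apply: der_eq; [rewrite /X; der|cbv beta; rewrite /dx; ring].
  have dY (u : R) : is_derive u 1 Y dy.
    by apply: der_eq; [rewrite /Y; der|cbv beta; rewrite /dy; ring].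
  have dC : has_der (fun t => cosh (Y t)) t (sinh (Y t) * dy).
    by apply: der_comp; [exact: is_derive_cosh|exact: dY].
  have dS : has_der (fun t => sinh (Y t)) t (cosh (Y t) * dy).
    by apply: der_comp; [exact: is_derive_sinh|exact: dY].
  have dXt := dX t.
  have c1 := cosh_neq0 (Y t); have c2 := cosh_neq0 y0.
  apply: der_eq; first by rewrite /n; der; rewrite mulf_neq0.
  cbv beta; rewrite /dn /nx /ny; have := cosh2_sinh2 (Y t).
  move: (sin _) (cos _) (sinh y0) c1 c2; move: (cosh (Y t)) (sinh (Y t)) (cosh y0).
  move=> c s c0 S C s0 n0 n1 H.
  have -> : s0 - C * s = c ^+ 2 * s0 - s * (C + s * s0) by rewrite H; ring.
  by field; rewrite n0 n1.
pose th t := - asin (k * n (X t) (Y t)).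
pose dth t := - ((Num.sqrt (1 - (k * n (X t) (Y t)) ^+ 2))^-1 * (k * dn t)).
have dthE (t : R) : is_derive t 1 th (dth t).
  have dnt := dnE t.
  have dk : has_der (fun t => k * n (X t) (Y t)) t (k * dn t).
    by have := derM (der_cst k t) dnt; rewrite mulr0 addr0.
  by apply: derN; apply: der_asin.
have cth : continuous th := is_derive_continuous dthE.
have [t tI] := @MVT R th dth 0 1 ltr01 (fun t _ => dthE t) (continuous_subspaceT cth).
rewrite subr0 mulr1.
have -> : th 1 - th 0 = asin (k * n x1 y1) - asin (k * n x2 y2).
  by rewrite /th /X /Y !mul1r !mul0r !addr0 ![_ + (_ - _)]addrC !subrK opprK addrC.
move=> ->.
have t01 : 0 <= t <= 1 by move: tI; rewrite in_itv /= => /andP[/ltW -> /ltW ->].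
have sM := HM t t01; rewrite -/dy -/(Y t) in sM.
have s0 : 0 < (cosh (Y t))^-1 by rewrite invr_gt0 cosh_gt0.
have D0 : 0 < 1 - (k * n (X t) (Y t)) ^+ 2 by rewrite subr_gt0.
have H : dth t ^+ 2 <= (M * N) ^+ 2.
  have -> : dth t ^+ 2 = (1 - (k * n (X t) (Y t)) ^+ 2)^-1 * (k ^+ 2 * dn t ^+ 2).
    rewrite /dth -[X in _ = X^-1 * _](sqr_sqrtr (ltW D0)).
    by move: (Num.sqrt _) (dn t) => S d; rewrite sqrrN exprMn exprVn exprMn.
  rewrite ler_pdivrMl //.
  have CS : dn t ^+ 2 <= (nx (X t) (Y t) ^+ 2 + ny (X t) (Y t) ^+ 2) * N ^+ 2.
    rewrite /N sqr_enorm /dn.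
    by have := sqr_ge0 (nx (X t) (Y t) * dy - ny (X t) (Y t) * dx); lra.
  rewrite sphere_dot_grad in CS.
  have n1 := sphere_dot_le1 (X t) (Y t).
  apply: le_trans (ler_wpM2l (sqr_ge0 k) CS) _.
  have sM2 : (cosh (Y t))^-1 ^+ 2 <= M ^+ 2 by rewrite ler_sqr ?nnegrE // ltW.
  have e1 : k ^+ 2 * (1 - n (X t) (Y t) ^+ 2) <= 1 - (k * n (X t) (Y t)) ^+ 2.
    have k2 : k ^+ 2 <= 1 by nra.
    by move: (n _ _) => u; rewrite exprMn; lra.
  have e0 : 0 <= k ^+ 2 * (1 - n (X t) (Y t) ^+ 2) by rewrite mulr_ge0 ?sqr_ge0 ?subr_ge0.
  have -> : k ^+ 2 * ((cosh (Y t))^-1 ^+ 2 * (1 - n (X t) (Y t) ^+ 2) * N ^+ 2) =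
    (k ^+ 2 * (1 - n (X t) (Y t) ^+ 2)) * ((cosh (Y t))^-1 ^+ 2 * N ^+ 2).
    by move: (n _ _) (cosh _)^-1 => u v; ring.
  rewrite [(M * N) ^+ 2]exprMn; apply: ler_pM => //; first by rewrite mulr_ge0 ?sqr_ge0.
  by rewrite ler_wpM2r // sqr_ge0.
apply: le_trans (ler_norm _) _.
by rewrite -ler_sqr ?nnegrE ?mulr_ge0 // real_normK ?num_real.
Qed.

Lemma sphere_dot_continuous : continuous (fun z : R * R => n z.1 z.2).
Proof.
have c1 : continuous (fun z : R * R => z.1) by move=> z; exact: cvg_fst.
have c2 : continuous (fun z : R * R => z.2) by move=> z; exact: cvg_snd.
have cc := @continuous_cosh R; have cs := @continuous_sinh R.
rewrite /n; cont => z; by rewrite mulf_neq0 // cosh_neq0.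
Qed.

End SphereDistance.

Section Extremal.
Local Open Scope classical_set_scope.
Local Open Scope ring_scope.
Context {R : realType} (b : R) (b0 : 0 < b).
Notation mu := (@lebesgue_measure R).
Variable A : R.
Hypotheses (A0 : 0 <= A) (AB : A <= b / 2) (cA : cosh A <= 2)
  (cAB : A = b / 2 \/ cosh A = 2).
Local Notation F := (fold b).

(** [fold] is odd and changes sign under [y -> y + b], so its absolute value, the distance to the
    nearest multiple of [b], is even with period [b]. *)
Definition profile (y : R) : R := (cosh (Num.min `|F y| A))^-1.
Local Notation P := profile.

Let F0 y : 0 <= Num.min `|F y| A. Proof. by rewrite le_min normr_ge0. Qed.

Lemma profile_gt0 y : 0 < P y.
Proof. by rewrite invr_gt0 cosh_gt0. Qed.

Lemma profile_ge_half y : 1 / 2 <= P y.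
Proof.
rewrite div1r lef_pV2 ?posrE ?cosh_gt0 //.
by apply: le_trans cA; apply: le_cosh => //; rewrite ge_min lexx orbT.
Qed.

Lemma cosh_norm (y : R) : cosh `|y| = cosh y.
Proof. by case: (ger0P y) => _; rewrite ?coshN. Qed.

Lemma profile_ge_sech y : (cosh (F y))^-1 <= P y.
Proof.
rewrite lef_pV2 ?posrE ?cosh_gt0 // -[cosh (F y)]cosh_norm.
by apply: le_cosh => //; rewrite ge_min lexx.
Qed.

Lemma profile_continuous : continuous P.
Proof.
have cF := fold_continuous b0.
have cm : continuous (fun y => Num.min `|F y| A).
  apply: (@cont_comp2 R R (fun z => Num.min z.1 z.2) (fun y => `|F y|) (fun=> A)).
  - exact: min_continuous.
  - by cont.
  - exact: cont_cst.
have cc := @continuous_cosh R.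
rewrite /P; apply: contV; last by cont.
by move=> y; rewrite gt_eqF // cosh_gt0.
Qed.

Lemma profileN y : P (- y) = P y.
Proof. by rewrite /P foldN normrN. Qed.

Lemma profileD y : P (y + b) = P y.
Proof. by rewrite /P foldD // normrN. Qed.

Lemma profile_deck g z : deck b g -> P (g z).2 = P z.2.
Proof.
elim=> [//|{}g _ IH|{}g _ IH|{}g _ IH|{}g _ IH]; rewrite -IH /=.
- exact: profileN.
- exact: profileN.
- exact: profileD.
- by rewrite -profileD subrK.
Qed.

Definition extremal (p : klein b) : R := P (repr p).2.

Lemma extremalE z : extremal (klein_pi b z) = P z.2.
Proof.
have [g dg E] : exists2 g, deck b g & z = g (repr (klein_pi b z)).
  by apply/klein_piP; rewrite /klein_pi reprK.
by rewrite /extremal [in RHS]E profile_deck.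
Qed.

Lemma extremal_conformal : conformal_factor extremal.
Proof.
split; last by move=> p; exact: profile_gt0.
apply/quotient_continuous.
have -> : extremal \o \pi_(klein b)%qT = fun z : R * R => P z.2.
  by apply/funext => z; exact: extremalE.
move=> z; apply: (continuous_comp (f := snd)); first exact: cvg_snd.
exact: profile_continuous.
Qed.

Let Pi (z : plane R) : R := P z.2.
Let cPi : continuous Pi.
Proof.
move=> z; apply: (continuous_comp (f := snd)); first exact: cvg_snd.
exact: profile_continuous.
Qed.
Let Pi0 z : 0 <= Pi z. Proof. exact: ltW (profile_gt0 _). Qed.

Lemma extremal_length_ge psi c : continuous psi -> loc_lip Pi psi ->
  closed_curve b c -> psi (c 1) - psi (c 0) <= curve_length extremal c.
Proof.
move=> cpsi lip [pc _]; apply: le_trans (piecewise_length cPi Pi0 cpsi lip pc) _.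
by rewrite le_eqVlt; apply/orP; left; apply/eqP/eq_Rintegral => t _; rewrite extremalE.
Qed.

Lemma closed_curve_deck c g : deck b g -> closed_curve b c ->
  freely_homotopic (klein_pi b \o c) (deck_loop b g) ->
  exists m k w, c 0 = deckf b m k w /\ c 1 = deckf b m k (g w).
Proof.
move=> dg [[n [s [s0 sn sS cS]]] ccl] Hc.
have cc : {within `[0, 1], continuous c}.
  have sge j : (j <= n)%N -> 0 <= s j.
    elim: j => [|j IH] jn; first by rewrite s0.
    exact: le_trans (IH (ltnW jn)) (ltW (sS _ jn)).
  suff H j : (j <= n)%N -> {within `[0, s j], continuous c}.
    by have := H n (leqnn n); rewrite sn.
  elim: j => [_|j IH jn].
    by rewrite s0 set_itv1; exact: continuous_subspace1.
  have E : `[0, s j.+1]%classic = `[0, s j]%classic `|` `[s j, s j.+1]%classic.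
    apply/seteqP; split => x /=; rewrite !in_itv /=.
      move=> /andP[x0 x1]; case: (lerP x (s j)) => xs; [left|right].
        by rewrite x0.
      by rewrite (ltW xs).
    case=> /andP[x0 x1]; apply/andP; split => //.
      exact: le_trans x1 (ltW (sS _ jn)).
    exact: le_trans (sge _ (ltnW jn)) x0.
  rewrite E; apply: withinU_continuous.
  - exact: interval_closed.
  - exact: interval_closed.
  - exact: IH (ltnW jn).
  - by case: (cS _ jn).
have [h [w [dh c0 c1]]] := freely_homotopic_deck b0 dg cc ccl Hc.
by have [m [k E]] := deck_normal dh; exists m, k, w; rewrite c0 c1 E.
Qed.

Lemma l_h_extremal : pi <= l_h extremal.
Proof.
apply: min_length_ge.
  exact: deck_glide2E.
move=> c clc /(closed_curve_deck (deck_glide2E b) clc) [m [k [w [c0 c1]]]].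
pose psi (z : plane R) := z.1 / 2.
have cpsi : continuous psi.
  by move=> z; apply: cvgM; [exact: cvg_fst|exact: cvg_cst].
have lip : loc_lip Pi psi.
  move=> z e e0; near=> v; rewrite /psi -mulrBl.
  have := ler_norm_enorm1 (v.1 - z.1) (v.2 - z.2); have := ler_norm (v.1 - z.1).
  have := profile_ge_half z.2; rewrite /Pi; set x := v.1 - z.1; set N := enorm _ _.
  have := enorm_ge0 x (v.2 - z.2); rewrite -/N; nra.
apply: le_trans (extremal_length_ge cpsi lip clc).
rewrite c0 c1 /psi /deckf /glide /=.
by rewrite le_eqVlt; apply/orP; left; apply/eqP; move: (pi : R) => p; field.
Unshelve. all: by end_near. Qed.

Lemma l_v_extremal : \int[mu]_(y in `[0, b]) P y <= l_v extremal.
Proof.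
apply: min_length_ge.
  exact: deck_vtransE.
move=> c clc /(closed_curve_deck (deck_vtransE b) clc) [m [k [w [c0 c1]]]].
have cP := profile_continuous.
have dQ x := is_derive_primitive x cP; set Q := primitive_of P in dQ.
have cQ : continuous Q := is_derive_continuous dQ.
have per y : Q (y + b) - Q y = \int[mu]_(y in `[0, b]) P y.
  rewrite -(@Rintegral_period R P b y (ltW b0) cP profileD).
  by rewrite Rintegral_primitive // lerDl ltW.
have lip (e : R) : `|e| = 1 -> loc_lip Pi (fun z => e * Q z.2).
  move=> e1 z d d0.
  have H := is_derive_near (dQ z.2) d0.
  have {}H : \forall v \near z, `|Q v.2 - Q z.2 - P z.2 * (v.2 - z.2)| <= d * `|v.2 - z.2|.
    exact: (cvg_snd H).
  apply: filterS H => v Hv.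
  rewrite -mulrBr; apply: le_trans (ler_norm _) _; rewrite normrM e1 mul1r.
  have N2 := ler_norm_enorm2 (v.1 - z.1) (v.2 - z.2).
  have P0 := profile_gt0 z.2.
  rewrite -[Q v.2 - Q z.2](subrK (P z.2 * (v.2 - z.2))).
  apply: le_trans (ler_normD _ _) _; rewrite [`|P z.2 * _|]normrM (gtr0_norm P0).
  by rewrite /Pi; nra.
have cpsi (e : R) : continuous (fun z : plane R => e * Q z.2).
  move=> z; apply: cvgM; first exact: cvg_cst.
  by apply: (continuous_comp (f := snd)); [exact: cvg_snd|exact: cQ].
(* The lift is known only up to a deck transformation, and conjugation by an odd power of sigma
   turns [t] into its inverse; the sign restores a positive increment. *)
apply: le_trans (extremal_length_ge (cpsi ((-1) ^ m)) (lip _ _) clc); last first.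
  by case: (@signz R m) => ->; rewrite ?normrN1 ?normr1.
rewrite c0 c1 /deckf /vtrans /= mulrDr -mulrBr.
case: (@signz R m) => ->; rewrite ?mul1r ?mulN1r.
  by rewrite addrAC per.
by rewrite opprB -(per (- w.2 - b + k%:~R * b)); rewrite (_ : - w.2 - b + k%:~R * b + b = - w.2 + k%:~R * b) //; ring.
Qed.

Lemma l_sigma_extremal : pi <= l_sigma extremal.
Proof.
apply: min_length_ge.
  exact: deck_glideE.
move=> c clc Hc.
have [m [k [w [c0 c1]]]] := closed_curve_deck (deck_glideE b) clc Hc.
have E1 : (c 1).1 = (c 0).1 + pi by rewrite c0 c1 /deckf /glide /=; ring.
(* The translation by [k b] moves both end points, so their ordinates add up to [2 k b] instead of
   0; the period [2 b] of [fold] absorbs this. *)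
have E2 : F (c 1).2 = - F (c 0).2.
  rewrite -foldN // -[RHS](@fold2Dz _ _ b0 _ k); congr F.
  by rewrite c0 c1 /deckf /glide /=; ring.
set x0 := (c 0).1 in E1 *; set y0 := F (c 0).2 in E2 *.
have n0 : sphere_dot x0 y0 x0 y0 = 1.
  rewrite /sphere_dot subrr cos0 -!expr2 -cosh2_sinh2 divff //.
  by rewrite expf_neq0 // cosh_neq0.
have n1 : sphere_dot x0 y0 (x0 + pi) (- y0) = -1.
  rewrite /sphere_dot [x0 + _]addrC addrK cospi sinhN coshN mulNr -opprD mulNr.
  by rewrite -!expr2 -cosh2_sinh2 divff // expf_neq0 // cosh_neq0.
have H (e : R) : 0 < e < 1 -> 2 * asin e <= curve_length extremal c.
  move=> e01.
  pose psi (z : plane R) := - asin (e * sphere_dot x0 y0 z.1 (F z.2)).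
  have eb x y : -1 < e * sphere_dot x0 y0 x y < 1.
    move/andP: e01 => [e0 e1].
    have := sphere_dot_le1 x0 y0 x y => n2; apply/andP; split; nra.
  have cF := fold_continuous b0.
  have cpsi : continuous psi.
    have cF2 : continuous (fun z : plane R => F z.2).
      by move=> z; apply: (continuous_comp (f := snd)); [exact: cvg_snd|exact: cF].
    have cn : continuous (fun z : plane R => sphere_dot x0 y0 z.1 (F z.2)).
      apply: (@cont_comp2 R _ (fun z => sphere_dot x0 y0 z.1 z.2)).
      - exact: sphere_dot_continuous.
      - by move=> z; exact: cvg_fst.
      - exact: cF2.
    move=> z; apply: cvgN; apply: (continuous_comp (f := fun z => e * sphere_dot x0 y0 z.1 (F z.2))).
      by apply: cvgM; [exact: cvg_cst|exact: cn].
    exact: continuous_asin.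
  have lip : loc_lip Pi psi.
    move=> z d d0.
    have cs := @continuous_sech R.
    have /cvgrPdist_lt /(_ _ d0) /nbhs_ballP[r /= r0 Hr] := cs (F z.2).
    have near_r : \forall v \near z, `|v.2 - z.2| < r.
      have := nbhsx_ballx z r r0; apply: filterS => v [_].
      by rewrite /ball /= distrC.
    apply: filterS near_r => v vr.
    rewrite /psi opprK addrC.
    have FL := fold_lip b0 v.2 z.2.
    (* Folding is 1-Lipschitz, so the whole segment between the folded ordinates stays within [r] of
       [F z.2], where [1 / cosh] varies by less than [d]; and [1 / cosh (F y)] is at most the
       profile. *)
    have HM t : 0 <= t <= 1 -> (cosh (F z.2 + t * (F v.2 - F z.2)))^-1 <= Pi z + d.
      move=> /andP[t0 t1].
      have B : `|(cosh (F z.2))^-1 - (cosh (F z.2 + t * (F v.2 - F z.2)))^-1| < d.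
        apply: Hr; rewrite /ball /= opprD addrA subrr sub0r normrN normrM ger0_norm //.
        apply: le_lt_trans vr; apply: le_trans FL; apply: ler_piMl => //.
      have := profile_ge_sech z.2; move: B; rewrite ltr_norml /Pi; lra.
    apply: le_trans (asin_sphere_dot_lip x0 y0 _ _ e01 HM) _.
    apply: ler_wpM2l; first by rewrite addr_ge0 // ltW.
    apply: enorm_le; first exact: enorm_ge0.
    by rewrite sqr_enorm lerD2l -[leLHS]real_normK ?num_real // -[leRHS]real_normK ?num_real // ler_sqr ?nnegrE.
  apply: le_trans (extremal_length_ge cpsi lip clc).
  rewrite /psi -/x0 -/y0 E1 E2 n0 n1 mulrN1 mulr1 asinN; last by move/andP: e01 => [? ?]; lra.
  by rewrite opprK; lra.
rewrite leNgt; apply/negP => lt.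
have l0 : 0 <= curve_length extremal c.
  by apply: curve_length_ge0 => p; exact: ltW (profile_gt0 _).
set l := curve_length extremal c in lt l0 H.
have p0 := pi_gt0 R.
(* Strictly between [l / 2] and [pi / 2]: the bound for [e = sin u] reads [2 u <= l], a
   contradiction. *)
pose u := (l + pi) / 4.
have u0 : 0 < u by rewrite /u; lra.
have u1 : u < pi / 2 by rewrite /u; lra.
have s0 : 0 < sin u by apply: sin_gt0_pihalf; rewrite u0.
have cu : 0 < cos u by apply: cos_gt0_pihalf; rewrite u1 andbT; lra.
have s1 : sin u < 1 by have := cos2Dsin2 u; nra.
have := H (sin u); rewrite s0 s1 => /(_ isT); rewrite sinK; last first.
  by rewrite in_itv /=; lra.
by rewrite /u; lra.
Qed.

Let profile_low y : 0 <= y <= A -> P y = (cosh y)^-1.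
Proof.
move=> /andP[y0 yA]; rewrite /P fold_id // ?ger0_norm ?(le_trans yA) //.
by rewrite min_l.
Qed.

Let profile_high y : A <= y <= b / 2 -> P y = (cosh A)^-1.
Proof.
move=> /andP[yA yb]; have y0 := le_trans A0 yA.
by rewrite /P fold_id // ger0_norm // min_r.
Qed.

Let half (k : R -> R) : continuous k -> (forall y, k (y + b) = k y) ->
  (forall y, k (- y) = k y) ->
  \int[mu]_(y in `[0, b]) k y = 2 * \int[mu]_(y in `[0, b / 2]) k y.
Proof.
move=> ck pk ek; rewrite -Rintegral_even ?divr_ge0 ?(ltW b0) //.
rewrite -(@Rintegral_period R k b (- (b / 2)) (ltW b0)) //.
by have -> : - (b / 2) + b = b / 2 by field.
Qed.

Lemma Rintegral_profile :
  \int[mu]_(y in `[0, b]) P y = 2 * (asin (tanh A) + (b / 2 - A) / 2).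
Proof.
have cP := profile_continuous.
rewrite (half cP profileD profileN) (Rintegral_itv_cat A0 AB); last exact: continuous_integrable.
have -> : \int[mu]_(y in `[0, A]) P y = asin (tanh A).
  rewrite -(Rintegral_sech A0).
  by apply: eq_Rintegral => y; rewrite inE /= in_itv /= => /profile_low.
have -> : \int[mu]_(y in `[A, b / 2]) P y = \int[mu]_(y in `[A, b / 2]) (cosh A)^-1.
  by apply: eq_Rintegral => y; rewrite inE /= in_itv /= => /profile_high.
rewrite Rintegral_itv_cst //; congr (2 * (_ + _)).
(* Either the plateau is reduced to a point or the profile equals [1 / 2] on it. *)
by case: cAB => [<-|->]; rewrite ?subrr ?mulr0 ?mul0r // mulrC.
Qed.

Lemma Rintegral_profile2 :
  \int[mu]_(y in `[0, b]) P y ^+ 2 = 2 * (tanh A + (b / 2 - A) / 4).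
Proof.
have cP := profile_continuous.
have cP2 : continuous (fun y => P y ^+ 2) by cont.
rewrite (half cP2); [|by move=> y; rewrite profileD|by move=> y; rewrite profileN].
rewrite (Rintegral_itv_cat A0 AB); last exact: continuous_integrable.
have -> : \int[mu]_(y in `[0, A]) (P y ^+ 2) = tanh A.
  rewrite -(Rintegral_sech2 A0).
  by apply: eq_Rintegral => y; rewrite inE /= in_itv /= => /profile_low ->.
have -> : \int[mu]_(y in `[A, b / 2]) (P y ^+ 2) =
    \int[mu]_(y in `[A, b / 2]) ((cosh A)^-1 ^+ 2).
  by apply: eq_Rintegral => y; rewrite inE /= in_itv /= => /profile_high ->.
rewrite Rintegral_itv_cst //; congr (2 * (_ + _)).
by case: cAB => [<-|->]; rewrite ?subrr ?mulr0 ?mul0r //; field.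
Qed.

Lemma vol_extremal : vol extremal = 2 * pi * (tanh A + (b / 2 - A) / 4).
Proof.
have cPi2 : continuous (fun z : R * R => Pi z ^+ 2) by cont.
have cP := profile_continuous.
transitivity (\int[(mu \x mu)%E]_(z in `[0, pi] `*` `[0, b]) (Pi z ^+ 2)).
  by apply: eq_Rintegral => z _; rewrite extremalE.
rewrite (@Rintegral_rect2 R (fun z => Pi z ^+ 2)) //.
transitivity (\int[mu]_(y in `[0, b]) (pi * P y ^+ 2)).
  apply: eq_Rintegral => y _; rewrite /Pi /=.
  by rewrite (@Rintegral_itv_cst R 0 pi (P y ^+ 2)) ?pi_ge0 // subr0 mulrC.
rewrite RintegralZl_itv; last by cont.
by rewrite Rintegral_profile2 mulrCA mulrA.
Qed.

Lemma extremal_equality :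
  (tanh A + (b / 2 - A) / 4) * (L_sigma extremal * l_v extremal) =
  (asin (tanh A) + (b / 2 - A) / 2) * vol extremal.
Proof.
apply/eqP; rewrite eq_le; apply/andP; split.
  exact: (sharp_bound b0 extremal_conformal).
rewrite vol_extremal.
have L1 : pi <= L_sigma extremal by rewrite le_min l_sigma_extremal l_h_extremal.
have V1 := l_v_extremal; rewrite Rintegral_profile in V1.
have E0 : 0 <= tanh A + (b / 2 - A) / 4.
  rewrite addr_ge0 //; last by rewrite divr_ge0 // subr_ge0.
  by rewrite /tanh divr_ge0 ?sinh_ge0 // ltW // cosh_gt0.
have I0 : 0 <= 2 * (asin (tanh A) + (b / 2 - A) / 2).
  rewrite -Rintegral_profile; apply: Rintegral_ge0 => y _; exact: ltW (profile_gt0 y).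
have := ler_wpM2l E0 (ler_pM (pi_ge0 R) I0 L1 V1).
apply: le_trans; rewrite le_eqVlt; apply/orP; left; apply/eqP.
by move: (pi : R) (asin _) => p q; ring.
Qed.

End Extremal.

(** * Local isometries with the round sphere and the plane *)

Section CoordProd.
Local Open Scope classical_set_scope.
Local Open Scope ring_scope.
Context {R : realType} (n : nat) (p q dp dq : 'I_n.+1 -> R -> R).
Hypotheses (pE : forall i (x : R), is_derive x 1 (p i) (dp i x))
  (qE : forall i (x : R), is_derive x 1 (q i) (dq i x))
  (cdp : forall i, continuous (dp i)) (cdq : forall i, continuous (dq i)).
Implicit Types w u : plane R.

(** Both kinds of charts used below have coordinates that split as a function of [x] times a
    function of [y]. *)
Definition coord_prod (w : plane R) : 'rV[R]_n.+1 := \row_i (p i w.1 * q i w.2).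

Lemma row_continuous (g : 'I_n.+1 -> plane R -> R) : (forall i, continuous (g i)) ->
  continuous (fun w => \row_i g i w : 'rV[R]_n.+1).
Proof.
move=> cg w; have -> : (fun w => \row_i g i w) =
    fun w => \sum_i g i w *: delta_mx 0 i :> 'rV[R]_n.+1.
  apply/funext => v; rewrite [LHS]row_sum_delta.
  by apply: eq_bigr => i _; rewrite mxE.
apply: cvg_big => [|i _]; [exact: add_continuous|]; apply: cvgZr_tmp; exact: cg.
Qed.

Let coord_differentiable i w : differentiable (fun w => p i w.1 * q i w.2) w.
Proof.
have d1 : differentiable (fst : R * R -> R) w.
  by apply: (@linear_differentiable _ _ _ fst); move=> ?; exact: cvg_fst.
have d2 : differentiable (snd : R * R -> R) w.
  by apply: (@linear_differentiable _ _ _ snd); move=> ?; exact: cvg_snd.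
apply: differentiableM.
- apply: (differentiable_comp d1); apply/derivable1_diffP.
  by have [] := pE i w.1.
- apply: (differentiable_comp d2); apply/derivable1_diffP.
  by have [] := qE i w.2.
Qed.

Lemma coord_prod_differentiable w : differentiable coord_prod w.
Proof.
have -> : coord_prod = \sum_i fun w => (p i w.1 * q i w.2) *: delta_mx 0 i.
  apply/funext => v; rewrite fct_sumE [LHS]row_sum_delta.
  by apply: eq_bigr => i _; rewrite mxE.
by apply: differentiable_sum => i; exact: differentiableZl.
Qed.

Lemma coord_prod_derive w u :
  'D_u coord_prod w = \row_i (dp i w.1 * q i w.2 * u.1 + p i w.1 * dq i w.2 * u.2).
Proof.
rewrite derive_mx; last exact: diff_derivable (coord_prod_differentiable w).
apply/matrixP => a i; rewrite !mxE ord1.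
have -> : (fun t => coord_prod t 0 i) = fun w => p i w.1 * q i w.2.
  by apply/funext => v; rewrite mxE.
rewrite /derive.
have := pE i w.1; have := qE i w.2 => dQ dP.
have d1 : has_der (fun h => p i (h * u.1 + w.1)) 0 (dp i w.1 * u.1).
  apply: der_eq; first apply: (der_comp (b := dp i w.1)).
  - by rewrite mul0r add0r.
  - by der.
  - by cbv beta; ring.
have d2 : has_der (fun h => q i (h * u.2 + w.2)) 0 (dq i w.2 * u.2).
  apply: der_eq; first apply: (der_comp (b := dq i w.2)).
  - by rewrite mul0r add0r.
  - by der.
  - by cbv beta; ring.
have [_ H] := derM d1 d2.
transitivity ('D_1 (fun h : R => p i (h * u.1 + w.1) * q i (h * u.2 + w.2)) 0).
  rewrite /derive; apply: (congr1 (fun k => lim (k @ 0^'))); apply/funext => h /=.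
  by rewrite addr0 !mul0r !add0r [_%:A]mulr1.
by rewrite H !mul0r !add0r; ring.
Qed.

Lemma coord_prod_isometric b (phi : klein b -> R) lam (U : set (plane R)) :
  (forall w (u v : plane R), U w ->
     \sum_i (dp i w.1 * q i w.2 * u.1 + p i w.1 * dq i w.2 * u.2) *
            (dp i w.1 * q i w.2 * v.1 + p i w.1 * dq i w.2 * v.2) =
     (lam * phi (klein_pi b w)) ^+ 2 * (u.1 * v.1 + u.2 * v.2)) ->
  isometric_on phi lam U coord_prod.
Proof.
move=> H; split.
- by move=> w _; exact: coord_prod_differentiable.
- move=> w u _.
  have -> : 'D_u coord_prod =
      fun w => \row_i (dp i w.1 * q i w.2 * u.1 + p i w.1 * dq i w.2 * u.2).
    by apply/funext => v; exact: coord_prod_derive.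
  apply: row_continuous => i.
  have cp := is_derive_continuous (pE i); have cq := is_derive_continuous (qE i).
  have cd := @cdp i; have cd' := @cdq i.
  have c1 : continuous (fun z : plane R => z.1) by move=> z; exact: cvg_fst.
  have c2 : continuous (fun z : plane R => z.2) by move=> z; exact: cvg_snd.
  by apply: contD; apply: contM; try exact: cont_cst; apply: contM;
    apply: cont_comp.
- move=> w u v Uw; rewrite !coord_prod_derive -H //.
  by apply: eq_bigr => i _; rewrite !mxE.
Qed.

End CoordProd.

Section ExtremalCharts.
Local Open Scope classical_set_scope.
Local Open Scope ring_scope.
Context {R : realType} (b : R) (b0 : 0 < b).
Variable A : R.
Hypotheses (A0 : 0 < A) (AB : A <= b / 2).
Local Notation F := (fold b).
Local Notation phi := (@extremal R b A).

Lemma deck_deckf m k : deck b (deckf b m k).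
Proof.
have H0 : forall l, deck b (deckf b 0 l).
  elim/int_ind => [|j IH|j IH]; first by rewrite deckf0; exact: deck_id.
  - have -> : deckf b 0 j.+1 = vtrans b \o deckf b 0 j.
      apply/funext => z; rewrite /deckf /vtrans /= -addn1 PoszD intrD.
      by rewrite !expr0z; congr pair; ring.
    exact: deck_vtrans.
  - have -> : deckf b 0 (- j.+1%:Z) = vtrans (- b) \o deckf b 0 (- j%:Z).
      apply/funext => z; rewrite /deckf /vtrans /= -addn1 PoszD opprD intrD !intrN.
      by rewrite !expr0z; congr pair; ring.
    exact: deck_vtransV.
elim/int_ind: m k => [|j IH|j IH] k; first exact: H0.
- have -> : deckf b j.+1 k = @glide R \o deckf b j (- k).
    apply/funext => z; rewrite /deckf /glide /= -addn1 PoszD signzD1 intrD intrN.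
    by congr pair; ring.
  exact: deck_glide.
- have -> : deckf b (- j.+1%:Z) k = @glideV R \o deckf b (- j%:Z) (- k).
    apply/funext => z; rewrite /deckf /glideV /= -addn1 PoszD opprD signzB1 intrB !intrN.
    by congr pair; ring.
  exact: deck_glideV.
Qed.

Lemma norm_fold_deck g z : deck b g -> `|F (g z).2| = `|F z.2|.
Proof.
case/deck_normal => m [k ->]; rewrite /deckf /= foldDz //.
by case: (@signz R m) => ->; rewrite ?mul1r ?mulN1r ?foldN ?normrN.
Qed.

(* The curve |F y| = A of the Klein bottle. *)
Definition edge (_ : 'I_1) (t : R) : plane R := (2 * pi * t, A).

Lemma edge_piecewise_C1 i : piecewise_C1 (edge i).
Proof.
have dE (t : R) : is_derive t 1 (fun t => 2 * pi * t) (2 * pi).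
  by apply: der_eq; [der|cbv beta; ring].
exists 1%N, (fun i => i%:R); split => // [j _|j _]; first by rewrite ltr_nat.
split.
  apply: continuous_subspaceT; apply: cont_pair; last exact: cont_cst.
  exact: is_derive_continuous dE.
exists (fun=> (2 * pi, 0)); split.
  by apply: continuous_subspaceT; move=> t; exact: cvg_cst.
by move=> t _; apply: is_derive_pair => //; exact: is_derive_cst.
Qed.

Lemma off_edge z : off_curves b edge z <-> `|F z.2| != A.
Proof.
split=> [off|/eqP zA i t _ /klein_piP[g dg E]]; last first.
  by apply: zA; rewrite E (norm_fold_deck _ dg) /edge /= fold_id // ger0_norm // ltW.
apply/eqP => zA.
have [k Hk] := ex_rep b0 z.2; have E := norm_fold b0 Hk.
have p0 := pi_gt0 R.
have base (m : int) : z.2 = (-1) ^ m * A + k%:~R * b ->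
    0 <= (z.1 - m%:~R * pi) / (2 * pi) <= 1 -> False.
  move=> E2 t01; have := off ord0 ((z.1 - m%:~R * pi) / (2 * pi)).
  rewrite in_itv /= t01 => /(_ isT); apply; rewrite /edge.
  apply/klein_piP; exists (deckf b m k); first exact: deck_deckf.
  rewrite /deckf /= -E2 [LHS]surjective_pairing; congr pair.
  by move: (pi : R) p0 (m%:~R : R) => P P0 M; field; rewrite gt_eqF.
(* The parity of the power of sigma decides between the heights [A] and [- A]. An even power remains
   free to bring the abscissa into [[0, 2 pi]], the range of [edge]. *)
have two (l e : int) : (-1 : R) ^ (2 * l + e) = (-1) ^ e.
  by rewrite exprzDr ?signz_unit // -exprz_exp // -exprnP sqrrN expr1n exp1rz mul1r.
have [e eE] : exists e : int, z.2 = (-1) ^ e * A + k%:~R * b.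
  rewrite E in zA; move: zA; case: (ger0P (z.2 - k%:~R * b)) => _ <-; [exists 0|exists 1].
    by rewrite expr0z mul1r subrK.
  by rewrite expr1z mulN1r opprK subrK.
pose x := (z.1 - e%:~R * pi) / (2 * pi); pose l := Num.floor x.
apply: (base (2 * l + e)); first by rewrite two.
have := Num.Theory.floor_itv x; rewrite -/l !intrD => /andP[l0 /ltW l1].
have -> : (z.1 - ((2 * l)%:~R + e%:~R) * pi) / (2 * pi) = x - l%:~R.
  rewrite /x intrM; move: (pi : R) p0 (e%:~R : R) (l%:~R : R) => P P0 M L.
  by field; rewrite gt_eqF.
by rewrite subr_ge0 l0 lerBlDl.
Qed.

(** The chart is the inverse Mercator projection [(cos x / cosh s, sin x / cosh s, tanh s)], with
    [s = y - k b] measured from the multiple of [b] nearest to the given point. *)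
Lemma extremal_round_at z : `|F z.2| < A -> round_at phi 1 z.
Proof.
move=> zA; have [k Hk] := ex_rep b0 z.2; have E := norm_fold b0 Hk.
pose s (y : R) := y - k%:~R * b.
have ds (y : R) : is_derive y 1 s 1.
  by apply: der_eq; [rewrite /s; der|cbv beta; ring].
pose U : set (plane R) := [set w | `|s w.2| < A].
pose p (i : 'I_3) : R -> R := nth (fun=> 0) [:: cos; sin; fun=> 1] i.
pose dp (i : 'I_3) : R -> R := nth (fun=> 0) [:: (fun x => - sin x); cos; fun=> 0] i.
pose sech (y : R) := (cosh (s y))^-1.
pose dsech (y : R) := - (sinh (s y) / cosh (s y) ^+ 2).
pose th (y : R) := tanh (s y).
pose dth (y : R) := (cosh (s y) ^+ 2)^-1.
pose q (i : 'I_3) : R -> R := nth (fun=> 0) [:: sech; sech; th] i.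
pose dq (i : 'I_3) : R -> R := nth (fun=> 0) [:: dsech; dsech; dth] i.
have dsechE (y : R) : is_derive y 1 sech (dsech y).
  have := ds y => dsy.
  apply: der_eq; first exact: der_comp (is_derive_sech (s y)) dsy.
  by rewrite mulr1.
have dthE (y : R) : is_derive y 1 th (dth y).
  have := ds y => dsy.
  apply: der_eq; first exact: der_comp (is_derive_tanh (s y)) dsy.
  by rewrite mulr1.
have pE i (x : R) : is_derive x 1 (p i) (dp i x).
  case: i => [[|[|[|//]]] ?]; rewrite /p /dp /=.
  - exact: is_derive_cos.
  - exact: is_derive_sin.
  - exact: is_derive_cst.
have qE i (y : R) : is_derive y 1 (q i) (dq i y).
  by case: i => [[|[|[|//]]] ?]; rewrite /q /dq /=.
have cs : continuous s := is_derive_continuous ds.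
have cc := @continuous_cosh R; have csh := @continuous_sinh R.
have cdp i : continuous (dp i).
  by case: i => [[|[|[|//]]] ?]; rewrite /dp /=; cont.
have c0 y := cosh_neq0 (s y).
have cV : continuous (fun y => (cosh (s y) ^+ 2)^-1).
  by apply: contV => [y|]; [rewrite expf_neq0|apply: contX; exact: (cont_comp cc cs)].
have cdq i : continuous (dq i).
  case: i => [[|[|[|//]]] ?]; rewrite /dq /=; rewrite ?/dsech ?/dth.
  - by apply: contN; apply: contM; first exact: (cont_comp csh cs).
  - by apply: contN; apply: contM; first exact: (cont_comp csh cs).
  - exact: cV.
exists U, (coord_prod p q); split.
- have -> : U = (fun w => `|s w.2|) @^-1` [set x | x < A] by [].
  apply: open_comp; last exact: open_lt.
  move=> w _; apply: (cont_norm (f := fun w => s w.2)).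
  by move=> v; apply: (continuous_comp (f := snd)); [exact: cvg_snd|exact: cs].
- by rewrite /U /= /s -E.
- apply: (coord_prod_isometric pE qE cdp cdq) => w u v Uw.
  have -> : phi (klein_pi b w) = sech w.2.
    rewrite extremalE // /profile (norm_fold b0 (ltW (lt_le_trans Uw AB))).
    by rewrite min_l ?cosh_norm // ltW.
  rewrite !big_ord_recl big_ord0 /= /p /dp /q /dq /= /sech /dsech /dth.
  have := c0 w.2; have := cosh2_sinh2 (s w.2); have := cos2Dsin2 w.1.
  move: (cosh _) (sinh _) (cos _) (sin _) => c sh C S CS H cn.
  transitivity ((C ^+ 2 + S ^+ 2) * c ^- 2 * (u.1 * v.1) +
     ((C ^+ 2 + S ^+ 2) * sh ^+ 2 + 1) * c ^- 4 * (u.2 * v.2)).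
    by field.
  rewrite CS !mul1r [sh ^+ 2 + 1]addrC -H; by field.
- move=> w _; rewrite /dotp !big_ord_recl big_ord0 !mxE /p /q /= /sech /th /tanh.
  have := c0 w.2; have := cosh2_sinh2 (s w.2); have := cos2Dsin2 w.1.
  move: (cosh _) (sinh _) (cos _) (sin _) => c sh C S CS H cn.
  transitivity ((C ^+ 2 + S ^+ 2 + sh ^+ 2) / c ^+ 2); first by field.
  by rewrite CS -H divff // expf_neq0.
Qed.

Lemma extremal_flat_at z : cosh A = 2 -> A < `|F z.2| -> flat_at phi 1 z.
Proof.
move=> cA zA.
pose U : set (plane R) := [set w | A < `|F w.2|].
pose p (i : 'I_2) : R -> R := nth (fun=> 0) [:: (fun x => x / 2); fun=> 1] i.
pose dp (i : 'I_2) : R -> R := nth (fun=> 0) [:: (fun=> 1 / 2); fun=> 0] i.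
pose q (i : 'I_2) : R -> R := nth (fun=> 0) [:: (fun=> 1); fun y => y / 2] i.
pose dq (i : 'I_2) : R -> R := nth (fun=> 0) [:: (fun=> 0); fun=> 1 / 2] i.
have dh (x : R) : is_derive x 1 (fun x => x / 2) (1 / 2).
  by apply: der_eq; [der|cbv beta; ring].
have d1 (x : R) : is_derive x 1 (fun=> 1 : R) 0 by exact: is_derive_cst.
have pE i (x : R) : is_derive x 1 (p i) (dp i x).
  by case: i => [[|[|//]] ?]; rewrite /p /dp /=.
have qE i (x : R) : is_derive x 1 (q i) (dq i x).
  by case: i => [[|[|//]] ?]; rewrite /q /dq /=.
have cdp i : continuous (dp i).
  by case: i => [[|[|//]] ?]; rewrite /dp /=; exact: cont_cst.
have cdq i : continuous (dq i).
  by case: i => [[|[|//]] ?]; rewrite /dq /=; exact: cont_cst.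
exists U, (coord_prod p q); split => //.
- have -> : U = (fun w => `|F w.2|) @^-1` [set x | A < x] by [].
  apply: open_comp; last exact: open_gt.
  move=> w _; apply: (cont_norm (f := fun w => F w.2)).
  by move=> v; apply: (continuous_comp (f := snd)); [exact: cvg_snd|exact: fold_continuous].
- apply: (coord_prod_isometric pE qE cdp cdq) => w u v Uw.
  rewrite extremalE // /profile min_r ?ltW // cA.
  rewrite !big_ord_recl big_ord0 /= /p /dp /q /dq /=.
  by field.
Qed.

Lemma fold_zero : F 0 = 0.
Proof. by rewrite fold_id // normr0 divr_ge0 // ltW. Qed.

Lemma extremal_spherical : A = b / 2 -> spherical phi.
Proof.
move=> EA; exists 1, 1%N, edge; split => //; first exact: edge_piecewise_C1.
move=> z /off_edge zA; apply: extremal_round_at.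
by rewrite lt_neqAle zA EA fold_le.
Qed.

Lemma extremal_flat_spherical : A < b / 2 -> cosh A = 2 -> flat_spherical phi.
Proof.
move=> Ab cA; exists 1, 1%N, edge; split => //; first exact: edge_piecewise_C1.
- move=> z /off_edge; rewrite neq_lt => /orP[zA|zA].
    by left; exact: extremal_round_at.
  by right; exact: extremal_flat_at.
- have H : `|F (0, 0).2| < A by rewrite /= fold_zero normr0.
  exists (0, 0); last exact: extremal_round_at.
  by apply/off_edge; rewrite lt_eqF.
- have H : A < `|F (0, b / 2).2|.
    have bb : 0 <= b / 2 by rewrite divr_ge0 // ltW.
    by rewrite /= fold_id // ger0_norm.
  exists (0, b / 2); last exact: extremal_flat_at.
  by apply/off_edge; rewrite gt_eqF.
Qed.

End ExtremalCharts.

(** * The explicit constants of the two cases *)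

Section Constants.
Local Open Scope ring_scope.
Context {R : realType}.
Implicit Types b : R.

Lemma tanh_half b : tanh (b / 2) = (expR b - 1) / (expR b + 1).
Proof.
have E : expR b = expR (b / 2) ^+ 2 by rewrite expr2 -expRD; congr expR; field.
have e0 := expR_gt0 (b / 2).
rewrite /tanh /sinh /cosh expRN E; move: (expR _) e0 => e e0.
have n2 : e ^+ 2 + 1 != 0 by rewrite gt_eqF // addr_gt0 // exprn_gt0.
by field; rewrite n2 gt_eqF.
Qed.

Let s3 : Num.sqrt 3 ^+ 2 = 3 :> R. Proof. by rewrite sqr_sqrtr. Qed.

Let r0 : 0 < 2 + Num.sqrt 3 :> R.
Proof. by rewrite ltr_wpDr // sqrtr_ge0. Qed.

Lemma expRN_ln_2Dsqrt3 : expR (- ln (2 + Num.sqrt 3)) = 2 - Num.sqrt 3 :> R.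
Proof.
rewrite expRN lnK ?posrE //; apply: (mulfI (lt0r_neq0 r0)).
rewrite divff ?gt_eqF //; move: s3; set s := Num.sqrt 3 => H.
by transitivity (4 - s ^+ 2); [rewrite H; ring|ring].
Qed.

Lemma cosh_ln_2Dsqrt3 : cosh (ln (2 + Num.sqrt 3)) = 2 :> R.
Proof. by rewrite /cosh expRN_ln_2Dsqrt3 lnK ?posrE //; field. Qed.

Lemma tanh_ln_2Dsqrt3 : tanh (ln (2 + Num.sqrt 3)) = Num.sqrt 3 / 2 :> R.
Proof. by rewrite /tanh cosh_ln_2Dsqrt3 /sinh expRN_ln_2Dsqrt3 lnK ?posrE //; field. Qed.

Lemma ln_2Dsqrt3_gt0 : 0 < ln (2 + Num.sqrt 3) :> R.
Proof. by rewrite ln_gt0 //; have := sqrtr_ge0 (3 : R); lra. Qed.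

Lemma sin_pi3 : sin (pi / 3) = Num.sqrt 3 / 2 :> R.
Proof.
set u : R := pi / 3; have p0 := pi_gt0 R.
have c0 : 0 < cos u by apply: cos_gt0_pihalf; rewrite /u; lra.
have u0 : 0 < sin u by apply: sin_gt0_pi; rewrite /u; lra.
(* Because [2 pi / 3 = pi - pi / 3]; the duplication formula then gives [cos u = 1 / 2]. *)
have H : sin (u + u) = sin u.
  have -> : u + u = pi - u by rewrite /u; move: (pi : R) => P; field.
  by rewrite sinB sinpi cospi mul0r sub0r mulN1r opprK.
have c2 : cos u = 1 / 2.
  have s0 : sin u != 0 by rewrite gt_eqF.
  apply: (mulfI s0); rewrite sinD in H; move: (cos u) (sin u) H => C S H.
  by lra.
have S2 : sin u ^+ 2 = (Num.sqrt 3 / 2) ^+ 2.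
  by rewrite sin2cos2 c2 !expr_div_n s3; field.
by apply/eqP; rewrite -(@eqrXn2 _ 2) // ?S2 // ltW.
Qed.

Lemma asin_sqrt3 : asin (Num.sqrt 3 / 2) = pi / 3 :> R.
Proof.
rewrite -sin_pi3 sinK // in_itv /=; have := pi_gt0 R; move: (pi : R) => P ?.
by apply/andP; split; lra.
Qed.

End Constants.

Local Open Scope ring_scope.

Theorem theorem1p3 (R : realType) (beta : R) (beta_gt0 : 0 < beta) :
  (beta <= 2 * ln (2 + Num.sqrt 3) ->
     (forall phi : klein beta -> R, conformal_factor phi ->
        L_sigma phi * l_v phi <=
          (asin ((expR beta - 1) / (expR beta + 1)) /
           ((expR beta - 1) / (expR beta + 1))) * vol phi) /\
     (exists phi : klein beta -> R,
        [/\ conformal_factor phi, spherical phi &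
            L_sigma phi * l_v phi =
          (asin ((expR beta - 1) / (expR beta + 1)) /
           ((expR beta - 1) / (expR beta + 1))) * vol phi])) /\
  (2 * ln (2 + Num.sqrt 3) < beta ->
     (forall phi : klein beta -> R, conformal_factor phi ->
        L_sigma phi * l_v phi <=
          (2 / 3 *
           ((3 * beta + 4 * pi - 6 * ln (2 + Num.sqrt 3)) /
            (4 * Num.sqrt 3 + beta - 2 * ln (2 + Num.sqrt 3)))) * vol phi) /\
     (exists phi : klein beta -> R,
        [/\ conformal_factor phi, flat_spherical phi &
            L_sigma phi * l_v phi =
          (2 / 3 *
           ((3 * beta + 4 * pi - 6 * ln (2 + Num.sqrt 3)) /
            (4 * Num.sqrt 3 + beta - 2 * ln (2 + Num.sqrt 3)))) * vol phi])).
Proof.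
have le_div (E X I v : R) : 0 < E -> E * X <= I * v -> X <= I / E * v.
  by move=> E0 H; rewrite -mulrA [E^-1 * v]mulrC mulrA ler_pdivlMr // mulrC.
have eq_div (E X I v : R) : 0 < E -> E * X = I * v -> X = I / E * v.
  by move=> E0 H; rewrite mulrAC -H mulrAC divff ?mul1r // gt_eqF.
split=> [b_le|b_gt].
- have A0 : 0 < beta / 2 by rewrite divr_gt0.
  have cA : cosh (beta / 2) <= 2.
    rewrite -[leRHS]cosh_ln_2Dsqrt3; apply: le_cosh; first exact: ltW.
    by rewrite ler_pdivrMr // mulrC.
  have T0 : 0 < tanh (beta / 2) by rewrite /tanh divr_gt0 ?sinh_gt0 ?cosh_gt0.
  rewrite -tanh_half; split=> [phi cphi|].
    apply: le_div => //.
    have := sharp_bound beta_gt0 cphi (ltW A0) (lexx _) cA.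
    by rewrite subrr !mul0r !addr0.
  exists (@extremal R beta (beta / 2)); split.
  + exact: extremal_conformal.
  + exact: extremal_spherical.
  + apply: eq_div => //.
    have := extremal_equality beta_gt0 (ltW A0) (lexx _) cA (or_introl erefl).
    by rewrite subrr !mul0r !addr0.
- set A : R := ln (2 + Num.sqrt 3) in b_gt *.
  have A0 : 0 < A := ln_2Dsqrt3_gt0.
  have Ab : A < beta / 2 by rewrite ltr_pdivlMr // mulrC.
  have cA : cosh A = 2 := cosh_ln_2Dsqrt3.
  have cA2 : cosh A <= 2 by rewrite cA.
  have tA : tanh A = Num.sqrt 3 / 2 := tanh_ln_2Dsqrt3.
  have E0 : 0 < tanh A + (beta / 2 - A) / 4.
    rewrite ltr_wpDl ?divr_gt0 ?subr_gt0 //.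
    by rewrite tA divr_ge0 // sqrtr_ge0.
  (* With [tanh A = sqrt 3 / 2] and [asin (tanh A) = pi / 3], the numerator on the right is
     multiplied by 12 and the denominator by 8, whence the factor [2 / 3]. *)
  have -> : 2 / 3 * ((3 * beta + 4 * pi - 6 * A) / (4 * Num.sqrt 3 + beta - 2 * A)) =
      (asin (tanh A) + (beta / 2 - A) / 2) / (tanh A + (beta / 2 - A) / 4).
    rewrite tA asin_sqrt3; rewrite tA in E0.
    move: (pi : R) (Num.sqrt 3) E0 => P s E0.
    have D0 : 4 * s + beta - 2 * A != 0 by rewrite gt_eqF //; lra.
    by field; rewrite D0 gt_eqF //; lra.
  split=> [phi cphi|].
    by apply: le_div => //; exact: (sharp_bound beta_gt0 cphi (ltW A0) (ltW Ab)).
  exists (@extremal R beta A); split.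
  + exact: extremal_conformal.
  + by apply: extremal_flat_spherical => //; exact: ltW.
  + apply: eq_div => //.
    exact: (extremal_equality beta_gt0 (ltW A0) (ltW Ab) cA2 (or_intror cA)).
Qed.
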